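(* Let $X$ be a locally compact, second countable Hausdorff topological space, and let $\rho$ be a measure on $(\Gamma_{X,0},\mathcal B(\Gamma_{X,0}))$ satisfying: (N) $\rho(\Gamma_X^{(0)})=1$; (PD) for each $G\in\mathcal S$: $\int_{\Gamma_{X,0}}(G\star G)(\eta)\,\rho(d\eta)\ge0$; (LB) there are constants $C_\Delta>0$, $\Delta\in\mathcal B_0(X)$, such that $\rho(\Gamma_\Delta^{(n)})\le C_\Delta^n$ for all $\Delta\in\mathcal B_0(X)$ and $n\in\mathbb N$, where $\Gamma_\Delta^{(n)}:=\{\eta\in\Gamma_X^{(n)}\mid\eta\subset\Delta\}$, and such that, for any sequence $(\Delta_n)_{n\in\mathbb N}$ in $\mathcal B_0(X)$ with $\Delta_n\downarrow\varnothing$, one has $C_{\Delta_n}\to0$ as $n\to\infty$. Then there exists a unique probability measure on $(\Gamma_X,\mathcal B(\Gamma_X))$ which has $\rho$ as correlation measure.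
   Context: Spaces. $\mathcal B(X)$ is the Borel $\sigma$-algebra of $X$, and $\mathcal B_0(X)$ is the collection of relatively compact sets in $\mathcal B(X)$. $\mathbb N=\{1,2,\dots\}$, $\mathbb N_0=\{0,1,2,\dots\}$. The space of finite multiple configurations is $\ddot\Gamma_{X,0}:=\bigsqcup_{n\in\mathbb N_0}\ddot\Gamma_X^{(n)}$, where $\ddot\Gamma_X^{(0)}=\{\varnothing\}$ and, for $n\in\mathbb N$, $\ddot\Gamma_X^{(n)}=X^n/S_n$ ($S_n$ permuting coordinates), with elements $[x_1,\dots,x_n]$; $\mathcal B(\ddot\Gamma_X^{(n)})$ is the image of $\mathcal B(X^n)$ under $(x_1,\dots,x_n)\mapsto[x_1,\dots,x_n]$. Functions on $\ddot\Gamma_X^{(n)}$ are identified with symmetric functions on $X^n$. An element $[x_1,\dots,x_n]$ is also identified with the measure $\varepsilon_{x_1}+\dots+\varepsilon_{x_n}$ ($\varepsilon_x$ the Dirac measure at $x$), and $\varnothing$ with the zero measure. $\Gamma_X^{(n)}\subset\ddot\Gamma_X^{(n)}$ is the subset of those $[x_1,\dots,x_n]$ with $x_1,\dots,x_n$ pairwise different (identified with the set $\{x_1,\dots,x_n\}$), $\Gamma_X^{(0)}=\{\varnothing\}$, and $\Gamma_{X,0}:=\bigsqcup_{n\in\mathbb N_0}\Gamma_X^{(n)}$ is the space of finite configurations. $\Gamma_X^{(n)}$ carries the trace $\sigma$-algebra $\mathcal B(\Gamma_X^{(n)})$ of $\mathcal B(\ddot\Gamma_X^{(n)})$, and $\mathcal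 B(\Gamma_{X,0})$ is the $\sigma$-algebra on $\Gamma_{X,0}$ whose restriction to each $\Gamma_X^{(n)}$ is $\mathcal B(\Gamma_X^{(n)})$, with $\{\varnothing\}\in\mathcal B(\Gamma_{X,0})$. The configuration space is $\Gamma_X:=\{\gamma\subset X: |\gamma\cap\Delta|<\infty\text{ for each }\Delta\in\mathcal B_0(X)\}$ with $\mathcal B(\Gamma_X)$ the minimal $\sigma$-algebra making all maps $\gamma\mapsto|\gamma\cap\Delta|$, $\Delta\in\mathcal B_0(X)$, measurable. $\eta\Subset\gamma$ means that $\eta$ is a finite subset of $\gamma$ (including $\varnothing$). The class $\mathcal S$. $\chi_A$ is the indicator of $A$ and $f_1\odot\dots\odot f_n$ is the symmetric tensor product, i.e. the symmetrization of $f_1(x_1)\cdots f_n(x_n)$, viewed as a function on $\ddot\Gamma_X^{(n)}$. For $G:\ddot\Gamma_{X,0}\to\mathbb R$, $G^{(n)}$ is its restriction to $\ddot\Gamma_X^{(n)}$. $\mathcal S$ is the set of all $G:\ddot\Gamma_{X,0}\to\mathbb R$ for which there is $N\in\mathbb N$ with $G^{(n)}=0$ for $n>N$ and such that for each $n\in\{1,\dots,N\}$, $G^{(n)}$ is a finite (real) linear combination of functions $\chi_{\Delta_1}\odot\dots\odot\chi_{\Delta_n}$ with $\Delta_1,\dots,\Delta_n\in\mathcal B_0(X)$. The convolution $\star$. For $G_1,G_2\in\mathcal S$, $(G_1\star G_2)(\eta):=\sum G_1(\xi_1+\xi_2)G_2(\xi_2+\xi_3)$, the sum being over all $\xi_1,\xi_2,\xi_3\in\ddot\Gamma_{X,0}$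 with $\xi_1+\xi_2+\xi_3=\eta$ (for $\eta\in\Gamma_{X,0}$ this is the sum over all ordered partitions of the set $\eta$ into three, possibly empty, disjoint subsets). Correlation measure. $\rho$ is the correlation measure of a probability measure $\mu$ on $(\Gamma_X,\mathcal B(\Gamma_X))$ if each $G\in\mathcal S$ is $\rho$-integrable and $\int_{\Gamma_{X,0}}G(\eta)\,\rho(d\eta)=\int_{\Gamma_X}\sum_{\eta\Subset\gamma}G(\eta)\,\mu(d\gamma)$ for all $G\in\mathcal S$.
   Formalization: In (LB) the condition C_Δ > 0 is replaced by C_Δ ≥ 0: with C_Δ > 0 the constant sequence Δ_n = ∅ would force C_∅ → 0 and contradict C_∅ > 0, so (LB) could never hold as written. *)

(* Defs.v *)
From HB Require Import structures.
From mathcomp Require Import all_boot all_order all_algebra all_fingroup.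
From mathcomp Require Import finmap multiset.
From mathcomp Require Import all_classical all_reals all_analysis.

Set Implicit Arguments.
Unset Strict Implicit.
Unset Printing Implicit Defensive.

Import Order.TTheory GRing.Theory Num.Theory.
Import numFieldNormedType.Exports.

Local Open Scope classical_set_scope.
Local Open Scope ring_scope.

Definition borel (T : topologicalType) : set (set T) := <<s [set A | open A] >>.

Definition precompact_borel (X : topologicalType) : set (set X) :=
  [set D | borel D /\ precompact D].

(* A finite multiple configuration is a finite multiset of points of X, so that
   the disjoint union of the X^n / S_n is the whole type {mset X}, and the sum of
   the associated measures is the sum of multisets. *)
Definition mconf (X : topologicalType) (n : nat) (x : 'I_n -> X) : {mset X}%mset :=
  seq_mset (codom x).

(* X^n carries the Borel sigma-algebra of the product topology. *)
Definition borel_mconf (X : topologicalType) (n : nat) : set (set {mset X}%mset) :=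
  [set @mconf X n @` B | B in @borel {ptws 'I_n -> X}].

Definition fconf (X : topologicalType) : Type := {fset X}.

HB.instance Definition _ (X : topologicalType) := Choice.on (fconf X).
HB.instance Definition _ (X : topologicalType) :=
  isPointed.Build (fconf X) fset0.

Definition mset_of_fconf (X : topologicalType) (eta : fconf X) : {mset X}%mset :=
  seq_mset (eta : {fset X}).

Definition fconf_card (X : topologicalType) (n : nat) : set (fconf X) :=
  [set eta | #|` eta| = n].
Arguments fconf_card : clear implicits.

Definition fconf_in (X : topologicalType) (D : set X) (n : nat) :
    set (fconf X) :=
  [set eta | fconf_card X n eta /\ [set` (eta : {fset X})] `<=` D].

(* The trace of borel_mconf X n on the configurations of n distinct points,
   under the identification of a finite set with a multiset. *)
Definition borel_fconf_card (X : topologicalType) (n : nat) :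
    set (set (fconf X)) :=
  preimage_set_system setT (@mset_of_fconf X) (@borel_mconf X n).

Definition borel_fconf (X : topologicalType) : set (set (fconf X)) :=
  [set A | forall n, borel_fconf_card n (A `&` fconf_card X n)].

Lemma borel_preimage (S T : topologicalType) (f : S -> T) :
  continuous f -> forall A, borel A -> borel (f @^-1` A).
Proof.
move=> cf; pose F := [set A | borel (f @^-1` A)].
suff: <<s [set A : set T | open A] >> `<=` F by [].
apply: smallest_sub.
  split => [|A FA|A FA].
  - exact: sigma_algebra0.
  - by rewrite /F /= setTD preimage_setC -setTD; exact: sigma_algebraCD.
  - by rewrite /F /= preimage_bigcup; exact: sigma_algebra_bigcup.
move=> A oA; apply: sub_sigma_algebra.
by apply: open_comp => // x _; exact: cf.
Qed.

Lemma mconf_eqP (X : topologicalType) n (x y : 'I_n -> X) :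
  mconf x = mconf y <-> exists s : 'S_n, x = y \o s.
Proof.
have cE (z : 'I_n -> X) : codom z = [tuple z i | i < n] :> seq X by [].
rewrite /mconf; split => [/eq_seq_msetP|[s ->]].
  rewrite cE (cE y) => /tuple_permP[s sE]; exists s.
  apply/funext => i /=.
  have /(congr1 (fun t => tnth t i)) :
    [tuple x j | j < n] = [tuple tnth [tuple y k | k < n] (s j) | j < n].
    exact: val_inj.
  by rewrite !tnth_mktuple.
apply/eq_seq_msetP; rewrite cE (cE y); apply/tuple_permP; exists s.
by congr val; apply: eq_from_tnth => i; rewrite !tnth_mktuple.
Qed.

Lemma comp_perm_continuous (X : topologicalType) n (s : 'S_n) :
  continuous ((fun x => x \o s) : {ptws 'I_n -> X} -> {ptws 'I_n -> X}).
Proof.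
move=> x; pose F := (fun y : {ptws 'I_n -> X} => y \o s : {ptws 'I_n -> X}) @ x.
have FF : Filter F by apply: fmap_filter; exact: nbhs_filter.
suff: F --> (x \o s : {ptws 'I_n -> X}) by [].
apply/cvg_sup => i U [V] [[W] oW <-] Wx /filterS; apply.
apply: (@proj_continuous 'I_n (fun=> X) (s i) x).
by apply: open_nbhs_nbhs; split.
Qed.

Lemma borel_mconfP (X : topologicalType) n (A : set ({mset X}%mset)) :
  borel_mconf n A <->
  A `<=` range (@mconf X n) /\ borel (@mconf X n @^-1` A : set {ptws 'I_n -> X}).
Proof.
split=> [[B mB <-]|[Ar mA]]; last first.
  exists (@mconf X n @^-1` A) => //; apply/seteqP; split => [_ [x Ax <-]//|e Ae].
  by have [x _ xe] := Ar _ Ae; exists x => //; rewrite /preimage /= xe.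
split; first by move=> _ [x _ <-]; exists x.
pose E (k : nat) : set {ptws 'I_n -> X} :=
  if insub k is Some j then
    (fun x : {ptws 'I_n -> X} => x \o (enum_val (j : 'I_#|'S_n|) : 'S_n)) @^-1` B
  else set0.
rewrite [X in borel X](_ : _ = \bigcup_k E k); last first.
  apply/seteqP; split=> [x /= [y By /mconf_eqP[s yE]]|x].
    exists (enum_rank s : nat) => //; rewrite /E valK /preimage /= enum_rankK.
    by rewrite -yE.
  case=> k _; rewrite /E; case: insub => [j|] //= Bx.
  exists (x \o (enum_val j : 'S_n)) => //.
  by apply/mconf_eqP; exists (enum_val j).
apply: sigma_algebra_bigcup => k; rewrite /E; case: insub => [j|]; last first.
  exact: sigma_algebra0.
apply: borel_preimage mB; exact: comp_perm_continuous.
Qed.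

Lemma borel_fconf_cardP (X : topologicalType) n (A : set (fconf X)) :
  borel_fconf_card n (A `&` fconf_card X n) <->
  exists2 B : set {mset X}%mset,
    borel (@mconf X n @^-1` B : set {ptws 'I_n -> X}) &
    forall eta : fconf X, fconf_card X n eta ->
      (A eta <-> B (mset_of_fconf eta)).
Proof.
have szE (eta : fconf X) (x : 'I_n -> X) :
    mconf x = mset_of_fconf eta -> fconf_card X n eta.
  move/eq_seq_msetP/perm_size; rewrite size_codom card_ord => nE.
  by rewrite /fconf_card /= nE.
have exE (eta : fconf X) : fconf_card X n eta ->
    exists x : 'I_n -> X, mconf x = mset_of_fconf eta.
  move=> /eqP etan; exists (tnth (Tuple etan)).
  rewrite /mconf /mset_of_fconf; congr seq_mset.
  by rewrite codomE map_tnth_enum.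
split=> [[B /borel_mconfP[Bn mB] BE]|[B mB BE]].
  exists B => // eta etan; split=> [Ae|Be].
    have : (A `&` fconf_card X n) eta by [].
    by rewrite -BE => -[].
  have : (A `&` fconf_card X n) eta by rewrite -BE.
  by case.
exists (B `&` range (@mconf X n)).
  apply/borel_mconfP; split; first by move=> ? [].
  rewrite preimage_setI preimage_range setIT; exact: mB.
apply/seteqP; split=> [eta [_ [Be [x _ xE]]]|eta [Ae etan]].
  by have etan := szE _ _ xE; split=> //; apply/BE.
split=> //; split; first exact/BE.
by have [x <-] := exE _ etan; exists x.
Qed.

Lemma borel_fconf0 (X : topologicalType) : borel_fconf (set0 : set (fconf X)).
Proof.
move=> n; apply/borel_fconf_cardP; exists set0 => //.
by rewrite preimage_set0; exact: sigma_algebra0.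
Qed.

Lemma borel_fconfC (X : topologicalType) (A : set (fconf X)) :
  borel_fconf A -> borel_fconf (~` A).
Proof.
move=> mA n; have /borel_fconf_cardP[B mB BE] := mA n.
apply/borel_fconf_cardP; exists (~` B).
  by rewrite preimage_setC -setTD; exact: sigma_algebraCD.
by move=> eta etan; split=> nA /(BE _ etan).
Qed.

Lemma borel_fconf_bigcup (X : topologicalType) (F : (set (fconf X))^nat) :
  (forall i, borel_fconf (F i)) -> borel_fconf (\bigcup_i F i).
Proof.
move=> mF n.
have /choice[B BP] : forall i, exists B : set {mset X}%mset,
    borel (@mconf X n @^-1` B : set {ptws 'I_n -> X}) /\
    forall eta : fconf X, fconf_card X n eta ->
      (F i eta <-> B (mset_of_fconf eta)).
  by move=> i; have /borel_fconf_cardP[B mB BE] := mF i n; exists B.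
apply/borel_fconf_cardP; exists (\bigcup_i B i).
  rewrite preimage_bigcup; apply: sigma_algebra_bigcup => i.
  by have [] := BP i.
move=> eta etan; split=> -[i _ Fi]; exists i => //.
  exact/(BP i).2.
exact/((BP i).2 eta etan).
Qed.

Fact fconf_display : measure_display. Proof. exact. Qed.

HB.instance Definition _ (X : topologicalType) :=
  isMeasurable.Build fconf_display (fconf X)
    (@borel_fconf0 X) (@borel_fconfC X) (@borel_fconf_bigcup X).

Definition locally_finite (X : topologicalType) : set (set X) :=
  [set g | forall D, precompact_borel D -> finite_set (g `&` D)].

Definition conf (X : topologicalType) : Type := set_type (@locally_finite X).

HB.instance Definition _ (X : topologicalType) := Choice.on (conf X).

Lemma locally_finite0 (X : topologicalType) :
  (set0 : set X) \in @locally_finite X.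
Proof. by apply/mem_set => D _; rewrite set0I; exact: finite_set0. Qed.

HB.instance Definition _ (X : topologicalType) :=
  isPointed.Build (conf X) (exist _ set0 (@locally_finite0 X)).

Definition conf_count (X : topologicalType) (D : set X) (g : conf X) : nat :=
  #|` fset_set (val g `&` D)|.

Definition conf_gen (X : topologicalType) : set (set (conf X)) :=
  \bigcup_(D in @precompact_borel X)
    preimage_set_system setT (@conf_count X D) measurable.

Notation borel_conf X := (g_sigma_algebraType (@conf_gen X)).

Definition symtens (R : realType) (X : topologicalType) (n : nat)
    (f : 'I_n -> X -> R) (x : 'I_n -> X) : R :=
  (n`!%:R)^-1 * \sum_(s : 'S_n) \prod_(i < n) f i (x (s i)).

(* The value of G at the empty configuration is unconstrained. *)
Definition classS (R : realType) (X : topologicalType) :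
    set ({mset X}%mset -> R) :=
  [set G | exists2 N : nat, (0 < N)%N &
    (forall n, (N < n)%N -> forall x : 'I_n -> X, G (mconf x) = 0) /\
    (forall n, (0 < n <= N)%N ->
      exists (m : nat) (c : 'I_m -> R) (D : 'I_m -> 'I_n -> set X),
        (forall j i, precompact_borel (D j i)) /\
        forall x : 'I_n -> X,
          G (mconf x) = \sum_(j < m) c j * symtens (fun i => \1_(D j i)) x)].

Definition star (R : realType) (X : topologicalType)
    (G1 G2 : {mset X}%mset -> R) (eta : {mset X}%mset) : R :=
  \sum_(p \in [set p : {mset X}%mset * {mset X}%mset * {mset X}%mset |
                  (p.1.1 `+` p.1.2 `+` p.2)%mset = eta])
    G1 (p.1.1 `+` p.1.2)%mset * G2 (p.1.2 `+` p.2)%mset.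

Definition positive_definite (R : realType) (X : topologicalType)
    (rho : {measure set (fconf X) -> \bar R}) : Prop :=
  forall G, @classS R X G ->
    (0 <= \int[rho]_eta (star G G (mset_of_fconf eta))%:E)%E.

(* C D = 0 is allowed: the constant sequence equal to set0 decreases to set0, so
   that requiring 0 < C set0 would make the condition on C contradictory. *)
Definition local_bound (R : realType) (X : topologicalType)
    (rho : {measure set (fconf X) -> \bar R}) : Prop :=
  exists C : set X -> R,
    [/\ forall D, precompact_borel D -> 0 <= C D,
        forall D, precompact_borel D -> forall n, (0 < n)%N ->
          (rho (fconf_in D n) <= (C D ^+ n)%:E)%E &
        forall D : (set X)^nat,
          (forall n, precompact_borel (D n)) ->
          (forall n, D n.+1 `<=` D n) -> \bigcap_n D n = set0 ->
          (C (D n) @[n --> \oo] --> (0 : R))].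

(* The sum over the finite subsets of a configuration g; for G in classS it has
   finitely many nonzero terms. *)
Definition sum_finite_sub (R : realType) (X : topologicalType)
    (G : {mset X}%mset -> R) (g : conf X) : R :=
  \sum_(eta \in [set eta : fconf X | [set` (eta : {fset X})] `<=` val g])
    G (mset_of_fconf eta).

Definition correlation_measure (R : realType) (X : topologicalType)
    (rho : {measure set (fconf X) -> \bar R})
    (mu : probability (borel_conf X) R) : Prop :=
  forall G, @classS R X G ->
    rho.-integrable setT (fun eta => (G (mset_of_fconf eta))%:E) /\
    (\int[rho]_eta (G (mset_of_fconf eta))%:E
     = \int[mu]_g (sum_finite_sub G g)%:E)%E.

(* Main.v *)
Require Import Defs.
From HB Require Import structures.
From mathcomp Require Import all_boot all_order all_algebra all_fingroup.
From mathcomp Require Import finmap multiset.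
From mathcomp Require Import all_classical all_reals all_analysis.
From mathcomp Require Import measurable_realfun.
From mathcomp Require Import ring lra zify.

Set Implicit Arguments.
Unset Strict Implicit.
Unset Printing Implicit Defensive.

Import Order.TTheory GRing.Theory Num.Theory.
Import numFieldNormedType.Exports.

Local Open Scope classical_set_scope.
Local Open Scope ring_scope.

(* On functions F of finite configurations put L(F) = int mob F d rho, where mob is
   Moebius inversion over subsets; if F sums a function G over subsets, then L(F) is
   the integral of G.  Since the subset sums of G * G are the square of those of G,
   (PD) says that L is positive on the algebra of polynomials in the counting
   functions.  By (LB) and the Cauchy-Schwarz inequality every point has a
   neighbourhood D on which |eta| has a large exponential rho-moment; there the
   truncated Moebius expansions of a function of the configuration in D are Cauchy in
   L^2 of L.  Processing the cells of a countable cover by such sets one at a time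
   extends L, with its positivity, to indicators of cylinder sets and so defines a
   content.  A finitely additive content may fail to be sigma-additive only by
   losing points to the boundaries of the cells or by merging points; both events
   have small content by Markov's inequality for L, and otherwise limits along an
   ultrafilter exist.  Bounds on second moments identify the moments of the resulting
   measure, and show that any measure with these moments agrees with it on cylinder
   sets. *)

(** * Moebius inversion over finite subsets *)

(** (PD) makes L nonnegative on squares of polynomials, and a nonnegative function need not be such
    a square. An indicator, however, is its own square; so the effort goes into an algebra that
    contains the indicators and on which squares still have nonnegative value. Markov's inequality
    is obtained in the same way, from square roots of differences.

    Moebius expansions of indicators are controlled only where the exponential moment is finite.
    This is a local property that need not pass from cells to their union; hence one cell at a time,
    with a factor that depends on the outside of the cell kept as a fixed L^2 function.

    Locally, (LB) controls sets that shrink to the empty set, while neighbourhoods of a point x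
    shrink to {x}, which configurations may charge. So (LB) is applied to punctured neighbourhoods,
    and x is put back by Cauchy-Schwarz. That inequality halves the exponent of the geometric decay,
    whence the base 255 * 256 * 256 asked for before x is added and the base 255 that remains
    afterwards. *)

Section subset_sums.
Context {K : choiceType} {R : realFieldType}.
Implicit Types (A B Z : {fset K}) (F G : {fset K} -> R).

(** On finite configurations this is the K-transform; [mob] is its inverse ([mob_zeta],
    [zeta_mob]). *)
Definition zeta F A : R := \sum_(B <- fpowerset A) F B.

Definition mob F A : R :=
  \sum_(B <- fpowerset A) (-1) ^+ (#|` A| - #|` B|) * F B.

Lemma sum_fpowersetU1 F x A : x \notin A ->
  \sum_(B <- fpowerset (x |` A)%fset) F B =
  \sum_(B <- fpowerset A) F B + \sum_(B <- fpowerset A) F (x |` B)%fset.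
Proof.
move=> xA; rewrite -(big_map (fun B => (x |` B)%fset) xpredT F) -big_cat.
apply: perm_big; apply: uniq_perm; first exact: fset_uniq.
  rewrite cat_uniq fset_uniq /=; apply/andP; split.
    apply/hasPn => y /mapP[B]; rewrite fpowersetE => BA ->.
    rewrite fpowersetE; apply/negP => /fsubsetP/(_ x).
    by rewrite fset1U1 (negbTE xA) => /(_ isT).
  rewrite map_inj_in_uniq ?fset_uniq// => B C; rewrite !fpowersetE.
  move=> /fsubsetP BA /fsubsetP CA BC.
  have xB : x \notin B by apply: contra xA => /BA.
  have xC : x \notin C by apply: contra xA => /CA.
  by rewrite -(fsetU1K xB) BC fsetU1K.
move=> B; rewrite mem_cat !fpowersetE; apply/idP/orP => [BxA|].
  have [xB|xB] := boolP (x \in B).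
    right; apply/mapP; exists (B `\ x)%fset; last by rewrite fsetD1K.
    by rewrite fpowersetE fsubDset.
  left; apply/fsubsetP => y yB; have /fsubsetP/(_ y yB) := BxA.
  by rewrite !inE => /orP[/eqP yx|//]; rewrite -yx yB in xB.
case=> [BA|/mapP[C]]; first exact: fsubset_trans BA (fsubsetU1 _ _).
by rewrite fpowersetE => CA ->; exact: fsetUS.
Qed.

Lemma eq_zeta F G A : (forall B, (B `<=` A)%fset -> F B = G B) ->
  zeta F A = zeta G A.
Proof.
by move=> FG; apply: eq_big_seq => B; rewrite fpowersetE => /FG.
Qed.

Lemma eq_mob F G A : (forall B, (B `<=` A)%fset -> F B = G B) ->
  mob F A = mob G A.
Proof.
by move=> FG; apply: eq_big_seq => B; rewrite fpowersetE => /FG ->.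
Qed.

Lemma zeta0 F : zeta F fset0 = F fset0.
Proof. by rewrite /zeta fpowerset0 big_seq_fset1. Qed.

Lemma mob0 F : mob F fset0 = F fset0.
Proof. by rewrite /mob fpowerset0 big_seq_fset1 subnn expr0 mul1r. Qed.

Lemma zetaU1 F x A : x \notin A ->
  zeta F (x |` A)%fset = zeta F A + zeta (fun B => F (x |` B)%fset) A.
Proof. exact: sum_fpowersetU1. Qed.

(** Subsets with and without [x] enter with opposite signs, so each point contributes one difference
    operator. In particular [mob F] vanishes on a set with a point that [F] ignores ([mob_loc]). *)
Lemma mobU1 F x A : x \notin A ->
  mob F (x |` A)%fset = mob (fun B => F (x |` B)%fset) A - mob F A.
Proof.
move=> xA; rewrite /mob sum_fpowersetU1// addrC cardfsU1 xA add1n.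
congr (_ + _).
  apply: eq_big_seq => B; rewrite fpowersetE => BA.
  by rewrite cardfsU1 (contra (fsubsetP BA x) xA) add1n subSS.
rewrite -sumrN; apply: eq_big_seq => B; rewrite fpowersetE => BA.
by rewrite subSn ?fsubset_leq_card// exprS mulN1r mulNr.
Qed.

Lemma zetaD F G A : zeta (fun B => F B + G B) A = zeta F A + zeta G A.
Proof. exact: big_split. Qed.

Lemma mobD F G A : mob (fun B => F B + G B) A = mob F A + mob G A.
Proof. by rewrite /mob -big_split; apply: eq_bigr => B _; rewrite mulrDr. Qed.

Lemma zetaZ c F A : zeta (fun B => c * F B) A = c * zeta F A.
Proof. by rewrite /zeta mulr_sumr. Qed.

Lemma mobZ c F A : mob (fun B => c * F B) A = c * mob F A.
Proof. by rewrite /mob mulr_sumr; apply: eq_bigr => B _; rewrite mulrCA. Qed.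

Lemma mobN F A : mob (fun B => - F B) A = - mob F A.
Proof. by rewrite /mob -sumrN; apply: eq_bigr => B _; rewrite mulrN. Qed.

Lemma mobB F G A : mob (fun B => F B - G B) A = mob F A - mob G A.
Proof. by rewrite mobD mobN. Qed.

Lemma mob_cst0 A : mob (fun=> 0) A = 0.
Proof. by rewrite /mob big1// => B _; rewrite mulr0. Qed.

Lemma mob_sum I (r : seq I) (P : pred I) (F : I -> {fset K} -> R) A :
  mob (fun B => \sum_(i <- r | P i) F i B) A = \sum_(i <- r | P i) mob (F i) A.
Proof.
by rewrite /mob exchange_big/=; apply: eq_bigr => B _; rewrite mulr_sumr.
Qed.

Lemma mob_zeta F A : mob (zeta F) A = F A.
Proof.
elim/fset1U_rect: A F => [|x A xA IH] F; first by rewrite mob0 zeta0.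
rewrite mobU1// (@eq_mob _ (fun B => zeta F B + zeta (fun B => F (x |` B)%fset) B)).
  by rewrite mobD addrC addKr IH.
by move=> B BA; rewrite zetaU1// (contra (fsubsetP BA x) xA).
Qed.

Lemma zeta_mob F A : zeta (mob F) A = F A.
Proof.
elim/fset1U_rect: A F => [|x A xA IH] F; first by rewrite zeta0 mob0.
rewrite zetaU1// IH.
rewrite (@eq_zeta _ (fun B => mob (fun B => F (x |` B)%fset) B + -1 * mob F B)).
  by rewrite zetaD zetaZ !IH mulN1r addrC subrK.
by move=> B BA; rewrite mobU1 ?mulN1r// (contra (fsubsetP BA x) xA).
Qed.

Lemma zeta_exp c A : zeta (fun B => c ^+ #|` B|) A = (1 + c) ^+ #|` A|.
Proof.
elim/fset1U_rect: A => [|x A xA IH]; first by rewrite zeta0 cardfs0.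
rewrite zetaU1// IH cardfsU1 xA add1n exprS mulrDl mul1r; congr (_ + _).
rewrite -IH -zetaZ; apply: eq_zeta => B BA.
by rewrite cardfsU1 (contra (fsubsetP BA x) xA) exprS.
Qed.

Lemma mob_exp c A : mob (fun B => (1 + c) ^+ #|` B|) A = c ^+ #|` A|.
Proof.
by rewrite -[RHS](mob_zeta (fun B => c ^+ #|` B|)); apply: eq_mob => B _; rewrite zeta_exp.
Qed.

(** Absolute values remove the signs, and [zeta_exp] turns the rate [a] into [1 + a]. With [a = 2]
    this gives the rate 3 of [mob_trunc_le]. *)
Lemma normr_mob_le F A c a : (forall B, (B `<=` A)%fset -> `|F B| <= c * a ^+ #|` B|) ->
  `|mob F A| <= c * (1 + a) ^+ #|` A|.
Proof.
move=> FB; rewrite -zeta_exp -zetaZ /mob big_seq /zeta [leRHS]big_seq.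
apply: le_trans (ler_norm_sum _ _ _) _; apply: ler_sum => B.
by rewrite fpowersetE => BA; rewrite normrM normrX normrN normr1 expr1n mul1r FB.
Qed.

(** The star-convolution on sets: [A] is the union of the first two parts of a partition of [Z] and
    [B] that of the last two, so that the middle part is their intersection; see [star_conv]. *)
Definition uconv F G Z : R := \sum_(A <- fpowerset Z) \sum_(B <- fpowerset Z)
  if (A `|` B == Z)%fset then F A * G B else 0.

(** Summing over all [Z] inside [C] removes the constraint on the union and leaves all pairs of
    subsets of [C], that is, a product of two sums. So [zeta] carries the convolution to the
    pointwise product. *)
Lemma uconvE F G Z : uconv F G Z = mob (fun A => zeta F A * zeta G A) Z.
Proof.
rewrite -[uconv F G Z]mob_zeta; apply: eq_mob => C _.
rewrite /zeta /uconv big_distrlr/=.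
pose c := fun Z A B => if (A `|` B == Z)%fset then F A * G B else 0.
transitivity (\sum_(Z <- fpowerset C) \sum_(A <- fpowerset C)
   \sum_(B <- fpowerset C) c Z A B).
  apply: eq_big_seq => B; rewrite fpowersetE => BC.
  have BCs : {subset fpowerset B <= fpowerset C}.
    by move=> D; rewrite !fpowersetE => /fsubset_trans; apply.
  rewrite [RHS](big_fsetID _ (fun A => A \in fpowerset B))/=.
  rewrite [X in _ = _ + X]big1_seq ?addr0; last first.
    move=> A; rewrite !inE => /andP[_ /andP[_ AB]]; rewrite big1// => A' _.
    rewrite /c; case: eqP => // AA'; move: AB.
    by rewrite fpowersetE -AA' fsubsetUl.
  have -> : [fset x | x in fpowerset C & x \in fpowerset B]%fset = fpowerset B.
    apply/fsetP => D; rewrite !inE/=; apply/andP/idP => [[]//|DB].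
    by split=> //; exact: BCs.
  apply: eq_bigr => A _.
  rewrite [RHS](big_fsetID _ (fun A => A \in fpowerset B))/=.
  rewrite [X in _ = _ + X]big1_seq ?addr0; last first.
    move=> A'; rewrite !inE => /andP[_ /andP[_ AB]].
    rewrite /c; case: eqP => // AA'; move: AB.
    by rewrite fpowersetE -AA' fsubsetUr.
  have -> : [fset x | x in fpowerset C & x \in fpowerset B]%fset = fpowerset B.
    apply/fsetP => D; rewrite !inE/=; apply/andP/idP => [[]//|DB].
    by split=> //; exact: BCs.
  by [].
rewrite exchange_big/=; apply: eq_big_seq => A; rewrite fpowersetE => AC.
rewrite exchange_big/=; apply: eq_big_seq => B; rewrite fpowersetE => BC.
rewrite (big_fsetD1 (A `|` B)%fset) /=; last by rewrite fpowersetE fsubUset AC.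
rewrite /c eqxx big1_seq ?addr0// => D; rewrite !inE eq_sym.
by move=> /andP[_ /andP[/negbTE ->]].
Qed.

(** The majorants are exponential, so their convolution can be computed: [zeta] gives the rates
    [1 + a] and [1 + b], the product has the rate [1 + (a + b + a * b)], and [mob] takes off the
    1. *)
Lemma normr_uconv_le F G c d a b Z :
  (forall B, (B `<=` Z)%fset -> `|F B| <= c * a ^+ #|` B|) ->
  (forall B, (B `<=` Z)%fset -> `|G B| <= d * b ^+ #|` B|) ->
  `|uconv F G Z| <= c * d * (a + b + a * b) ^+ #|` Z|.
Proof.
move=> Fc Gd.
apply: (@le_trans _ _ (uconv (fun A => c * a ^+ #|` A|) (fun A => d * b ^+ #|` A|) Z)).
  rewrite /uconv big_seq [leRHS]big_seq.
  apply: le_trans (ler_norm_sum _ _ _) _; apply: ler_sum => A.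
  rewrite fpowersetE => AZ; rewrite big_seq [leRHS]big_seq.
  apply: le_trans (ler_norm_sum _ _ _) _; apply: ler_sum => B.
  rewrite fpowersetE => BZ; case: ifP => _; last by rewrite normr0.
  rewrite normrM; apply: ler_pM => //; [exact: Fc|exact: Gd].
rewrite uconvE (@eq_mob _ (fun A => c * d * (1 + (a + b + a * b)) ^+ #|` A|)).
  by rewrite mobZ mob_exp.
move=> B _; rewrite !zetaZ !zeta_exp mulrACA -exprMn; congr (_ * _ ^+ _); ring.
Qed.

Lemma uconv_ge F G A B Z : (forall C, 0 <= F C) -> (forall C, 0 <= G C) ->
  (A `|` B = Z)%fset -> F A * G B <= uconv F G Z.
Proof.
move=> F0 G0 ABZ; rewrite /uconv (big_fsetD1 A)/=; last by rewrite fpowersetE -ABZ fsubsetUl.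
rewrite (big_fsetD1 B)/=; last by rewrite fpowersetE -ABZ fsubsetUr.
rewrite ABZ eqxx -addrA lerDl addr_ge0//; apply: sumr_ge0 => C _.
  by case: ifP => // _; rewrite mulr_ge0.
by apply: sumr_ge0 => C' _; case: ifP => // _; rewrite mulr_ge0.
Qed.

Lemma uconv_eq0 F G Z : (forall A B, (A `|` B = Z)%fset -> F A * G B = 0) ->
  uconv F G Z = 0.
Proof.
by move=> FG0; rewrite /uconv big1// => A _; rewrite big1// => B _; case: eqP => // /FG0.
Qed.

End subset_sums.

Section restriction.
Context {K : choiceType}.
Implicit Types (A B : {fset K}) (D : set K) (s : seq (set K)).

Definition restr D A : {fset K} := [fset x in A | x \in D]%fset.

Definition cnt D A : nat := #|` restr D A|.

Lemma in_restr D A x : (x \in restr D A) = (x \in A) && (x \in D).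
Proof. by rewrite !inE. Qed.

Lemma restr_sub D A : (restr D A `<=` A)%fset.
Proof. by apply/fsubsetP => x; rewrite in_restr => /andP[]. Qed.

Lemma restrI D D' A : restr D (restr D' A) = restr (D `&` D') A.
Proof. by apply/fsetP => x; rewrite !in_restr in_setI andbAC andbA. Qed.

Lemma restr_id D A : [set` A] `<=` D -> restr D A = A.
Proof.
move=> AD; apply/fsetP => x; rewrite in_restr.
by case: (boolP (x \in A)) => // xA; apply/mem_set/AD.
Qed.

Lemma restrP D A : reflect ([set` A] `<=` D) (restr D A == A).
Proof.
apply: (iffP eqP) => [<- x /=|]; last exact: restr_id.
by rewrite in_restr => /andP[_ /set_mem].
Qed.

Lemma restr_setU D A B : restr D (A `|` B)%fset = (restr D A `|` restr D B)%fset.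
Proof.
by apply/fsetP => x; rewrite !(in_restr, inE)/= andb_orl.
Qed.

Lemma restr_set_setU D D' A : restr (D `|` D') A = (restr D A `|` restr D' A)%fset.
Proof.
by apply/fsetP => x; rewrite !(in_restr, inE)/= in_setU andb_orr.
Qed.

Lemma restr0 D : restr D fset0 = fset0.
Proof. by apply/fsetP => x; rewrite in_restr !inE. Qed.

Lemma restrU1 D x A :
  restr D (x |` A)%fset = (if x \in D then x |` restr D A else restr D A)%fset.
Proof.
apply/fsetP => y; case: ifPn => xD; rewrite !(in_restr, inE)/=.
  by case: eqP => // ->.
by case: eqP => // ->; rewrite (negbTE xD) !andbF.
Qed.

Lemma restr_disj D D' A : D `&` D' = set0 -> restr D (restr D' A) = fset0.
Proof.
move=> DD'; rewrite restrI DD'; apply/fsetP => x.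
by rewrite in_restr inE in_set0 andbF.
Qed.

Lemma restrUC D A : (restr D A `|` restr (~` D) A)%fset = A.
Proof.
apply/fsetP => x; rewrite !(in_restr, inE)/= in_setC.
by case: (x \in A) => //=; case: (x \in D).
Qed.

Lemma cntE D A : cnt D A = count (fun x => x \in D) A.
Proof.
rewrite /cnt -size_filter; apply: perm_size; apply: uniq_perm.
- exact: fset_uniq.
- by rewrite filter_uniq// fset_uniq.
- by move=> x; rewrite mem_filter in_restr andbC.
Qed.

Lemma cnt_restr D D' A : cnt D (restr D' A) = cnt (D `&` D') A.
Proof. by rewrite /cnt restrI. Qed.

Lemma cntT A : cnt setT A = #|` A|.
Proof. by rewrite /cnt restr_id. Qed.

Lemma cntU D D' A : D `&` D' = set0 -> cnt (D `|` D') A = (cnt D A + cnt D' A)%N.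
Proof.
move=> DD'; rewrite !cntE -count_predUI [X in (_ + X)%N](_ : _ = 0%N) ?addn0.
  by apply: eq_count => x; rewrite /= in_setU.
rewrite (@eq_count _ _ pred0) ?count_pred0// => x /=.
by rewrite -in_setI DD' in_set0.
Qed.

Lemma cnt_le D D' A : D `<=` D' -> (cnt D A <= cnt D' A)%N.
Proof.
move=> DD'; rewrite !cntE; apply: sub_count => x /set_mem xD.
by apply/mem_set/DD'.
Qed.

Lemma cnt_le_card D A : (cnt D A <= #|` A|)%N.
Proof. by rewrite -cntT; exact: cnt_le. Qed.

End restriction.

(** * Tuples of distinct points *)

Fixpoint picks (T : Type) (s : seq T) : seq (T * seq T) :=
  if s is D :: s' then (D, s') :: [seq (p.1, D :: p.2) | p <- picks s'] else [::].

Section distinct_tuples.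
Context {K : choiceType} {R : realFieldType}.
Implicit Types (A B Z : {fset K}) (D : set K) (s : seq (set K)).

(* The number of tuples of distinct points x_i of A with x_i in the i-th set of s. *)
Fixpoint injc s A : R :=
  if s is D :: s' then \sum_(x <- A) (x \in D)%:R * injc s' (A `\ x)%fset else 1.

Lemma fsetD1C A x y : (A `\ x `\ y = A `\ y `\ x)%fset.
Proof. by apply/fsetP => z; rewrite !inE andbCA. Qed.

Lemma injcD1 s A x : x \in A ->
  injc s A = injc s (A `\ x)%fset +
    \sum_(p <- picks s) (x \in p.1)%:R * injc p.2 (A `\ x)%fset.
Proof.
elim: s A => [|D s IH] A xA /=; first by rewrite big_nil addr0.
rewrite big_cons big_map /= addrCA (big_fsetD1 x)//=; congr (_ + _).
under [X in _ = _ + X]eq_bigr do rewrite mulr_sumr.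
rewrite exchange_big -big_split/=; apply: eq_big_seq => y.
rewrite !inE => /andP[yx yA].
rewrite (IH (A `\ y)%fset) ?inE 1?eq_sym ?yx//.
rewrite mulrDr fsetD1C; congr (_ + _).
by rewrite mulr_sumr; apply: eq_bigr => p _; rewrite mulrCA.
Qed.

Lemma cntR D A : (cnt D A)%:R = \sum_(x <- A) (x \in D)%:R :> R.
Proof.
rewrite cntE; elim: (enum_fset A) => [|x r IH] /=; first by rewrite big_nil.
by rewrite big_cons natrD IH.
Qed.

(** The extra point taken from [D] is either new or equal to one coordinate, which is then confined
    to the intersection with [D]. This rule replaces products of counts by combinations of
    [injc]. *)
Lemma cnt_injc D s A :
  (cnt D A)%:R * injc s A =
  injc (D :: s) A + \sum_(p <- picks s) injc (D `&` p.1 :: p.2) A.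
Proof.
rewrite cntR mulr_suml /= exchange_big -big_split/=; apply: eq_big_seq => x xA.
rewrite (injcD1 s xA) mulrDr; congr (_ + _).
rewrite mulr_sumr; apply: eq_bigr => p _.
by rewrite in_setI mulrA -natrM mulnb.
Qed.

Lemma cnt_injc1 D A : injc [:: D] A = (cnt D A)%:R.
Proof. by rewrite cntR /=; apply: eq_bigr => x _; rewrite mulr1. Qed.

(** The Moebius transform of [injc s] ([mob_injc]): a tuple of distinct points is counted at the set
    of its own entries. It is n! times the symmetrized product of the indicators ([symext_injc]). *)
Definition injc_top s A : R := if #|` A| == size s then injc s A else 0.

Lemma injc_eq0 s A : (#|` A| < size s)%N -> injc s A = 0.
Proof.
elim: s A => [|D s IH] A //= As; rewrite big1_seq// => x /andP[_ xA].
rewrite IH ?mulr0//; move: As; rewrite (cardfsD1 x A) xA; lia.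
Qed.

Lemma size_picks s p : p \in picks s -> size p.2 = (size s).-1.
Proof.
elim: s p => [|D s IH] p //=; rewrite inE => /orP[/eqP -> //|/mapP[q qs -> /=]].
by rewrite IH//; case: s qs {IH}.
Qed.

Lemma size_picks_lt s p : p \in picks s -> (size p.2 < size s)%N.
Proof. by move=> ps; rewrite (size_picks ps); case: s ps. Qed.

Lemma mem_picks s p D : p \in picks s -> (D \in p.1 :: p.2) -> D \in s.
Proof.
elim: s p => [|D' s IH] p //=; rewrite inE => /orP[/eqP -> //|/mapP[q qs -> /=]].
move=> Dq; have : D \in D' :: q.1 :: q.2.
  by move: Dq; rewrite !in_cons orbCA.
by rewrite !in_cons => /orP[->//|Dq']; rewrite (IH q) ?orbT// in_cons.
Qed.

Lemma injcU1 s A x : x \notin A ->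
  injc s (x |` A)%fset = injc s A + \sum_(p <- picks s) (x \in p.1)%:R * injc p.2 A.
Proof. by move=> xA; rewrite (@injcD1 _ _ x) ?fset1U1// fsetU1K. Qed.

Lemma mob_injc s A : mob (injc s) A = injc_top s A.
Proof.
elim/fset1U_rect: A s => [|x A xA IH] s.
  rewrite mob0 /injc_top; case: ifPn => //; rewrite cardfs0 => s0.
  by rewrite injc_eq0// cardfs0 lt0n eq_sym.
rewrite mobU1// (@eq_mob _ _ _ (fun B => injc s B +
    \sum_(p <- picks s) (x \in p.1)%:R * injc p.2 B)); last first.
  by move=> B BA; rewrite injcU1// (contra (fsubsetP BA x) xA).
rewrite mobD [X in X - _]addrC addrK.
have -> : mob (fun B => \sum_(p <- picks s) (x \in p.1)%:R * injc p.2 B) A =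
    \sum_(p <- picks s) (x \in p.1)%:R * injc_top p.2 A.
  elim: (picks s) => [|p l IHl].
    rewrite big_nil (@eq_mob _ _ _ (fun B => 0 * 0)) ?mobZ ?mul0r// => B _.
    by rewrite big_nil.
  rewrite big_cons -IHl -IH -mobZ -mobD; apply: eq_mob => B _.
  by rewrite big_cons.
rewrite /injc_top cardfsU1 xA add1n injcU1//.
case: ifPn => [/eqP As|As]; last first.
  rewrite big1_seq// => p /andP[_ ps]; rewrite (size_picks ps) ifF ?mulr0//.
  apply: contraNF As => /eqP ->; rewrite prednK//.
  by case: s ps {IH}.
rewrite injc_eq0 ?As// add0r; apply: eq_big_seq => p ps.
by rewrite (size_picks ps) -As eqxx.
Qed.

Lemma zeta_injc_top s A : zeta (injc_top s) A = injc s A.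
Proof.
by rewrite -[RHS]zeta_mob; apply: eq_zeta => B _; rewrite mob_injc.
Qed.

Lemma injc_ge0 s A : 0 <= injc s A.
Proof.
elim: s A => [|D s IH] A //=; apply: sumr_ge0 => x _.
by rewrite mulr_ge0.
Qed.

Lemma injc_le s A : injc s A <= #|` A|%:R ^+ size s.
Proof.
elim: s A => [|D s IH] A /=; first by rewrite expr0.
apply: (@le_trans _ _ (\sum_(x <- A) #|` A|%:R ^+ size s)); last first.
  by rewrite big_const_seq count_predT iter_addr_0 exprS mulr_natl.
apply: ler_sum => x _; apply: le_trans (_ : injc s (A `\ x)%fset <= _).
  by case: (x \in D); rewrite ?mul1r ?mul0r// injc_ge0.
apply: le_trans (IH _) _; rewrite lerXn2r ?nnegrE ?ler0n// ler_nat.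
by rewrite fsubset_leq_card// fsubD1set.
Qed.

Lemma injc_top_eq0 s A x : x \in A -> (forall D, D \in s -> x \notin D) ->
  injc_top s A = 0.
Proof.
move=> xA xs; rewrite /injc_top; case: eqP => // As.
elim: s A xA xs As => [|D s IH] A xA xs As.
  by move: As; rewrite /= (cardfsD1 x) xA.
rewrite /= big1_seq// => y /andP[_ yA]; have [<-|yx] := eqVneq x y.
  by rewrite (negbTE (xs D _)) ?mul0r// mem_head.
rewrite IH ?mulr0//; first by rewrite !inE yx.
  by move=> D' D's; rewrite xs// inE D's orbT.
by move: As; rewrite (cardfsD1 y) yA /= => -[].
Qed.

Lemma injc_permutations s A : #|` A| = size s ->
  injc s A = \sum_(t <- permutations (A : seq K))
    \prod_(p <- zip s t) (p.2 \in p.1)%:R.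
Proof.
elim: s A => [|D s IH] A As.
  have -> : A = fset0 by apply/eqP; rewrite -cardfs_eq0 As.
  have -> : enum_fset (@fset0 K) = [::] by exact: (size0nil (cardfs0 K)).
  rewrite /= (_ : permutations [::] = [:: [::]]) ?big_seq1 ?big_nil//.
rewrite (perm_big _ (permutationsE _)) ?As//= undup_id ?fset_uniq//.
rewrite big_allpairs_dep/=; apply: eq_big_seq => x xA.
under eq_bigr do rewrite big_cons/=.
rewrite -mulr_sumr IH; last by move: As; rewrite (cardfsD1 x) xA /= => -[].
congr (_ * _); apply: perm_big; apply: perm_permutations.
apply: uniq_perm; rewrite ?rem_uniq ?fset_uniq// => y.
by rewrite mem_rem_uniq ?fset_uniq// !inE.
Qed.

End distinct_tuples.

Section linear_span.
Context {T : Type} {R : realFieldType}.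
Implicit Types (S : set (T -> R)) (f g : T -> R).

(** Finite linear combinations as an inductive predicate: properties of polynomials are then proved
    by [elim], one summand at a time. *)
Inductive lspan S : set (T -> R) :=
| lspan0 : lspan S (fun=> 0)
| lspan_cons a f g : S f -> lspan S g -> lspan S (fun x => a * f x + g x).

Lemma lspan_sub S f : S f -> lspan S f.
Proof.
move=> Sf; have -> : f = (fun x => 1 * f x + 0).
  by apply/funext => x; rewrite mul1r addr0.
exact: (lspan_cons 1 Sf (lspan0 S)).
Qed.

Lemma lspanD S f g : lspan S f -> lspan S g -> lspan S (fun x => f x + g x).
Proof.
move=> Sf Sg; elim: Sf => [|a f1 f2 Sf1 _ IH].
  by rewrite (_ : (fun _ => _) = g)//; apply/funext => x; rewrite add0r.
under eq_fun do rewrite -addrA; exact: (lspan_cons a Sf1 IH).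
Qed.

Lemma lspanZ S a f : lspan S f -> lspan S (fun x => a * f x).
Proof.
move=> Sf; elim: Sf => [|b f1 f2 Sf1 _ IH].
  by under eq_fun do rewrite mulr0; exact: lspan0.
under eq_fun do rewrite mulrDr mulrA; exact: (lspan_cons _ Sf1 IH).
Qed.

Lemma lspanB S f g : lspan S f -> lspan S g -> lspan S (fun x => f x - g x).
Proof.
by move=> Sf Sg; have := lspanD Sf (lspanZ (-1) Sg); under eq_fun do rewrite mulN1r.
Qed.

Lemma lspan_sum S I (r : seq I) (P : pred I) (F : I -> T -> R) :
  (forall i, P i -> lspan S (F i)) -> lspan S (fun x => \sum_(i <- r | P i) F i x).
Proof.
move=> SF; elim: r => [|i r IH].
  by under eq_fun do rewrite big_nil; exact: lspan0.
case Pi: (P i); under eq_fun do rewrite big_cons Pi; last exact: IH.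
by apply: lspanD => //; exact: SF.
Qed.

Lemma lspanM S : (forall f g, S f -> S g -> lspan S (fun x => f x * g x)) ->
  forall f g, lspan S f -> lspan S g -> lspan S (fun x => f x * g x).
Proof.
move=> SM f g Sf Sg; elim: Sf => [|a f1 f2 Sf1 _ IH].
  by under eq_fun do rewrite mul0r; exact: lspan0.
under eq_fun do rewrite mulrDl -mulrA; apply: lspanD IH; apply: lspanZ.
elim: Sg => [|b g1 g2 Sg1 _ IHg].
  by under eq_fun do rewrite mulr0; exact: lspan0.
under eq_fun do rewrite mulrDr mulrCA; apply: lspanD IHg; apply: lspanZ.
exact: SM.
Qed.

End linear_span.

(** * Functions of finite configurations *)

Section pattern_invariance.
Context {K : choiceType} {R : realFieldType}.
Implicit Types (A B Z : {fset K}) (D : set K) (F G : {fset K} -> R).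

(** [F] sees a configuration only through the numbers of its points with each label. With finitely
    many Borel labels this replaces measurability of [F] by a property that [mob] preserves
    ([inv_mob]). *)
Definition invar (P : eqType) (f : K -> P) F := forall A A' : {fset K},
  perm_eq (map f A) (map f A') -> F A = F A'.

Lemma perm_refine (P Q : eqType) (f : K -> P) (g : K -> Q) (s s' : seq K) :
  (forall x y, g x = g y -> f x = f y) ->
  perm_eq (map g s) (map g s') -> perm_eq (map f s) (map f s').
Proof.
move=> gf gss'.
(* [h] recovers the coarse label from the fine one; fine labels that are not attained get [None]. *)
pose h (q : Q) := if pselect (exists x, g x = q) is left e
  then Some (f (projT1 (cid e))) else None.
have hg x : h (g x) = Some (f x).
  rewrite /h; case: pselect => [e|]; last by case; exists x.
  by congr Some; apply: gf; rewrite (projT2 (cid e)).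
have Some_inj : injective (@Some P) by move=> ? ? [].
apply: (perm_map_inj Some_inj); have := perm_map h gss'; rewrite -!map_comp.
by rewrite !(@eq_map _ _ (h \o g) (Some \o f)).
Qed.

Lemma inv_refine (P Q : eqType) (f : K -> P) (g : K -> Q) F :
  (forall x y, g x = g y -> f x = f y) -> invar f F -> invar g F.
Proof. by move=> gf fF A A' /(perm_refine gf); exact: fF. Qed.

Let fst_set (P : seq (K * K)) := [fset x in unzip1 P]%fset.
Let snd_set (P : seq (K * K)) := [fset x in unzip2 P]%fset.

Lemma fset_cons (x : K) (s : seq K) : [fset y in x :: s]%fset = (x |` [fset y in s])%fset.
Proof. by apply/fsetP => y; rewrite !inE. Qed.

(** A label-preserving bijection is encoded as a list of pairs, and its restrictions to subsets are
    the subsequences of the list. This makes an induction with [mobU1] possible. *)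
Lemma mob_pairs (p : seq (K * K)) F G : uniq (unzip1 p) -> uniq (unzip2 p) ->
  (forall q, subseq q p -> F (fst_set q) = G (snd_set q)) ->
  mob F (fst_set p) = mob G (snd_set p).
Proof.
elim: p F G => [|[x y] p IH] F G /=.
  move=> _ _ FG; have e0 : [fset x0 in [::]]%fset = fset0 :> {fset K}.
    by apply/fsetP => z; rewrite !inE.
  by rewrite /fst_set /snd_set /= e0 !mob0 -e0; have := FG [::] isT.
move=> /andP[xp u1] /andP[yp u2] FG; rewrite /fst_set /snd_set/= !fset_cons.
rewrite !mobU1 ?inE//; congr (_ - _); apply: IH => // q qp.
  have := FG ((x, y) :: q); rewrite /fst_set /snd_set/= !fset_cons; apply.
  by rewrite eqxx.
by apply: (FG q); exact: (subseq_trans qp (subseq_cons p (x, y))).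
Qed.

Lemma perm_eq_map_pairs (P : eqType) (f : K -> P) (s t : seq K) :
  perm_eq (map f s) (map f t) ->
  exists2 t', perm_eq t' t & map f t' = map f s.
Proof.
elim: s t => [|x s IH] t /=.
  by move=> /perm_size; rewrite size_map => /esym/size0nil ->; exists [::].
move=> xst; have : f x \in map f t by rewrite -(perm_mem xst) mem_head.
move=> /mapP[y yt fxy]; have tE := perm_to_rem yt.
have : perm_eq (map f s) (map f (rem y t)).
  rewrite -(perm_cons (f x)) (perm_trans xst)//.
  by rewrite fxy -map_cons; exact: perm_map.
move=> /IH[t' tt' ft']; exists (y :: t'); last by rewrite /= ft' fxy.
by rewrite perm_sym (perm_trans tE)// perm_cons perm_sym.
Qed.

Lemma perm_map_fset (P : eqType) (f : K -> P) A A' :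
  perm_eq (map f A) (map f A') ->
  exists p : seq (K * K), [/\ fst_set p = A, snd_set p = A',
    uniq (unzip1 p) /\ uniq (unzip2 p) & forall q, q \in p -> f q.1 = f q.2].
Proof.
move=> /perm_eq_map_pairs[t tA' ft].
have st : size t = size (A : seq K) by rewrite -(size_map f t) ft size_map.
have z1 : unzip1 (zip A t) = A by rewrite unzip1_zip ?st.
have z2 : unzip2 (zip A t) = t by rewrite unzip2_zip ?st.
exists (zip A t); rewrite /fst_set /snd_set z1 z2; split.
- by apply/fsetP => x; rewrite !inE.
- by apply/fsetP => x; rewrite !inE (perm_mem tA').
- by rewrite fset_uniq (perm_uniq tA') fset_uniq.
move=> [x y] /= xy; have iA := xy; move: (A : seq K) (t) ft st xy {iA} => s.
elim: s => [|a s IH] [|b r] //= [ba sr] [rs]; rewrite inE => /orP[/eqP[-> ->]//|].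
exact: IH.
Qed.

Lemma inv_mob (P : eqType) (f : K -> P) F : invar f F -> invar f (mob F).
Proof.
move=> fF A A' /perm_map_fset[p [<- <- [u1 u2] fp]].
apply: mob_pairs => // q qp; apply: fF.
have q1 : subseq (unzip1 q) (unzip1 p) by apply: map_subseq.
have q2 : subseq (unzip2 q) (unzip2 p) by apply: map_subseq.
have e1 : perm_eq (fst_set q) (unzip1 q).
  apply: uniq_perm; rewrite ?fset_uniq ?(subseq_uniq q1)// => x.
  by rewrite !inE.
have e2 : perm_eq (snd_set q) (unzip2 q).
  apply: uniq_perm; rewrite ?fset_uniq ?(subseq_uniq q2)// => x.
  by rewrite !inE.
have e : map f (unzip1 q) = map f (unzip2 q).
  by rewrite -!map_comp; apply/eq_in_map => z /(mem_subseq qp); exact: fp.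
apply: (perm_trans (perm_map f e1)).
by rewrite e perm_sym; exact: perm_map.
Qed.

Lemma inv_op (P : eqType) (f : K -> P) (h : R -> R -> R) F G :
  invar f F -> invar f G -> invar f (fun A => h (F A) (G A)).
Proof. by move=> fF fG A A' AA'; rewrite (fF _ _ AA') (fG _ _ AA'). Qed.

Lemma inv_card (P : eqType) (f : K -> P) A A' :
  perm_eq (map f A) (map f A') -> #|` A| = #|` A'|.
Proof. by move=> /perm_size; rewrite !size_map. Qed.

Lemma inv_cnt (P : eqType) (f : K -> P) D A A' :
  (forall x y, f x = f y -> (x \in D) = (y \in D)) ->
  perm_eq (map f A) (map f A') -> cnt D A = cnt D A'.
Proof.
move=> fD /(perm_refine fD) /seq.permP/(_ id); rewrite !count_map !cntE; exact.
Qed.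

End pattern_invariance.

Section local_functions.
Context {K : choiceType} {R : realFieldType}.
Implicit Types (A B Z : {fset K}) (D : set K) (F G w phi : {fset K} -> R).

Definition loc D F := forall A, F A = F (restr D A).

Lemma loc_subset D D' F : D `<=` D' -> loc D F -> loc D' F.
Proof.
by move=> DD' DF A; rewrite DF [RHS]DF restrI; congr (F (restr _ _)); apply/esym/setIidPl.
Qed.

Lemma loc_op D (h : R -> R -> R) F G : loc D F -> loc D G -> loc D (fun A => h (F A) (G A)).
Proof. by move=> DF DG A; rewrite DF DG. Qed.

Lemma loc_cst D c : loc D (fun=> c). Proof. by []. Qed.

Lemma loc_cnt D : loc D (fun A => (cnt D A)%:R).
Proof. by move=> A; rewrite cnt_restr setIid. Qed.

Lemma mob_loc D F Z : loc D F -> ~ [set` Z] `<=` D -> mob F Z = 0.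
Proof.
move=> DF ZD; have [x [xZ xD]] : exists x, x \in Z /\ ~ D x.
  apply: contrapT => nx; apply: ZD => x /= xZ; apply: contrapT => Dx.
  by apply: nx; exists x.
rewrite -(fsetD1K xZ) mobU1 ?inE ?eqxx//; apply/eqP; rewrite subr_eq0; apply/eqP.
by apply: eq_mob => B _; rewrite DF [RHS]DF restrU1 memNset.
Qed.

(** The expansion is cut off in the points inside [D] only, with the points outside [D] kept as
    parameters. A factor that depends on the outside therefore passes through ([truncfM]), as the
    step from one cell to the next needs. *)
Definition trunc D (N : nat) F A : R :=
  zeta (fun Z => if (#|` Z| <= N)%N
    then mob (fun B => F (B `|` restr (~` D) A)%fset) Z else 0) (restr D A).

Definition mob_trunc D N F Z : R :=
  if (#|` Z| <= N)%N && (restr D Z == Z) then mob F Z else 0.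

Lemma truncE D N phi A : loc D phi -> trunc D N phi A = zeta (mob_trunc D N phi) A.
Proof.
move=> Dphi; rewrite /trunc /zeta -[RHS](@big_fset_incl _ _ _ _ (fpowerset (restr D A))).
- apply: eq_big_seq => Z; rewrite fpowersetE => ZA.
  have ZD : restr D Z = Z.
    by apply: restr_id => x /(fsubsetP ZA); rewrite in_restr => /andP[_ /set_mem].
  rewrite /mob_trunc ZD eqxx andbT; case: ifP => // _; apply: eq_mob => B BZ.
  rewrite Dphi [RHS]Dphi restr_setU restr_disj ?setICr//.
  by rewrite fsetU0.
- by apply/fsubsetP => Z; rewrite !fpowersetE => /fsubset_trans; apply; exact: restr_sub.
- move=> Z; rewrite !fpowersetE /mob_trunc => ZA ZDA; rewrite ifF//.
  apply: contraNF ZDA => /andP[_ /eqP <-].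
  by apply/fsubsetP => x; rewrite !in_restr => /andP[/(fsubsetP ZA) -> ->].
Qed.

Lemma mob_truncE D N phi Z : loc D phi -> mob (trunc D N phi) Z = mob_trunc D N phi Z.
Proof.
move=> Dphi; rewrite -[RHS]mob_zeta; apply: eq_mob => B _.
exact: truncE.
Qed.

Lemma loc_trunc D N phi : loc D phi -> loc D (trunc D N phi).
Proof.
move=> Dphi A; rewrite /trunc [restr D (restr D A)]restrI setIid; apply: eq_zeta => Z ZA.
case: ifP => // _; apply: eq_mob => B _.
by rewrite Dphi [RHS]Dphi !restr_setU !restr_disj ?setICr.
Qed.

Lemma truncfM D N phi w A : loc D phi -> loc (~` D) w ->
  trunc D N (fun B => phi B * w B) A = trunc D N phi A * w A.
Proof.
move=> Dphi Dw; rewrite mulrC /trunc -zetaZ; apply: eq_zeta => Z ZA.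
have ZD : [set` Z] `<=` D.
  by move=> x /(fsubsetP ZA); rewrite in_restr => /andP[_ /set_mem].
case: ifP => _; last by rewrite mulr0.
rewrite -mobZ; apply: eq_mob => B BZ; rewrite mulrC; congr (_ * _).
have -> : B = restr D B.
  by rewrite restr_id// => x /(fsubsetP BZ) /ZD.
by rewrite Dw [RHS]Dw restr_setU restr_disj ?setICl// fset0U restrI setIid.
Qed.

Lemma trunc_loc D N w A : loc (~` D) w -> trunc D N w A = w A.
Proof.
move=> Dw; rewrite -[LHS](_ : trunc D N (fun B => 1 * w B) A = _); last first.
  by congr trunc; apply/funext => B; rewrite mul1r.
(* The Moebius transform of the constant 1 is the indicator of the empty set, written as a power of
   0; no level [N] cuts it off. *)
rewrite truncfM// truncE// (@eq_zeta _ _ _ (fun Z => 0 ^+ #|` Z|)).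
  by rewrite zeta_exp addr0 expr1n mul1r.
move=> B _; rewrite /mob_trunc -[0 ^+ _]mob_exp.
rewrite (@eq_mob _ _ (fun=> 1) (fun B => (1 + 0) ^+ #|` B|)); last first.
  by move=> ? _; rewrite addr0 expr1n.
case: ifPn => //; rewrite mob_exp negb_and -ltnNge => h; rewrite expr0n.
case: (posnP #|` B|) => [|B0]; last by [].
move=> /eqP; rewrite cardfs_eq0 => /eqP B0; move: h.
by rewrite B0 restr0 eqxx cardfs0.
Qed.

Lemma truncfD D N F G A :
  trunc D N (fun B => F B + G B) A = trunc D N F A + trunc D N G A.
Proof.
rewrite /trunc -zetaD; apply: eq_zeta => Z _; case: ifP => _; last by rewrite addr0.
exact: mobD.
Qed.

Lemma truncfZ D N c F A : trunc D N (fun B => c * F B) A = c * trunc D N F A.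
Proof.
rewrite /trunc -zetaZ; apply: eq_zeta => Z _; case: ifP => _; last by rewrite mulr0.
exact: mobZ.
Qed.

Lemma truncf0 D N A : trunc D N (fun=> 0) A = 0.
Proof.
by have := truncfZ D N 0 (fun=> 0) A; under eq_fun do rewrite mul0r; rewrite mul0r.
Qed.

Lemma trunc_small D N phi A : loc D phi -> (cnt D A <= N)%N ->
  trunc D N phi A = phi A.
Proof.
move=> Dphi AN; rewrite [RHS]Dphi -[RHS]zeta_mob; apply: eq_zeta => Z ZA.
rewrite (leq_trans _ AN) ?fsubset_leq_card//; apply: eq_mob => B _.
by rewrite Dphi [RHS]Dphi restr_setU restr_disj ?setICr// fsetU0.
Qed.

(** Degree as a polynomial in the counting functions: [injc s] has degree at most [size s]
    ([degle_injc]). *)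
Definition degle (n : nat) F := forall Z, (n < #|` Z|)%N -> mob F Z = 0.

Lemma degleW m n F : (m <= n)%N -> degle m F -> degle n F.
Proof. by move=> mn dF Z /(leq_ltn_trans mn)/dF. Qed.

Lemma degleU1 n F x : degle n F -> degle n (fun B => F (x |` B)%fset).
Proof.
move=> dF Z nZ; have [xZ|xZ] := boolP (x \in Z); last first.
  have := dF (x |` Z)%fset; rewrite mobU1// (dF Z)// subr0; apply.
  by rewrite cardfsU1 xZ ltnW.
rewrite -(fsetD1K xZ) mobU1 ?inE ?eqxx//; apply/eqP; rewrite subr_eq0; apply/eqP.
by apply: eq_mob => B _; rewrite fsetUA fsetUid.
Qed.

Lemma degleU n F C : degle n F -> degle n (fun B => F (B `|` C)%fset).
Proof.
elim/fset1U_rect: C F => [|x C xC IH] F dF.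
  by under eq_fun do rewrite fsetU0.
have := IH _ (degleU1 x dF); congr (degle _ _).
by apply/funext => B; rewrite fsetUCA.
Qed.

(** Fixing the points outside [D] does not raise the degree ([degleU]), so nothing is cut off. Hence
    truncation is eventually the identity on polynomials, and the limits taken over the cells keep
    the values of [corr] ([tower_poly]). *)
Lemma trunc_degle D N F A : degle N F -> trunc D N F A = F A.
Proof.
move=> dF; rewrite /trunc -[RHS](_ : F (restr D A `|` restr (~` D) A)%fset = _); last first.
  by rewrite restrUC.
rewrite -[RHS](zeta_mob (fun B => F (B `|` restr (~` D) A)%fset)).
apply: eq_zeta => Z _; case: leqP => // NZ.
by rewrite (degleU (restr (~` D) A) dF).
Qed.

Lemma degle_injc s : degle (size s) (@injc K R s).
Proof. by move=> Z sZ; rewrite mob_injc /injc_top gtn_eqF. Qed.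

End local_functions.

(** * Polynomials in the counting functions *)

Section polynomials.
Context {K : choiceType} {R : realFieldType}.
Variable C : set (set K).
Hypothesis CI : setI_closed C.
Implicit Types (A B Z : {fset K}) (D : set K) (s : seq (set K))
  (F G : {fset K} -> R).

(** Polynomials in the counts of sets from [C], spanned by the factorial powers [injc s] because
    their Moebius transforms are explicit. Closure under products is [polycM]. *)
Definition polyc : set ({fset K} -> R) :=
  lspan [set F | exists2 s, (forall D, D \in s -> C D) & F = injc s].

Lemma polyc_injc s : (forall D, D \in s -> C D) -> polyc (injc s).
Proof. by move=> sC; apply: lspan_sub; exists s. Qed.

Lemma polyc_cst c : polyc (fun=> c).
Proof.
rewrite (_ : (fun=> c) = (fun A => c * injc [::] A)).
  by apply: lspanZ; exact: polyc_injc.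
by apply/funext => A; rewrite /= mulr1.
Qed.

Lemma polyc_cnt D : C D -> polyc (fun A => (cnt D A)%:R).
Proof.
move=> CD; rewrite (_ : (fun _ => _) = injc [:: D]).
  by apply: polyc_injc => D'; rewrite inE => /eqP ->.
by apply/funext => A; rewrite cnt_injc1.
Qed.

Lemma polyc_cntM D F : C D -> polyc F -> polyc (fun A => (cnt D A)%:R * F A).
Proof.
move=> CD; elim=> [|a _ g [s sC ->] _ IH].
  by under eq_fun do rewrite mulr0; exact: lspan0.
under eq_fun do rewrite mulrDr mulrCA cnt_injc; apply: lspanD IH; apply: lspanZ.
apply: lspanD.
  by apply: polyc_injc => D'; rewrite inE => /orP[/eqP -> //|]; exact: sC.
rewrite (_ : (fun _ => _) = (fun A => \sum_(p <- picks s | p \in picks s)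
    injc (D `&` p.1 :: p.2) A)); last by apply/funext => A; rewrite -big_seq.
apply: (@lspan_sum _ _ _ _ _ (fun p => p \in picks s) (fun p => injc (D `&` p.1 :: p.2))).
move=> p ps; apply: polyc_injc => D'; rewrite inE => /orP[/eqP ->|Dp].
  by apply: CI => //; apply: sC; apply: (mem_picks ps); rewrite mem_head.
by apply: sC; apply: (mem_picks ps); rewrite inE Dp orbT.
Qed.

(** Induction on the length of the first list: [cnt_injc] writes [injc (D :: s)] as [cnt D] times
    [injc s] minus terms whose lists are as short as [s]. *)
Lemma polycM F G : polyc F -> polyc G -> polyc (fun A => F A * G A).
Proof.
apply: lspanM => _ _ [s sC ->] [t tC ->].
move: sC; have [n] := ubnP (size s); elim: n s => // n IH [|D s].
  move=> _ _; rewrite (_ : (fun _ => _) = injc t); first exact: polyc_injc.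
  by apply/funext => A; rewrite /= mul1r.
rewrite /= ltnS => sn sC.
have -> : (fun A => injc (D :: s) A * injc t A) = (fun A => (cnt D A)%:R * (injc s A * injc t A) -
    \sum_(p <- picks s | p \in picks s) injc (D `&` p.1 :: p.2) A * injc t A) :> ({fset K} -> R).
  apply/funext => A; rewrite -big_seq -mulr_suml mulrA cnt_injc mulrDl addrK//.
apply: lspanB.
  apply: polyc_cntM; first by apply: sC; rewrite mem_head.
  by apply: IH => // D' D's; apply: sC; rewrite inE D's orbT.
apply: (@lspan_sum _ _ _ _ _ (fun p => p \in picks s)
  (fun p A => injc (D `&` p.1 :: p.2) A * injc t A)).
move=> p ps; apply: IH => [|D'].
  exact: leq_ltn_trans (size_picks_lt ps) sn.
have Cs : forall D, D \in p.1 :: p.2 -> C D.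
  by move=> E Ep; apply: sC; rewrite inE (mem_picks ps) ?orbT.
rewrite inE => /orP[/eqP ->|Dp].
  by apply: CI; [apply: sC|apply: Cs]; rewrite mem_head.
by apply: Cs; rewrite inE Dp orbT.
Qed.

Lemma polyc_degle F : polyc F -> exists n, degle n F.
Proof.
elim=> [|a _ g [s sC ->] _ [n gn]].
  by exists 0%N => Z _; exact: mob_cst0.
exists (maxn (size s) n) => Z; rewrite gtn_max => /andP[sZ nZ].
by rewrite mobD mobZ degle_injc// gn// mulr0 addr0.
Qed.

Definition cell (P : eqType) (f : K -> P) (D : set K) (t : P) : set K :=
  [set x | f x = t] `&` D.

Lemma prod_zip_cell (P : eqType) (f : K -> P) D (t : seq P) (x : seq K) :
  size t = size x ->
  \prod_(p <- zip (map (cell f D) t) x) (p.2 \in p.1)%:R =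
  ((all (fun y => y \in D) x) && (map f x == t))%:R :> R.
Proof.
elim: t x => [|a t IH] [|y x]//=; first by rewrite big_nil.
move=> [tx]; rewrite big_cons IH//= -natrM mulnb eqseq_cons /cell in_setI.
congr ((nat_of_bool _)%:R); rewrite andbACA andbA [RHS]andbA; congr (_ && _).
rewrite andbC -andbA; congr (_ && _); rewrite andbC; congr (_ && _).
by apply/idP/eqP => [/set_mem//|ya]; exact/mem_set.
Qed.

(** A function of the labels that lives on at most [N] points of [D] is a finite combination of the
    [injc_top] of words of cells: a set of n points has n! enumerations, each of which spells one
    word, whence the division by n!. *)
Lemma polyc_zeta (P : finType) (f : K -> P) D N G : invar f G ->
  (forall t, C (cell f D t)) ->
  (forall Z, ~ [set` Z] `<=` D -> G Z = 0) ->
  (forall Z, (N < #|` Z|)%N -> G Z = 0) ->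
  polyc (zeta G).
Proof.
move=> fG cC G0 GN.
(* [g] reads [G] off a word of labels through any configuration in [D] that spells it up to order,
   independently of the choice by [invar]; words that no configuration spells get 0. *)
pose g (t : seq P) := if pselect (exists Z : {fset K}, [set` Z] `<=` D /\
  perm_eq (map f Z) t) is left e then G (projT1 (cid e)) else 0.
have gE (Z : {fset K}) (x : seq K) : [set` Z] `<=` D -> perm_eq x Z -> g (map f x) = G Z.
  move=> ZD xZ; rewrite /g; case: pselect => [e|]; last first.
    by case; exists Z; split=> //; rewrite perm_sym perm_map.
  case: (cid e) => /= Z' [_ Z'x]; apply: fG; rewrite (perm_trans Z'x)//.
  exact: perm_map.
pose H := fun A => \sum_(n < N.+1) \sum_(t : n.-tuple P)
  ((n`!)%:R^-1 * g t) * injc (map (cell f D) t) A.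
suff -> : zeta G = H.
  apply: lspan_sum => n _; apply: lspan_sum => t _; apply: lspanZ.
  by apply: polyc_injc => D' /mapP[p _ ->].
apply/funext => A; rewrite -[RHS]zeta_mob; apply: eq_zeta => Z _.
have -> : mob H Z = \sum_(n < N.+1) \sum_(t : n.-tuple P)
    ((n`!)%:R^-1 * g t) * injc_top (map (cell f D) t) Z.
  rewrite mob_sum; apply: eq_bigr => n _; rewrite mob_sum; apply: eq_bigr => t _.
  by rewrite mobZ mob_injc.
have [NZ|ZN] := ltnP N #|` Z|.
  rewrite GN// big1// => n _; rewrite big1// => t _.
  rewrite /injc_top size_map size_tuple gtn_eqF ?mulr0//.
  exact: leq_trans (ltn_ord n) NZ.
have [ZD|ZD] := pselect ([set` Z] `<=` D); last first.
  rewrite G0//; have [x [xZ xD]] : exists x, x \in Z /\ ~ D x.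
    apply: contrapT => nx; apply: ZD => x /= xZ; apply: contrapT => Dx.
    by apply: nx; exists x.
  rewrite big1// => n _; rewrite big1// => t _.
  rewrite (injc_top_eq0 xZ) ?mulr0// => D' /mapP[p _ ->].
  by rewrite /cell in_setI (memNset xD) andbF.
have ZN1 : (#|` Z| < N.+1)%N by [].
rewrite (bigD1 (Ordinal ZN1))//= [X in _ + X]big1 ?addr0; last first.
  move=> n nZ; rewrite big1// => t _; rewrite /injc_top size_map size_tuple ifF ?mulr0//.
  by apply: contraNF nZ => /eqP nZ; apply/eqP/val_inj.
under eq_bigr => t _.
  rewrite /injc_top size_map size_tuple eqxx injc_permutations ?size_map ?size_tuple//.
  rewrite mulr_sumr; over.
rewrite exchange_big/=.
transitivity (\sum_(x <- permutations (Z : seq K)) ((#|` Z|)`!%:R)^-1 * G Z).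
  rewrite big_const_seq count_predT iter_addr_0 size_permutations ?fset_uniq//.
  rewrite -[RHS]mulr_natl.
  by rewrite mulrA mulfV ?mul1r// pnatr_eq0 -lt0n fact_gt0.
apply: eq_big_seq => x; rewrite mem_permutations => xZ.
have sx : size (map f x) == #|` Z| by rewrite size_map (perm_size xZ).
rewrite (bigD1 (Tuple sx))//= [X in _ = _ + X]big1 ?addr0; last first.
  move=> t tx; rewrite prod_zip_cell; last by rewrite size_tuple (perm_size xZ).
  rewrite andbC (_ : _ == _ = false) ?mulr0//.
  by apply: contraNF tx => /eqP xt; apply/eqP/val_inj.
rewrite prod_zip_cell ?size_map// eqxx andbT (_ : all _ _ = true) ?mulr1.
  by rewrite (gE Z).
by apply/allP => y; rewrite (perm_mem xZ) => yZ; apply/mem_set/ZD.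
Qed.

End polynomials.

(** * The star-convolution and the class S *)

Section star_product.
Context {R : realType} {X : topologicalType}.
Implicit Types (A B : {fset X}) (eta : fconf X).

Lemma mset_of_fconfE eta x : mset_of_fconf eta x = (x \in (eta : {fset X})).
Proof. by rewrite /mset_of_fconf mset_seqE count_uniq_mem ?fset_uniq. Qed.

Let split3 (q : {fset X} * {fset X}) :=
  (mset_of_fconf (q.1 `\` q.2)%fset, mset_of_fconf (q.1 `&` q.2)%fset,
   mset_of_fconf (q.2 `\` q.1)%fset).

Let split3_inj : injective split3.
Proof.
move=> [A B] [A' B'] [/msetP e1 /msetP e2 /msetP e3].
congr pair; apply/fsetP => x; move: (e1 x) (e2 x) (e3 x);
  rewrite !mset_of_fconfE !inE;
  by case: (x \in A); case: (x \in B); case: (x \in A'); case: (x \in B').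
Qed.

Let split3_l q : ((split3 q).1.1 `+` (split3 q).1.2)%mset = mset_of_fconf q.1.
Proof.
apply/msetP => x; rewrite msetE2 /split3/= !mset_of_fconfE !inE.
by case: (x \in q.1); case: (x \in q.2).
Qed.

Let split3_r q : ((split3 q).1.2 `+` (split3 q).2)%mset = mset_of_fconf q.2.
Proof.
apply/msetP => x; rewrite msetE2 /split3/= !mset_of_fconfE !inE.
by case: (x \in q.1); case: (x \in q.2).
Qed.

Let split3_sum q : ((split3 q).1.1 `+` (split3 q).1.2 `+` (split3 q).2)%mset =
  mset_of_fconf (q.1 `|` q.2)%fset.
Proof.
apply/msetP => x; rewrite !msetE2 /split3/= !mset_of_fconfE !inE.
by case: (x \in q.1); case: (x \in q.2).
Qed.

(** As [eta] has no multiple points, a triple with sum [eta] is a partition of it, and [split3]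
    matches the partitions with the pairs of subsets that cover [eta]. *)
Lemma star_conv (G1 G2 : {mset X}%mset -> R) eta :
  star G1 G2 (mset_of_fconf eta) =
  uconv (fun A => G1 (mset_of_fconf A)) (fun A => G2 (mset_of_fconf A)) eta.
Proof.
pose P := [seq (A, B) | A <- fpowerset eta, B <- fpowerset eta].
pose Q := [seq q <- P | (q.1 `|` q.2)%fset == eta].
rewrite /star (@fsbigE _ _ _ _ _ (map split3 Q)).
- rewrite big_map.
  rewrite (eq_bigr (fun q => G1 (mset_of_fconf q.1) * G2 (mset_of_fconf q.2))); last first.
    by move=> q _; rewrite split3_l split3_r.
  have PE (F : {fset X} * {fset X} -> R) : \sum_(q <- P) F q =
      \sum_(A <- fpowerset eta) \sum_(B <- fpowerset eta) F (A, B).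
    by rewrite /P big_allpairs_dep.
  rewrite /Q big_filter_cond big_mkcond [LHS]PE /=.
  rewrite /uconv; apply: eq_bigr => A _; apply: eq_bigr => B _.
  case: eqP => AB //=; rewrite ifT//; apply/mem_set => /=.
  by have /= := split3_sum (A, B); rewrite AB.
- rewrite (map_inj_uniq split3_inj).
  rewrite filter_uniq// allpairs_uniq ?fset_uniq//.
  by move=> [? ?] [? ?].
- move=> y /= /mapP[[A B]]; rewrite mem_filter => /andP[/eqP AB _] ->.
  by rewrite split3_sum AB.
- move=> [[p1 p2] p3] /= /msetP pe; apply: contraNeq => _.
  pose A := [fset x in eta | (0 < p1 x + p2 x)%N]%fset.
  pose B := [fset x in eta | (0 < p2 x + p3 x)%N]%fset.
  have px x : (p1 x + p2 x + p3 x)%N = (x \in (eta : {fset X})).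
    by rewrite -mset_of_fconfE -pe !msetE2.
  apply/mapP; exists (A, B).
    rewrite mem_filter; apply/andP; split.
      apply/eqP/fsetP => x; rewrite !inE /=; move: (px x).
      by case: (x \in _) => //=; case: (p1 x) => [|a]; case: (p2 x) => [|b]; case: (p3 x).
    by apply/allpairsP; exists (A, B); rewrite !fpowersetE; split=> //;
      apply/fsubsetP => x; rewrite !inE => /andP[].
  rewrite /split3/=.
  by congr (_, _, _); apply/msetP => x; rewrite mset_of_fconfE !inE /=; move: (px x);
    case: (x \in _) => //=; case: (p1 x) => [|[|a]]; case: (p2 x) => [|[|b]]; case: (p3 x) => [|[|c]].
Qed.

End star_product.

Section symmetric_extension.
Context {R : realType} {X : topologicalType}.
Implicit Types (s : seq (set X)) (eta : fconf X).

Lemma symtens_perm n (f : 'I_n -> X -> R) (x : 'I_n -> X) (s : 'S_n) :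
  symtens f (x \o s) = symtens f x.
Proof.
rewrite /symtens; congr (_ * _).
rewrite [RHS](reindex_inj (mulIg s)); apply: eq_bigr => t _.
by apply: eq_bigr => i _; rewrite permM.
Qed.

(** Extends [injc_top s] to configurations with multiple points, as class S requires. The choice of
    an enumeration of [m] is harmless because [symtens] is symmetric; the factorial undoes its
    normalization. *)
Definition symext s (m : {mset X}%mset) : R :=
  if pselect (exists x : 'I_(size s) -> X, mconf x = m) is left e
  then (size s)`!%:R * symtens (fun i => \1_(tnth (in_tuple s) i)) (projT1 (cid e))
  else 0.

Lemma symext_mconf s (x : 'I_(size s) -> X) :
  symext s (mconf x) = (size s)`!%:R * symtens (fun i => \1_(tnth (in_tuple s) i)) x.
Proof.
rewrite /symext; case: pselect => [e|]; last by case; exists x.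
case: (cid e) => /= y /mconf_eqP[t ->]; congr (_ * _); exact: symtens_perm.
Qed.

Lemma size_mconf n (x : 'I_n -> X) : size (mconf x) = n.
Proof. by rewrite (perm_size (perm_eq_seq_mset _)) size_codom card_ord. Qed.

Lemma symext_neq s n (x : 'I_n -> X) : n != size s -> symext s (mconf x) = 0.
Proof.
move=> ns; rewrite /symext; case: pselect => // e; exfalso; case: e => y yx.
by have := size_mconf x; rewrite -yx size_mconf => e; move: ns; rewrite -e eqxx.
Qed.

Lemma size_mset_of_fconf eta : size (mset_of_fconf eta) = #|` eta|.
Proof. exact: (perm_size (perm_eq_seq_mset _)). Qed.

Lemma sum_perm_tuple n (eta : n.-tuple X) (s : n.-tuple (set X)) : uniq eta ->
  \sum_(p : 'S_n) \prod_(i < n) \1_(tnth s i) (tnth eta (p i)) =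
  \sum_(t <- permutations eta) \prod_(p <- zip s t) (p.2 \in p.1)%:R :> R.
Proof.
move=> ueta; pose t (p : 'S_n) := [tuple tnth eta (p i) | i < n].
transitivity (\sum_(u <- [seq val (t p) | p <- index_enum 'S_n])
   \prod_(p <- zip s u) (p.2 \in p.1)%:R : R).
  rewrite big_map; apply: eq_bigr => p _.
  have -> : zip s (t p) = [tuple (tnth s i, tnth eta (p i)) | i < n].
    have -> : t p = [tuple tnth eta (p i) | i < n] by [].
    rewrite -{1}(map_tnth_enum s) /=; elim: (enum _) => //= i l ->.
    by [].
  rewrite big_tuple; apply: eq_bigr => i _.
  by rewrite tnth_mktuple indicE.
apply: perm_big; apply: uniq_perm.
- rewrite map_inj_uniq ?index_enum_uniq// => p q /val_inj pq.
  apply/permP => i; have := congr1 (fun u => tnth u i) pq.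
  by rewrite !tnth_mktuple => /(tuple_uniqP _ ueta).
- exact: permutations_uniq.
move=> u; rewrite mem_permutations; apply/mapP/tuple_permP => [[p _ ->]|[p ->]].
  by exists p.
by exists p; rewrite ?mem_index_enum.
Qed.

Lemma symext_injc s eta : symext s (mset_of_fconf eta) = injc_top s eta.
Proof.
rewrite /injc_top; case: ifPn => [|ns]; last first.
  rewrite /symext; case: pselect => // e; exfalso; case: e => y yx.
  by have := size_mset_of_fconf eta; rewrite -yx size_mconf => e; move: ns; rewrite -e eqxx.
move=> etas; pose x := Tuple etas.
have xE : mconf (tnth x) = mset_of_fconf eta.
  by rewrite /mconf /mset_of_fconf; congr seq_mset; rewrite codomE map_tnth_enum.
rewrite -xE symext_mconf /symtens mulVKf ?pnatr_eq0 -?lt0n ?fact_gt0//.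
rewrite injc_permutations; last exact/eqP.
by rewrite (sum_perm_tuple (eta := x) (in_tuple s)) ?fset_uniq.
Qed.

(** (PD) and the correlation identity speak of functions in S; this lets them be applied to
    polynomials. Values at configurations with multiple points are supplied by [symext]. *)
Lemma polyc_ext (F : {fset X} -> R) : polyc (@precompact_borel X) F ->
  exists2 G, @Defs.classS R X G & forall eta, G (mset_of_fconf eta) = mob F eta.
Proof.
elim=> [|a _ g [s sC ->] _ [G [N N0 [GN Gs]] Gmob]].
  exists (fun=> 0); last by move=> eta; rewrite mob_cst0.
  exists 1%N => //; split=> // n _; exists 0%N, (fun=> 0), (fun _ _ => set0).
  by split=> [[]//|x]; rewrite big_ord0.
exists (fun m => a * symext s m + G m); last first.
  by move=> eta; rewrite mobD mobZ mob_injc symext_injc Gmob.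
exists (maxn N (size s)); first by rewrite leq_max N0.
split=> [n|n].
  rewrite gtn_max => /andP[Nn sn] x.
  by rewrite symext_neq ?gtn_eqF// GN// mulr0 addr0.
move=> /andP[n0 _].
have [m [c [D [DC GD]]]] : exists m (c : 'I_m -> R) (D : 'I_m -> 'I_n -> set X),
    (forall j i, precompact_borel (D j i)) /\
    forall x : 'I_n -> X,
      G (mconf x) = \sum_(j < m) c j * symtens (fun i => \1_(D j i)) x.
  have [nN|Nn] := leqP n N; first by apply: Gs; rewrite n0.
  exists 0%N, (fun=> 0), (fun _ _ => set0); split=> [[]//|x].
  by rewrite big_ord0 GN.
(* Only in degree [size s] does the new summand contribute; there it is put in front of the
   combination for [G]. *)
have [ns|ns] := eqVneq n (size s); last first.
  by exists m, c, D; split=> // x; rewrite symext_neq// mulr0 add0r GD.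
subst n; exists m.+1.
exists (fun j => if unlift ord0 j is Some i then c i else a * (size s)`!%:R).
exists (fun j => if unlift ord0 j is Some i then D i else tnth (in_tuple s)).
split=> [j i|x].
  case: unliftP => [k|] _; first exact: DC.
  by apply: sC; exact: mem_tnth.
rewrite big_ord_recl unlift_none symext_mconf mulrA; congr (_ + _).
by rewrite GD; apply: eq_bigr => j _; rewrite liftK.
Qed.

End symmetric_extension.

(** * Measurability and integration *)

Section borel_sets.
Context {T : topologicalType}.
Implicit Types A B D : set T.

Let sT : sigma_algebra setT (@borel T).
Proof. exact: smallest_sigma_algebra. Qed.

Let sTP := (@sigma_algebraP T setT (@borel T) (fun X _ => @subsetT _ X)).1 sT.

Lemma borelT : borel (@setT T). Proof. by have [] := sTP. Qed.

Lemma borelD A B : borel A -> borel B -> borel (A `\` B).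
Proof.
move=> bA bB; have [_ bSD _ bI] := sTP.
rewrite setDE; apply: bI => //; rewrite -setTD; apply: bSD => //; exact: borelT.
Qed.

Lemma borelC A : borel A -> borel (~` A).
Proof. by move=> bA; rewrite -setTD; apply: borelD => //; exact: borelT. Qed.

Lemma borelI A B : borel A -> borel B -> borel (A `&` B).
Proof. by have [_ _ _] := sTP; apply. Qed.

Lemma borelU A B : borel A -> borel B -> borel (A `|` B).
Proof.
move=> bA bB; rewrite -[_ `|` _]setCK setCU; apply: borelC; apply: borelI; exact: borelC.
Qed.

Lemma borel0 : borel (@set0 T). Proof. by rewrite -setCT; exact: (borelC borelT). Qed.

Lemma borel_bigcup (F : (set T)^nat) : (forall i, borel (F i)) -> borel (\bigcup_i F i).
Proof. exact: sigma_algebra_bigcup. Qed.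

Lemma borel_bigsetU (F : (set T)^nat) n :
  (forall i, borel (F i)) -> borel (\big[setU/set0]_(i < n) F i).
Proof.
move=> bF; elim/big_ind : _ => //; [exact: borel0|exact: borelU].
Qed.

Lemma open_borel A : open A -> borel A. Proof. exact: sub_sigma_algebra. Qed.

Lemma precompact_borelI : setI_closed (@precompact_borel T).
Proof.
move=> A B [bA pA] [bB pB]; split; first exact: borelI.
by apply: precompact_subset pA; exact: subIsetl.
Qed.

Lemma precompact_borel_sub A D : borel A -> A `<=` D -> precompact_borel D ->
  precompact_borel A.
Proof. by move=> bA AD [_ pD]; split=> //; exact: precompact_subset AD pD. Qed.

Lemma precompactU A B : precompact A -> precompact B -> precompact (A `|` B).
Proof.
rewrite !precompactE closureU; exact: compactU.
Qed.

Lemma precompact_borelU A B : precompact_borel A -> precompact_borel B ->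
  precompact_borel (A `|` B).
Proof. by move=> [bA pA] [bB pB]; split; [exact: borelU|exact: precompactU]. Qed.

Lemma precompact_borel0 : precompact_borel (@set0 T).
Proof. by split; [exact: borel0|rewrite precompactE closure0; exact: compact0]. Qed.

End borel_sets.

Section fconf_measurability.
Context {R : realType} {X : topologicalType}.
Implicit Types (eta : fconf X) (D : set X) (s : seq (set X)).

Lemma measurable_nat_preimage d (T : measurableType d) (f : T -> nat) :
  (forall k, measurable [set x | f x = k]) -> measurable_fun setT f.
Proof.
move=> mf _ Y _; rewrite setTI.
rewrite [X in measurable X](_ : _ = \bigcup_k (if k \in Y then [set x | f x = k] else set0)).
  by apply: bigcup_measurable => k _; case: ifP => _; [exact: mf|exact: measurable0].
apply/seteqP; split=> [x Yx|x [k _]].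
  by exists (f x) => //; rewrite mem_set.
by case: ifPn => // /set_mem Yk /= xk; rewrite /preimage/= xk.
Qed.

Lemma measurable_natr d (T : measurableType d) (f : T -> nat) :
  measurable_fun setT f -> measurable_fun setT (fun x => (f x)%:R : R).
Proof.
move=> mf; apply: (@measurableT_comp _ _ _ _ _ _ (fun n : nat => n%:R : R)) => //.
Qed.

Lemma measurable_fconf_card n : measurable (fconf_card X n).
Proof.
move=> k; apply/borel_fconf_cardP; exists (if k == n then setT else set0).
  by case: ifP => _; rewrite ?preimage_setT ?preimage_set0; [exact: borelT|exact: borel0].
move=> eta etak; rewrite /fconf_card/=; move: etak; rewrite /fconf_card/= => ->.
by case: eqP.
Qed.

Lemma borel_ptws_count D n k (l : seq 'I_n) : borel D ->
  borel ([set x | count (fun i => x i \in D) l = k] : set {ptws 'I_n -> X}).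
Proof.
move=> bD; elim: l k => [|i l IH] k.
  rewrite [X in borel X](_ : _ = if k == 0%N then setT else set0).
    by case: ifP => _; [exact: borelT|exact: borel0].
  by apply/seteqP; split=> x /=; case: k.
have bi : borel ([set x | D (x i)] : set {ptws 'I_n -> X}).
  apply: (@borel_preimage _ _ (fun x : {ptws 'I_n -> X} => x i)) => //.
  exact: proj_continuous.
rewrite [X in borel X](_ : _ =
  ([set x | D (x i)] `&` (if k is k'.+1 then
      [set x | count (fun i => x i \in D) l = k'] else set0)) `|`
  (~` [set x | D (x i)] `&` [set x | count (fun i => x i \in D) l = k])); last first.
  apply/seteqP; split=> x /=.
    have [xD|xD] := boolP (x i \in D).
      by case: k => // k [<-]; left; split=> //; exact: set_mem.
    by rewrite add0n => ?; right; split=> // /mem_set; exact/negP.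
  case=> [[Dx]|[Dx]]; last by rewrite memNset.
  by rewrite mem_set// add1n; case: k => // k /= ->.
apply: borelU; apply: borelI.
- exact: bi.
- by case: k => [|k]; [exact: borel0|exact: IH].
- exact: borelC.
- exact: IH.
Qed.

Lemma measurable_cnt_eq D k : borel D -> measurable [set eta : fconf X | cnt D eta = k].
Proof.
move=> bD; suff: borel_fconf [set eta : fconf X | cnt D eta = k] by [].
move=> n; apply/borel_fconf_cardP; exists [set m : {mset X}%mset | count (fun x => x \in D) m = k].
  rewrite [X in borel X](_ : _ =
    [set x : {ptws 'I_n -> X} | count (fun i => x i \in D) (enum 'I_n) = k]).
    exact: borel_ptws_count.
  have e (x : 'I_n -> X) : count (fun x => x \in D) (mconf x) =
      count (fun i => x i \in D) (enum 'I_n).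
    by rewrite (seq.permP (perm_eq_seq_mset _)) codomE count_map.
  by apply/seteqP; split=> x; rewrite /preimage/= e.
move=> eta _ /=; rewrite /mset_of_fconf.
by rewrite (seq.permP (perm_eq_seq_mset _)) cntE.
Qed.

Lemma measurable_cnt D : borel D ->
  measurable_fun setT (fun eta : fconf X => (cnt D eta)%:R : R).
Proof.
move=> bD; apply: measurable_natr; apply: measurable_nat_preimage => k.
exact: measurable_cnt_eq.
Qed.

Lemma measurable_fconf_sub D : borel D -> measurable [set eta : fconf X | [set` (eta : {fset X})] `<=` D].
Proof.
move=> bD; rewrite [X in measurable X](_ : _ = [set eta : fconf X | cnt (~` D) eta = 0%N]).
  by apply: measurable_cnt_eq; exact: borelC.
apply/seteqP; split=> eta /=; rewrite cntE => h.
  apply/eqP; rewrite -leqn0 leqNgt -has_count; apply/hasPn => x xe.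
  by rewrite in_setC negbK; apply/mem_set/h.
move=> x /= xe; apply: contrapT => xD; suff : (0 < count (fun x => x \in ~` D) (eta : {fset X}))%N.
  by rewrite h.
by rewrite -has_count; apply/hasP; exists x => //; exact/mem_set.
Qed.

Lemma measurable_fconf_in D n : borel D -> measurable (fconf_in D n).
Proof.
move=> bD; rewrite [X in measurable X](_ : _ = fconf_card X n `&`
  [set eta : fconf X | [set` (eta : {fset X})] `<=` D]).
  by apply: measurableI; [exact: measurable_fconf_card|exact: measurable_fconf_sub].
by apply/seteqP; split=> eta.
Qed.

Lemma measurable_injc s : (forall D, D \in s -> borel D) ->
  measurable_fun setT (injc s : fconf X -> R).
Proof.
have [n] := ubnP (size s); elim: n s => // n IH [|D s].
  by move=> _ _; exact: measurable_cst.
rewrite [size _]/= ltnS => sn sb.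
(* The terms are set to 0 outside [picks s], since [measurable_sum] asks for measurability of every
   term while the induction hypothesis covers only those in the list. *)
pose h p := if p \in picks s then injc (D `&` p.1 :: p.2) else fun=> 0 : R.
have -> : injc (D :: s) = (fun A => (cnt D A)%:R * injc s A -
    \sum_(p <- picks s) h p A) :> (fconf X -> R).
  apply/funext => A; rewrite cnt_injc [X in _ - X](_ : _ =
    \sum_(p <- picks s) injc (D `&` p.1 :: p.2) A) ?addrK//.
  by apply: eq_big_seq => p ps; rewrite /h ps.
apply: measurable_funB.
  apply: measurable_funM.
    by apply: measurable_cnt; apply: sb; rewrite mem_head.
  by apply: IH => // E Es; apply: sb; rewrite inE Es orbT.
apply: measurable_sum => p; rewrite /h; case: ifPn => ps; last exact: measurable_cst.
apply: IH; first exact: leq_ltn_trans (size_picks_lt ps) sn.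
have bs E : E \in p.1 :: p.2 -> borel E.
  by move=> Ep; apply: sb; rewrite inE (mem_picks ps Ep) orbT.
move=> E; rewrite inE => /orP[/eqP ->|Ep]; last by apply: bs; rewrite inE Ep orbT.
by apply: borelI; [apply: sb|apply: bs]; rewrite mem_head.
Qed.

Lemma measurable_injc_top s : (forall D, D \in s -> borel D) ->
  measurable_fun setT (injc_top s : fconf X -> R).
Proof.
move=> sb; rewrite (_ : injc_top s = (fun A : fconf X =>
    \1_(fconf_card X (size s)) A * injc s A)).
  apply: measurable_funM; last exact: measurable_injc.
  by apply: measurable_indic; exact: measurable_fconf_card.
apply/funext => A; rewrite /injc_top indicE; case: ifPn => As.
  by rewrite mem_set ?mul1r//; exact/eqP.
by rewrite memNset ?mul0r//; exact/eqP.
Qed.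

Lemma measurable_mob F : polyc (@precompact_borel X) F ->
  measurable_fun setT (mob F : fconf X -> R).
Proof.
elim=> [|a _ g [s sC ->] _ IH].
  by rewrite (_ : mob _ = fun=> 0) //; apply/funext => A; rewrite mob_cst0.
rewrite (_ : mob _ = (fun A => a * injc_top s A + mob g A)).
  apply: measurable_funD => //; apply: measurable_funM => //.
  by apply: measurable_injc_top => D /sC[].
by apply/funext => A; rewrite mobD mobZ mob_injc.
Qed.

End fconf_measurability.

Section real_integrals.
Context d {T : measurableType d} {R : realType}.
Variable mu : {measure set T -> \bar R}.
Implicit Types f g : T -> R.

Definition rint f := Rintegral mu setT f.

Definition rintegrable f := mu.-integrable setT (EFin \o f).

Lemma rintegrable_measurable f : rintegrable f -> measurable_fun setT f.
Proof. by move=> /integrableP[mf _]; exact/measurable_EFinP. Qed.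

Lemma rintegrable_le f g : measurable_fun setT f ->
  (forall x, `|f x| <= g x) -> rintegrable g -> rintegrable f.
Proof.
move=> mf fg ig; apply: le_integrable ig => //; first exact/measurable_EFinP.
by move=> x _ /=; rewrite lee_fin (le_trans (fg x))// ler_norm.
Qed.

Lemma rintegrableD f g : rintegrable f -> rintegrable g -> rintegrable (fun x => f x + g x).
Proof.
move=> i_f ig; have := integrableD measurableT i_f ig.
by apply: eq_integrable => // x _ /=; rewrite EFinD.
Qed.

Lemma rintegrableZ a f : rintegrable f -> rintegrable (fun x => a * f x).
Proof.
move=> i_f; have := integrableZl measurableT a i_f.
by apply: eq_integrable => // x _ /=; rewrite EFinM.
Qed.

Lemma rintegrableB f g : rintegrable f -> rintegrable g -> rintegrable (fun x => f x - g x).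
Proof.
move=> i_f ig; rewrite (_ : (fun x => f x - g x) = (fun x => f x + -1 * g x)).
  by apply: rintegrableD => //; exact: rintegrableZ.
by apply/funext => x; rewrite mulN1r.
Qed.

Lemma rintegrable0 : rintegrable (fun=> 0).
Proof. exact: integrable0. Qed.

Lemma rintegrable_indic A : measurable A -> (mu A < +oo)%E -> rintegrable \1_A.
Proof.
move=> mA Aoo; apply/integrableP; split; first exact/measurable_EFinP.
rewrite (eq_integral (fun x => (\1_A x)%:E)); last first.
  by move=> t _; rewrite /= ger0_norm.
by rewrite integral_indic// setIT.
Qed.

Lemma rint_indic A : measurable A -> rint \1_A = fine (mu A).
Proof. by move=> mA; rewrite /rint /Rintegral integral_indic// setIT. Qed.

Lemma rintD f g : rintegrable f -> rintegrable g ->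
  rint (fun x => f x + g x) = rint f + rint g.
Proof. exact: RintegralD. Qed.

Lemma rintZ a f : rintegrable f -> rint (fun x => a * f x) = a * rint f.
Proof. exact: RintegralZl. Qed.

Lemma rintB f g : rintegrable f -> rintegrable g ->
  rint (fun x => f x - g x) = rint f - rint g.
Proof. exact: RintegralB. Qed.

Lemma rint_le f g : rintegrable f -> rintegrable g -> (forall x, f x <= g x) ->
  rint f <= rint g.
Proof. by move=> i_f ig fg; apply: le_Rintegral. Qed.

Lemma rint_ge0 f : (forall x, 0 <= f x) -> 0 <= rint f.
Proof. by move=> f0; apply: Rintegral_ge0. Qed.

Lemma rint0 : rint (fun=> 0) = 0.
Proof. by rewrite /rint /Rintegral integral0_eq. Qed.

Lemma EFin_rint f : rintegrable f -> (\int[mu]_x (f x)%:E)%E = (rint f)%:E.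
Proof.
by move=> i_f; rewrite /rint /Rintegral fineK//; exact: integrable_fin_num.
Qed.

Lemma rint_dominated (F : nat -> T -> R) f g :
  (forall n, measurable_fun setT (F n)) -> rintegrable g ->
  (forall n x, `|F n x| <= g x) -> (forall x, F n x @[n --> \oo] --> f x) ->
  rint (F n) @[n --> \oo] --> rint f.
Proof.
move=> mF ig Fg Ff.
have mf : measurable_fun setT f.
  by apply: (measurable_fun_cvg mF) => x _; exact: Ff.
have fg x : `|f x| <= g x.
  have fx : `|F n x| @[n --> \oo] --> `|f x| by apply: cvg_norm; exact: Ff.
  rewrite -(cvg_lim _ fx)//; apply: limr_le; first exact: cvgP fx.
  by apply: nearW => n; exact: Fg.
have i_f : rintegrable f by exact: (rintegrable_le mf fg).
apply: fine_cvg; rewrite fineK; last exact: integrable_fin_num.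
have mF' n : measurable_fun setT (EFin \o F n) by exact/measurable_EFinP.
have Ff' x : setT x -> (EFin \o F n) x @[n --> \oo] --> (EFin \o f) x.
  by move=> _; apply: cvg_EFin; [exact: nearW|exact: Ff].
have Fg' n x : setT x -> (`|(EFin \o F n) x| <= (EFin \o g) x)%E.
  by move=> _; rewrite lee_fin.
exact: (@dominated_cvg _ _ _ mu setT measurableT _ _ _ mF' Ff' _ ig Fg').
Qed.

Lemma rint_fatou (F : nat -> T -> R) f M :
  (forall n, rintegrable (F n)) -> (forall n x, 0 <= F n x) ->
  (forall x, F n x @[n --> \oo] --> f x) -> (forall n, rint (F n) <= M) ->
  rintegrable f /\ rint f <= M.
Proof.
move=> iF F0 Ff FM.
have mf : measurable_fun setT f.
  apply: (@measurable_fun_cvg _ _ _ _ F) => [n|x _]; last exact: Ff.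
  exact: rintegrable_measurable.
have f0 x : 0 <= f x.
  by rewrite -(cvg_lim _ (Ff x))//; apply: limr_ge; [exact: cvgP (Ff x)|exact: nearW].
have fM : (\int[mu]_x (f x)%:E <= M%:E)%E.
  have mF n : measurable_fun setT (EFin \o F n).
    by apply/measurable_EFinP; exact: rintegrable_measurable.
  have F0' n x : setT x -> (0 <= (EFin \o F n) x)%E by rewrite lee_fin.
  have := @fatou _ _ _ mu setT measurableT _ mF F0'.
  rewrite (eq_integral (fun x => (f x)%:E)); last first.
    move=> x _; have fx : (EFin \o F n) x @[n --> \oo] --> (f x)%:E.
      by apply: cvg_EFin; [exact: nearW|exact: Ff].
    by rewrite is_cvg_limn_einfE; [exact: cvg_lim|exact: cvgP fx].
  move=> /le_trans; apply; rewrite (_ : (fun n => _) = (fun n => (rint (F n))%:E)); last first.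
    by apply/funext => n; rewrite EFin_rint.
  rewrite limn_einf_lim; apply: lime_le; first exact: is_cvg_einfs.
  apply: nearW => n; apply: (@le_trans _ _ (rint (F n))%:E); last by rewrite lee_fin.
  by apply: ereal_inf_lbound; exists n => /=.
have i_f : rintegrable f.
  apply/integrableP; split; first exact/measurable_EFinP.
  rewrite (eq_integral (fun x => (f x)%:E)); last first.
    by move=> t _; rewrite /= ger0_norm.
  by rewrite (le_lt_trans fM)// ltry.
by split=> //; rewrite -lee_fin -EFin_rint.
Qed.

End real_integrals.

(** * The correlation functional and its extension *)

Section correlation_functional.
Context {R : realType} {X : topologicalType}.
Variable rho : {measure set (fconf X) -> \bar R}.
Hypothesis rho_fin : forall D, precompact_borel D -> forall n,
  (rho (fconf_in D n) < +oo)%E.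
Implicit Types (F : {fset X} -> R) (D : set X) (s : seq (set X)) (eta : fconf X).

Local Notation poly := (@polyc X R (@precompact_borel X)).

Lemma bigcup_seq_precompact s : (forall D, D \in s -> precompact_borel D) ->
  precompact_borel (\big[setU/set0]_(D <- s) D).
Proof.
move=> sC; rewrite big_seq; elim/big_ind : _ => [|A B|D Ds].
- exact: precompact_borel0.
- exact: precompact_borelU.
- exact: sC.
Qed.

(** The function is bounded and lives on the configurations with [size s] points in a precompact
    set. As these have finite measure, polynomials have integrable Moebius transforms. *)
Lemma injc_top_le s eta :
  injc_top s eta <= (size s)%:R ^+ size s *
     \1_(fconf_in (\big[setU/set0]_(D <- s) D) (size s)) eta :> R.
Proof.
rewrite /injc_top indicE; case: ifPn => [/eqP es|_]; last first.
  by rewrite mulr_ge0// exprn_ge0.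
have [etas|etas] := pselect ([set` (eta : {fset X})] `<=` \big[setU/set0]_(D <- s) D).
  by have := @injc_le X R s eta; rewrite es => ise; rewrite mem_set ?mulr1.
suff -> : injc s eta = 0 :> R by rewrite mulr_ge0// exprn_ge0.
have [x [xe xs]] : exists x, x \in (eta : {fset X}) /\ ~ (\big[setU/set0]_(D <- s) D) x.
  apply: contrapT => nx; apply: etas => x /= xZ; apply: contrapT => Dx.
  by apply: nx; exists x.
have := @injc_top_eq0 X R s eta x xe; rewrite /injc_top es eqxx; apply => D Ds.
apply/negP => /set_mem Dx; apply: xs; rewrite -bigcup_seq; by exists D.
Qed.

Lemma rintegrable_injc_top s : (forall D, D \in s -> precompact_borel D) ->
  rintegrable rho (injc_top s : fconf X -> R).
Proof.
move=> sC; have pU := bigcup_seq_precompact sC.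
apply: (@rintegrable_le _ _ _ _ _ (fun eta => (size s)%:R ^+ size s *
    \1_(fconf_in (\big[setU/set0]_(D <- s) D) (size s)) eta)).
- by apply: measurable_injc_top => D /sC[].
- move=> eta; rewrite ger0_norm ?injc_top_le//.
  by rewrite /injc_top; case: ifP => // _; exact: injc_ge0.
- apply: rintegrableZ; apply: rintegrable_indic; last exact: rho_fin.
  by apply: measurable_fconf_in; case: pU.
Qed.

Lemma rintegrable_mob F : poly F -> rintegrable rho (mob F : fconf X -> R).
Proof.
elim=> [|a _ g [s sC ->] _ IH].
  rewrite (_ : mob _ = fun=> 0) //; first exact: rintegrable0.
  by apply/funext => A; rewrite mob_cst0.
rewrite (_ : mob _ = (fun A => a * injc_top s A + mob g A)).
  by apply: rintegrableD => //; apply: rintegrableZ; exact: rintegrable_injc_top.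
by apply/funext => A; rewrite mobD mobZ mob_injc.
Qed.

Definition corr F : R := rint rho (mob F : fconf X -> R).

Lemma corrD F G : poly F -> poly G -> corr (fun A => F A + G A) = corr F + corr G.
Proof.
move=> pF pG; rewrite /corr -rintD; try exact: rintegrable_mob.
by congr rint; apply/funext => A; rewrite mobD.
Qed.

Lemma corrZ a F : poly F -> corr (fun A => a * F A) = a * corr F.
Proof.
move=> pF; rewrite /corr -rintZ; try exact: rintegrable_mob.
by congr rint; apply/funext => A; rewrite mobZ.
Qed.

(** If [F] sums [G] over subsets, the Moebius transform of the square of [F] is the star-convolution
    of [G] with itself, so this is (PD). *)
Lemma corr_ge0 F : positive_definite rho -> poly F -> 0 <= corr (fun A => F A * F A).
Proof.
move=> rhoPD pF; have [G SG GF] := polyc_ext pF.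
have pFF : poly (fun A => F A * F A) by apply: polycM => //; exact: precompact_borelI.
have := rhoPD _ SG; rewrite (eq_integral (fun A : fconf X => (mob (fun A => F A * F A) A)%:E)).
  by rewrite EFin_rint ?lee_fin//; exact: rintegrable_mob.
move=> eta _; rewrite star_conv; congr EFin.
transitivity (uconv (mob F) (mob F) eta).
  by rewrite /uconv; apply: eq_bigr => A _; apply: eq_bigr => B _; rewrite !GF.
by rewrite uconvE; apply: eq_mob => B _; rewrite zeta_mob.
Qed.

(* 255 = 15 + 15 + 15 * 15 and 15 = 3 + 3 + 3 * 3 come from bounding convolutions
   of functions of growth 3^|eta|. *)
Definition weight D N eta : R :=
  if (restr D eta == eta) && (N <= #|` eta|)%N then 255 ^+ #|` eta| else 0.

Definition tame D := rintegrable rho (weight D 0).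

Definition tail D N : R := rint rho (weight D N).

Lemma weight_ge0 D N eta : 0 <= weight D N eta.
Proof. by rewrite /weight; case: ifP => // _; rewrite exprn_ge0. Qed.

Lemma measurable_weight D N : borel D -> measurable_fun setT (weight D N).
Proof.
move=> bD; pose w (k : nat) eta : R := if (N <= k)%N then 255 ^+ k * \1_(fconf_in D k) eta else 0.
apply: (@measurable_fun_cvg _ _ _ _ (fun n eta => \sum_(0 <= k < n) w k eta)).
  move=> n; apply: measurable_sum => k; rewrite /w; case: (N <= k)%N; last exact: measurable_cst.
  by apply: measurable_funM => //; apply: measurable_indic; exact: measurable_fconf_in.
move=> eta _; apply: cvg_near_cst.
near=> n.
have en : (#|` eta| < n)%N by near: n; exact: nbhs_infty_gt.
rewrite (big_cat_nat (n := #|` eta|.+1))//= big_nat_recr//= big_nat big1.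
  rewrite add0r big_nat big1 ?addr0.
    rewrite /weight /w; case: (leqP N #|` eta|) => Ne; rewrite ?andbF ?andbT//.
    rewrite indicE; case: ifPn => De.
      by rewrite mem_set ?mulr1//; split => //; exact/restrP.
    by rewrite memNset ?mulr0// => -[_ /restrP]; exact/negP.
  move=> k /andP[ek _]; rewrite /w; case: ifP => // _; rewrite indicE memNset ?mulr0// => -[ke _].
  by move: ek; rewrite ke ltnn.
move=> k /andP[_ ek]; rewrite /w; case: ifP => // _; rewrite indicE memNset ?mulr0// => -[ke _].
by move: ek; rewrite ke ltnn.
Unshelve. all: by end_near. Qed.

Lemma weight_le D N eta : weight D N eta <= weight D 0 eta.
Proof.
rewrite /weight leq0n andbT; case: eqP => //= _; case: ifP => // _.
Qed.

Lemma rintegrable_weight D N : borel D -> tame D -> rintegrable rho (weight D N).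
Proof.
move=> bD; apply: rintegrable_le; first exact: measurable_weight.
by move=> eta; rewrite ger0_norm ?weight_ge0// weight_le.
Qed.

Lemma tail_cvg0 D : borel D -> tame D -> tail D N @[N --> \oo] --> (0 : R).
Proof.
move=> bD tD; rewrite -(rint0 rho).
apply: (rint_dominated (g := weight D 0)) => //.
- by move=> n; exact: measurable_weight.
- by move=> n eta; rewrite ger0_norm ?weight_ge0// weight_le.
move=> eta; apply: cvg_near_cst.
near=> n; have en : (#|` eta| < n)%N by near: n; exact: nbhs_infty_gt.
by rewrite /weight leqNgt en andbF.
Unshelve. all: by end_near. Qed.

Lemma tame_sub D D' : borel D -> D `<=` D' -> tame D' -> tame D.
Proof.
move=> bD DD'; apply: rintegrable_le; first exact: measurable_weight.
move=> eta; rewrite ger0_norm ?weight_ge0// /weight !leq0n !andbT.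
case: ifP => [/restrP eD|_]; last by case: ifP => // _; rewrite exprn_ge0.
by rewrite ifT//; apply/restrP; exact: subset_trans DD'.
Qed.

(** The Moebius transform of the square is the convolution of [mob F] with itself: the rate 15
    becomes 255, and a nonzero term needs two sets in [D], each with at least [N] points. What
    remains is the integral of [weight D N]. *)
Lemma corr_square_le F D N c : poly F -> borel D -> tame D ->
  (forall Z, `|mob F Z| <= c * 15 ^+ #|` Z|) ->
  (forall Z, ~ [set` Z] `<=` D -> mob F Z = 0) ->
  (forall Z, (#|` Z| < N)%N -> mob F Z = 0) ->
  corr (fun A => F A * F A) <= c ^+ 2 * tail D N.
Proof.
move=> pF bD tD Fc FD FN.
have pFF : poly (fun A => F A * F A) by apply: polycM => //; exact: precompact_borelI.
have i_w := rintegrable_weight N bD tD.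
rewrite -rintZ//; apply: rint_le; [exact: rintegrable_mob|exact: rintegrableZ|].
move=> Z; have -> : mob (fun A => F A * F A) Z = uconv (mob F) (mob F) Z.
  by rewrite uconvE; apply: eq_mob => B _; rewrite !zeta_mob.
rewrite /weight; case: ifPn => [_|].
  apply: le_trans (ler_norm _) _; apply: le_trans (normr_uconv_le _ _) _ => //.
  by rewrite expr2 (_ : 15 + 15 + 15 * 15 = 255 :> R)//; ring.
move=> DZ; rewrite mulr0 uconv_eq0// => A B AB; apply/eqP; apply: contraNT DZ.
rewrite mulf_eq0 negb_or => /andP[/eqP FA /eqP FB].
have AD : [set` A] `<=` D by apply: contrapT => /FD.
have BD : [set` B] `<=` D by apply: contrapT => /FD.
apply/andP; split.
  by apply/restrP => x /=; rewrite -AB inE => /orP[/AD|/BD].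
rewrite (leq_trans (n := #|` A|))//; last by rewrite fsubset_leq_card// -AB fsubsetUl.
by rewrite leqNgt; apply/negP => /FN.
Qed.

End correlation_functional.

(** * Functionals that are nonnegative on squares *)

Section positive_functionals.
Context {T : Type} {R : realType}.
Implicit Types (f g h w : T -> R).

(** Positivity is asked for squares of elements of [V] only. Comparing two functions therefore takes
    the square root of their difference in [V] ([pf_le]); an indicator is its own square. *)
Record posfun (V : set (T -> R)) (E : (T -> R) -> R) : Prop := Posfun {
  pf_cst : forall c, V (fun=> c) ;
  pf_VD : forall f g, V f -> V g -> V (fun x => f x + g x) ;
  pf_VM : forall f g, V f -> V g -> V (fun x => f x * g x) ;
  pf_D : forall f g, V f -> V g -> E (fun x => f x + g x) = E f + E g ;
  pf_Z : forall c f, V f -> E (fun x => c * f x) = c * E f ;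
  pf_sq : forall f, V f -> 0 <= E (fun x => f x * f x) }.

Variables (V : set (T -> R)) (E : (T -> R) -> R).
Hypothesis VE : posfun V E.

Lemma pf_VZ c f : V f -> V (fun x => c * f x).
Proof. by move=> Vf; apply: (pf_VM VE) => //; exact: (pf_cst VE). Qed.

Lemma pf_VB f g : V f -> V g -> V (fun x => f x - g x).
Proof.
move=> Vf Vg; rewrite (_ : (fun x => f x - g x) = (fun x => f x + -1 * g x)).
  by apply: (pf_VD VE) => //; exact: pf_VZ.
by apply/funext => x; rewrite mulN1r.
Qed.

Lemma pf_B f g : V f -> V g -> E (fun x => f x - g x) = E f - E g.
Proof.
move=> Vf Vg; rewrite (_ : (fun x => f x - g x) = (fun x => f x + -1 * g x)).
  by rewrite (pf_D VE) ?(pf_Z VE) ?mulN1r//; exact: pf_VZ.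
by apply/funext => x; rewrite mulN1r.
Qed.

Lemma pf_0 : E (fun=> 0) = 0.
Proof.
have := pf_Z VE 0 (pf_cst VE 0); rewrite (mul0r (E _)) => e; rewrite -[RHS]e.
by congr E; apply/funext => x; rewrite mul0r.
Qed.

Lemma pf_sum I (r : seq I) (P : pred I) (F : I -> T -> R) : (forall i, P i -> V (F i)) ->
  V (fun x => \sum_(i <- r | P i) F i x) /\
  E (fun x => \sum_(i <- r | P i) F i x) = \sum_(i <- r | P i) E (F i).
Proof.
move=> VF; elim: r => [|i r [IH1 IH2]].
  rewrite big_nil (_ : (fun _ => _) = (fun=> 0)); last by apply/funext => x; rewrite big_nil.
  by split; [exact: (pf_cst VE)|exact: pf_0].
rewrite big_cons; case Pi : (P i); last first.
  rewrite (_ : (fun _ => _) = (fun x => \sum_(j <- r | P j) F j x)) //.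
  by apply/funext => x; rewrite big_cons Pi.
rewrite (_ : (fun _ => _) = (fun x => F i x + \sum_(j <- r | P j) F j x)); last first.
  by apply/funext => x; rewrite big_cons Pi.
by split; [apply: (pf_VD VE) => //; exact: VF|rewrite (pf_D VE) ?IH2//; exact: VF].
Qed.

Lemma pf_le f g : V f -> V g -> V (fun x => Num.sqrt (g x - f x)) ->
  (forall x, f x <= g x) -> E f <= E g.
Proof.
move=> Vf Vg Vs fg; rewrite -subr_ge0 -pf_B//.
rewrite (_ : (fun x => g x - f x) = (fun x => Num.sqrt (g x - f x) * Num.sqrt (g x - f x))).
  exact: (pf_sq VE).
by apply/funext => x; rewrite -expr2 sqr_sqrtr// subr_ge0.
Qed.

Lemma pf_cauchy_schwarz h w : V h -> V w ->
  E (fun x => h x * w x) ^+ 2 <= E (fun x => h x * h x) * E (fun x => w x * w x).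
Proof.
move=> Vh Vw; set a := E (fun x => h x * h x); set c := E (fun x => w x * w x).
set b := E (fun x => h x * w x).
have q t : 0 <= a + 2 * t * b + t ^+ 2 * c.
  have Vtw := pf_VZ t Vw.
  have := pf_sq VE (pf_VD VE Vh Vtw); rewrite (_ : (fun _ => _) =
    (fun x => (h x * h x + (2 * t) * (h x * w x)) + t ^+ 2 * (w x * w x))).
    have Vhh := pf_VM VE Vh Vh; have Vhw := pf_VM VE Vh Vw; have Vww := pf_VM VE Vw Vw.
    rewrite (pf_D VE (pf_VD VE Vhh (pf_VZ (2 * t) Vhw)) (pf_VZ (t ^+ 2) Vww)).
    by rewrite (pf_D VE Vhh (pf_VZ (2 * t) Vhw)) !(pf_Z VE).
  by apply/funext => x; ring.
have c0 : 0 <= c by exact: (pf_sq VE).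
have [c_eq0|c_neq0] := eqVneq c 0.
  rewrite c_eq0 mulr0; suff -> : b = 0 by rewrite expr0n.
  (* If [c] vanishes the quadratic polynomial is affine in [t], and this [t] would give it the value
     -1. *)
  apply: contrapT => /eqP b0; have := q (- (a + 1) / (2 * b)).
  rewrite c_eq0 (_ : a + _ + _ = - 1); first by rewrite oppr_ge0 ler10.
  by field.
have cp : 0 < c by rewrite lt_def c_neq0.
have := q (- b / c); rewrite -(ler_pM2r cp) mul0r.
rewrite (_ : (a + _ + _) * c = a * c - b ^+ 2); first by rewrite subr_ge0.
by field.
Qed.

Lemma pf_square_le h w : V h -> V w ->
  `|E (fun x => h x * w x)| <= Num.sqrt (E (fun x => h x * h x)) * Num.sqrt (E (fun x => w x * w x)).
Proof.
move=> Vh Vw; rewrite -sqrtr_sqr -sqrtrM; last exact: (pf_sq VE).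
by rewrite ler_sqrt ?pf_cauchy_schwarz// mulr_ge0 ?(pf_sq VE).
Qed.

End positive_functionals.

Section cell_functions.
Context {R : realType} {X : topologicalType}.
Implicit Types (F phi psi w : {fset X} -> R) (D : set X) (A Z : {fset X}).

Lemma poly_le_exp d : exists2 C : R, 0 <= C & forall n : nat, (1 + n%:R) ^+ d <= C * 2 ^+ n.
Proof.
case: d => [|d]; first by exists 1 => // n; rewrite expr0 mul1r exprn_ege1// ler1n.
exists ((d.+1)%:R ^+ d.+1); first by rewrite exprn_ge0.
move=> n; rewrite [1 + _]addrC natr1 -!natrX -natrM ler_nat.
(* [n.+1] is at most [d.+1 * (n %/ d.+1).+1], and [k.+1] is at most [2 ^ k]; raised to the power
   [d.+1] the right side is at most a constant times [2 ^ n]. *)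
have h : (n.+1 <= d.+1 * 2 ^ (n %/ d.+1))%N.
  apply: (@leq_trans (d.+1 * (n %/ d.+1).+1)); last by rewrite leq_mul2l ltn_expl ?orbT.
  by rewrite mulnC ltn_ceil.
apply: (@leq_trans ((d.+1 * 2 ^ (n %/ d.+1)) ^ d.+1)); first by rewrite leq_exp2r.
by rewrite expnMn leq_mul2l -expnM leq_exp2l// leq_trunc_div orbT.
Qed.

(** Finitely many labels with Borel classes: a local function of this kind becomes a polynomial as
    soon as its Moebius expansion is cut off ([poly_trunc]). *)
Definition measinv F := exists (P : finType) (f : X -> P),
  (forall t, borel [set x | f x = t]) /\ invar f F.

(** Polynomial growth keeps the class closed under products; it is then weakened to the rate 2
    ([cellfun_exp]), from which the later rates follow. Square roots stay in the class
    ([cellfun_sqrt]), as [pf_le] requires. *)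
Record cellfun D phi : Prop := Cellfun {
  cf_loc : loc D phi ;
  cf_inv : measinv phi ;
  cf_growth : exists (a : R) d, forall A, `|phi A| <= a * (1 + #|` A|%:R) ^+ d }.

Lemma measinv_pair (P Q : finType) (f : X -> P) (g : X -> Q) :
  (forall t, borel [set x | f x = t]) -> (forall t, borel [set x | g x = t]) ->
  forall t, borel [set x | (f x, g x) = t].
Proof.
move=> bf bg [p q]; rewrite (_ : [set x | _] = [set x | f x = p] `&` [set x | g x = q]).
  exact: borelI.
by apply/seteqP; split=> x /= => [[]//|[-> ->]].
Qed.

Lemma measinv_op F phi (h : R -> R -> R) : measinv F -> measinv phi ->
  measinv (fun A => h (F A) (phi A)).
Proof.
move=> [P [f [bf fF]]] [Q [g [bg gphi]]].
exists (P * Q)%type, (fun x => (f x, g x)); split; first exact: measinv_pair.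
by apply: inv_op; [apply: (inv_refine _ fF)|apply: (inv_refine _ gphi)] => x y [].
Qed.

Lemma measinv_comp F (h : R -> R) : measinv F -> measinv (fun A => h (F A)).
Proof. by move=> mF; exact: (measinv_op (fun a _ => h a) mF mF). Qed.

Lemma measinv_cst c : measinv (fun=> c).
Proof.
exists unit, (fun=> tt); split=> // t.
rewrite (_ : [set _ | _] = setT); first exact: borelT.
by apply/seteqP; split=> // x _ /=; case: t.
Qed.

Lemma borel_mem D (t : bool) : borel D -> borel [set x | (x \in D) = t].
Proof.
move=> bD; case: t.
  rewrite (_ : [set _ | _] = D)//.
  by apply/seteqP; split=> x /=; [exact: set_mem|exact: mem_set].
rewrite (_ : [set _ | _] = ~` D); first exact: borelC.
apply/seteqP; split=> x /=; first by move=> xD /mem_set; rewrite xD.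
by move=> xD; rewrite memNset.
Qed.

Lemma measinv_cnt D (h : nat -> R) : borel D -> measinv (fun A => h (cnt D A)).
Proof.
move=> bD; exists bool, (fun x => x \in D); split=> [t|A A'].
  exact: borel_mem.
by move=> /(inv_cnt (D := D)) ->.
Qed.

Lemma cellfun_cst D c : cellfun D (fun=> c).
Proof.
split; [exact: loc_cst|exact: measinv_cst|].
by exists `|c|, 0%N => A; rewrite expr0 mulr1.
Qed.

Lemma cellfunM D phi psi : cellfun D phi -> cellfun D psi ->
  cellfun D (fun A => phi A * psi A).
Proof.
move=> [l1 i1 [a [d g1]]] [l2 i2 [b [e g2]]]; split.
- exact: loc_op.
- exact: measinv_op.
exists (a * b), (d + e)%N => A; rewrite exprD mulrACA normrM.
by apply: ler_pM.
Qed.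

Lemma cellfunD D phi psi : cellfun D phi -> cellfun D psi ->
  cellfun D (fun A => phi A + psi A).
Proof.
move=> [l1 i1 [a [d g1]]] [l2 i2 [b [e g2]]]; split.
- exact: (loc_op (fun a b => a + b)).
- exact: (measinv_op (fun a b => a + b)).
have n0 n : (1 : R) <= 1 + n%:R by rewrite lerDl.
have p0 f c k : (forall A, `|f A| <= c * (1 + #|` A|%:R) ^+ k) -> 0 <= c.
  move=> /(_ fset0); rewrite cardfs0 addr0 expr1n mulr1; apply: le_trans.
  exact: normr_ge0.
exists (a + b), (d + e)%N => A; rewrite (le_trans (ler_normD _ _))// mulrDl lerD//.
  rewrite (le_trans (g1 A))//; apply: ler_wpM2l; first exact: p0 g1.
  by apply: ler_weXn2l; rewrite ?n0// leq_addr.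
rewrite (le_trans (g2 A))//; apply: ler_wpM2l; first exact: p0 g2.
by apply: ler_weXn2l; rewrite ?n0// leq_addl.
Qed.

Lemma cellfunZ D phi c : cellfun D phi -> cellfun D (fun A => c * phi A).
Proof. by move=> cphi; apply: cellfunM => //; exact: cellfun_cst. Qed.

Lemma cellfun_exp D phi : cellfun D phi ->
  exists2 c : R, 0 <= c & forall A, `|phi A| <= c * 2 ^+ #|` A|.
Proof.
move=> [_ _ [a [d phia]]]; have [C C0 Cd] := poly_le_exp d.
have a0 : 0 <= a.
  have := phia fset0; rewrite cardfs0 addr0 expr1n mulr1; apply: le_trans.
  exact: normr_ge0.
exists (a * C) => [|A]; first by rewrite mulr_ge0.
by rewrite (le_trans (phia A))// -mulrA ler_wpM2l.
Qed.

Lemma cellfun_le D phi psi : loc D phi -> measinv phi -> cellfun D psi ->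
  (forall A, `|phi A| <= `|psi A|) -> cellfun D phi.
Proof.
move=> l1 i1 [_ _ [a [d g]]] le; split=> //.
by exists a, d => A; exact: le_trans (g A).
Qed.

Lemma cellfunB D phi psi : cellfun D phi -> cellfun D psi ->
  cellfun D (fun A => phi A - psi A).
Proof.
move=> cphi cpsi; rewrite (_ : (fun A => _) = (fun A => phi A + -1 * psi A)).
  by apply: cellfunD => //; exact: cellfunZ.
by apply/funext => A; rewrite mulN1r.
Qed.

(** The square root is bounded by [1 + phi * phi]; where [phi] is negative, [Num.sqrt] is 0. *)
Lemma cellfun_sqrt D phi : cellfun D phi -> cellfun D (fun A => Num.sqrt (phi A)).
Proof.
move=> cphi; have [l1 i1 _] := cphi.
have c1 := cellfunD (cellfun_cst D 1) (cellfunM cphi cphi).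
apply: cellfun_le c1 _.
- exact: (loc_op (fun a _ => Num.sqrt a)).
- exact: measinv_comp.
move=> A; have p2 : 0 <= phi A * phi A by rewrite -expr2 sqr_ge0.
rewrite ger0_norm ?sqrtr_ge0// ger0_norm ?addr_ge0//.
have [p0|p0] := leP 0 (phi A); last by rewrite ltr0_sqrtr// addr_ge0.
have := sqr_sqrtr p0; set s := Num.sqrt _ => <-; have s0 : 0 <= s by exact: sqrtr_ge0.
have h1 : 0 <= (s - 1) ^+ 2 by exact: sqr_ge0.
have h2 : 0 <= (s ^+ 2 - 1) ^+ 2 by exact: sqr_ge0.
have h3 : 0 <= s ^+ 2 * s ^+ 2 by rewrite -expr2 sqr_ge0.
move: h1 h2 h3; rewrite !sqrrB !mulr1 expr1n.
by rewrite -[s ^+ 2 * s ^+ 2]expr2; set u := s ^+ 2; set v := u ^+ 2; lra.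
Qed.

Local Notation poly := (@polyc X R (@precompact_borel X)).

Lemma poly_trunc D N phi : precompact_borel D -> loc D phi -> measinv phi ->
  poly (trunc D N phi).
Proof.
move=> pD lphi [P [f [bf fphi]]].
rewrite (_ : trunc D N phi = zeta (mob_trunc D N phi)); last first.
  by apply/funext => A; exact: truncE.
(* [mob_trunc] tests whether [Z] lies in [D], so the label also records membership in [D]. *)
pose g x := (f x, x \in D).
have gf x y : g x = g y -> f x = f y by case.
have gD x y : g x = g y -> (x \in D) = (y \in D) by case.
apply: (@polyc_zeta _ _ _ _ g D N).
- move=> A A' AA'; rewrite /mob_trunc (inv_card AA').
  have -> : (restr D A == A) = (restr D A' == A').
    have := inv_cnt gD AA'; have := inv_card AA'; rewrite /cnt => e1 e2.
    apply/idP/idP => /eqP e; rewrite eqEfcard restr_sub /=.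
      by rewrite -e2 -e1 e.
    by rewrite e2 e1 e.
  by case: ifP => // _; apply: (inv_mob fphi); exact: perm_refine AA'.
- move=> t; apply: (precompact_borel_sub _ _ pD); last exact: subIsetr.
  apply: borelI; last by case: pD.
  apply: (measinv_pair bf (g := fun x => x \in D)) => b.
  by apply: borel_mem; case: pD.
- by move=> Z ZD; rewrite /mob_trunc; case: ifP => // /andP[_ /restrP].
- by move=> Z NZ; rewrite /mob_trunc leqNgt NZ.
Qed.

End cell_functions.

(** * Adding the functions of one cell *)

Section tower_step.
Context {R : realType} {X : topologicalType}.
Variable rho : {measure set (fconf X) -> \bar R}.
Hypothesis rho_fin : forall D, precompact_borel D -> forall n,
  (rho (fconf_in D n) < +oo)%E.
Implicit Types (F phi psi w : {fset X} -> R) (A Z : {fset X}).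

Local Notation poly := (@polyc X R (@precompact_borel X)).
Local Notation corr := (corr rho).

Lemma mob_trunc_le D N phi c : (forall A, `|phi A| <= c * 2 ^+ #|` A|) -> 0 <= c ->
  forall Z, `|mob_trunc D N phi Z| <= c * 3 ^+ #|` Z|.
Proof.
move=> phic c0 Z; rewrite /mob_trunc; case: ifP => _; last first.
  by rewrite normr0 mulr_ge0// exprn_ge0.
by rewrite (le_trans (normr_mob_le (c := c) (a := 2) _)).
Qed.

(** The Moebius transform of the difference lives on more than [N] and at most [M] points and has
    the rate 3, below the 15 that [corr_square_le] allows; so the truncations are Cauchy in L^2. *)
Lemma corr_truncB D phi : precompact_borel D -> tame rho D -> cellfun D phi ->
  exists2 c : R, 0 <= c & forall N M, (N <= M)%N ->
    corr (fun A => (trunc D M phi A - trunc D N phi A) * (trunc D M phi A - trunc D N phi A))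
    <= c * tail rho D N.
Proof.
move=> pD tD cphi; have [a a0 phia] := cellfun_exp cphi.
have [l1 i1 _] := cphi; exists (a ^+ 2); first by rewrite exprn_ge0.
move=> N M NM.
have pT K : poly (trunc D K phi) by exact: poly_trunc.
have bD : borel D by case: pD.
apply: (corr_square_le rho_fin) => //.
- by apply: lspanB; exact: pT.
- move=> Z; rewrite mobB !mob_truncE//; apply: (@le_trans _ _ (a * 3 ^+ #|` Z|)).
    have h := mob_trunc_le D M phia a0 Z.
    rewrite /mob_trunc in h *; move: h; case: (restr D Z == Z); rewrite ?andbF ?andbT ?subr0//.
    case: (leqP #|` Z| N) => ZN; last by rewrite subr0.
    by rewrite (leq_trans ZN NM) subrr normr0 => _; rewrite mulr_ge0// exprn_ge0.
  by rewrite ler_wpM2l// lerXn2r ?nnegrE// ler_nat.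
- by move=> Z ZD; apply: (mob_loc (D := D)) => //; apply: (loc_op (fun a b => a - b)); exact: loc_trunc.
- move=> Z ZN; rewrite mobB !mob_truncE// /mob_trunc (ltnW ZN) (leq_trans (ltnW ZN) NM).
  by rewrite subrr.
Qed.

(** Both terms agree with [phi * psi] on configurations with at most [N] points in [D], so the
    Moebius transform of the difference vanishes on small sets. The product of truncations
    contributes a convolution of two functions of rate 3. *)
Lemma corr_truncM D phi psi : precompact_borel D -> tame rho D ->
  cellfun D phi -> cellfun D psi ->
  exists2 c : R, 0 <= c & forall N,
    corr (fun A => (trunc D N (fun A => phi A * psi A) A - trunc D N phi A * trunc D N psi A)
       * (trunc D N (fun A => phi A * psi A) A - trunc D N phi A * trunc D N psi A))
    <= c * tail rho D N.
Proof.
move=> pD tD cphi cpsi; have [a a0 phia] := cellfun_exp cphi.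
have [b b0 psib] := cellfun_exp cpsi.
have cpp := cellfunM cphi cpsi; have [c c0 ppc] := cellfun_exp cpp.
have [l1 i1 _] := cphi; have [l2 i2 _] := cpsi; have [l3 i3 _] := cpp.
exists ((c + a * b) ^+ 2); first by rewrite sqr_ge0.
move=> N; have bD : borel D by case: pD.
apply: (corr_square_le rho_fin) => //.
- apply: lspanB; first exact: poly_trunc.
  by apply: polycM; [exact: precompact_borelI|exact: poly_trunc|exact: poly_trunc].
- move=> Z; rewrite mobB mulrDl (le_trans (ler_normB _ _))// lerD//.
    rewrite mob_truncE// (le_trans (mob_trunc_le D N ppc c0 Z))//.
    by rewrite ler_wpM2l// lerXn2r ?nnegrE// ler_nat.
  rewrite (@eq_mob _ _ _ (fun A => zeta (mob_trunc D N phi) A * zeta (mob_trunc D N psi) A)); last first.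
    by move=> B _; rewrite -!truncE.
  rewrite -uconvE (le_trans (normr_uconv_le (c := a) (a := 3) (d := b) (b := 3) _ _))//.
  + by move=> B _; exact: mob_trunc_le.
  + by move=> B _; exact: mob_trunc_le.
  + by rewrite (_ : 3 + 3 + 3 * 3 = 15 :> R)//; ring.
- move=> Z ZD; apply: (mob_loc (D := D)) => //; apply: (loc_op (fun a b => a - b)); first exact: loc_trunc.
  by apply: (loc_op (fun a b => a * b)); exact: loc_trunc.
- move=> Z ZN; rewrite (@eq_mob _ _ _ (fun=> 0)) ?mob_cst0// => B BZ.
  have BN : (cnt D B <= N)%N.
    rewrite (leq_trans (cnt_le_card D B))// (leq_trans _ (ltnW ZN))//.
    exact: fsubset_leq_card.
  by rewrite !trunc_small// subrr.
Qed.

Variables (V : set ({fset X} -> R)) (E : ({fset X} -> R) -> R) (D : set X).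
Hypothesis VE : posfun V E.
Hypothesis pD : precompact_borel D.
Hypothesis tD : tame rho D.
Hypothesis VQ : forall F, poly F -> loc D F -> V F /\ E F = corr F.

(* Functions of the configuration in D are approximated in L^2 by the truncations
   trunc D N, on which E is already known. *)
Definition stepV : set ({fset X} -> R) :=
  lspan [set Phi | exists phi w, [/\ cellfun D phi, V w, loc (~` D) w &
    Phi = (fun A => phi A * w A)]].

Definition stepE F : R := limn (fun N => E (trunc D N F)).

Let VT N phi : cellfun D phi -> V (trunc D N phi).
Proof.
by move=> [l1 i1 _]; apply: (VQ _ _).1; [exact: poly_trunc|exact: loc_trunc].
Qed.

Let trunc_lspan N a phi w g : cellfun D phi -> loc (~` D) w ->
  trunc D N (fun A => a * (phi A * w A) + g A) =
  (fun A => a * (trunc D N phi A * w A) + trunc D N g A).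
Proof.
by move=> [l1 _ _] lw; apply/funext => A; rewrite truncfD truncfZ truncfM.
Qed.

Lemma stepV_trunc N F : stepV F -> V (trunc D N F).
Proof.
elim=> [|a _ g [phi [w [cphi Vw lw ->]]] _ IH].
  rewrite (_ : trunc _ _ _ = fun=> 0); first exact: (pf_cst VE).
  by apply/funext => A; rewrite truncf0.
rewrite trunc_lspan//; apply: (pf_VD VE) => //; apply: (pf_VZ VE).
by apply: (pf_VM VE) => //; exact: VT.
Qed.

Lemma pf_cvg0 (f : nat -> {fset X} -> R) w c : V w -> (forall N, V (f N)) ->
  (forall N, E (fun A => f N A * f N A) <= c * tail rho D N) ->
  E (fun A => f N A * w A) @[N --> \oo] --> (0 : R).
Proof.
move=> Vw Vf fc; have bD : borel D by case: pD.
apply: norm_cvg0; apply: (squeeze_cvgr (f := fun=> 0) (h := fun N =>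
  Num.sqrt (c * tail rho D N) * Num.sqrt (E (fun A => w A * w A)))).
- apply: nearW => N; rewrite normr_ge0 /=.
  apply: (le_trans (pf_square_le VE (Vf N) Vw)).
  by rewrite ler_wpM2r ?sqrtr_ge0// ler_wsqrtr.
- exact: cvg_cst.
- rewrite -[X in _ --> X](mul0r (Num.sqrt (E (fun A => w A * w A)))).
  apply: cvgMr_tmp; rewrite -[X in _ --> X]sqrtr0.
  apply: continuous_cvg; first exact: sqrt_continuous.
  by rewrite -[X in _ --> X](mulr0 c); apply: cvgMl_tmp; exact: tail_cvg0.
Qed.

(** Cauchy-Schwarz against the fixed [w]: by [VQ] the L^2 distance of two truncations is a value of
    [corr], which is small with [tail]. *)
Lemma cvg_cellfun phi w : cellfun D phi -> V w ->
  cvgn (fun N => E (fun A => trunc D N phi A * w A)).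
Proof.
move=> cphi Vw; have [c c0 hc] := corr_truncB pD tD cphi.
have bD : borel D by case: pD.
have [l1 i1 _] := cphi.
apply/cauchy_cvgP; apply: cauchy_exP => e e0.
set W := E (fun A => w A * w A).
have : Num.sqrt (c * tail rho D N) * Num.sqrt W @[N --> \oo] --> (0 : R).
  rewrite -[X in _ --> X](mul0r (Num.sqrt W)).
  apply: cvgMr_tmp; rewrite -[X in _ --> X]sqrtr0.
  apply: continuous_cvg; first exact: sqrt_continuous.
  by rewrite -[X in _ --> X](mulr0 c); apply: cvgMl_tmp; exact: tail_cvg0.
move=> /cvgrPdist_lt/(_ _ e0)[N0 _ hN0].
exists (E (fun A => trunc D N0 phi A * w A)); exists N0 => // M /= NM.
rewrite /ball /= distrC -(pf_B VE); do ?by apply: (pf_VM VE) => //; exact: VT.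
rewrite (_ : (fun _ => _) = (fun A => (trunc D M phi A - trunc D N0 phi A) * w A)); last first.
  by apply/funext => A; rewrite mulrBl.
have VMN : V (fun A => trunc D M phi A - trunc D N0 phi A) by apply: (pf_VB VE); exact: VT.
apply: (le_lt_trans (pf_square_le VE VMN Vw)).
have := hN0 N0 (leqnn _); rewrite /= sub0r normrN ger0_norm; last first.
  by rewrite mulr_ge0// sqrtr_ge0.
apply: le_lt_trans; rewrite ler_wpM2r ?sqrtr_ge0// ler_wsqrtr//.
have pM : poly (fun A => trunc D M phi A - trunc D N0 phi A).
  by apply: lspanB; exact: poly_trunc.
have pMM : poly (fun A => (trunc D M phi A - trunc D N0 phi A) * (trunc D M phi A - trunc D N0 phi A)).
  by apply: polycM => //; exact: precompact_borelI.
rewrite (VQ pMM _).2; first exact: hc.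
have lM : loc D (fun A => trunc D M phi A - trunc D N0 phi A).
  by apply: (loc_op (fun a b => a - b)); exact: loc_trunc.
exact: (loc_op (fun a b => a * b)).
Qed.

Lemma is_cvg_stepE F : stepV F -> cvgn (fun N => E (trunc D N F)).
Proof.
elim=> [|a _ g [phi [w [cphi Vw lw ->]]] Vg IH].
  rewrite (_ : (fun _ => _) = fun=> 0); first exact: is_cvg_cst.
  apply/funext => N /=; rewrite -[RHS](pf_0 VE); congr E.
  by apply/funext => A; exact: truncf0.
rewrite (_ : (fun _ => _) = (fun N => a * E (fun A => trunc D N phi A * w A) + E (trunc D N g))).
  apply: is_cvgD => //; apply: is_cvgMl_tmp; exact: cvg_cellfun.
apply/funext => N; rewrite trunc_lspan// (pf_D VE) ?(pf_Z VE)//.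
- by apply: (pf_VM VE) => //; exact: VT.
- by apply: (pf_VZ VE); apply: (pf_VM VE) => //; exact: VT.
- exact: stepV_trunc.
Qed.

Lemma stepE_cvg F : stepV F -> E (trunc D N F) @[N --> \oo] --> stepE F.
Proof. exact: is_cvg_stepE. Qed.

Lemma stepE_D F G : stepV F -> stepV G -> stepE (fun A => F A + G A) = stepE F + stepE G.
Proof.
move=> VF VG; apply/cvg_lim => //.
rewrite (_ : (fun _ => _) = (fun N => E (trunc D N F) + E (trunc D N G))).
  by apply: cvgD; exact: stepE_cvg.
apply/funext => N; rewrite -(pf_D VE); try exact: stepV_trunc.
by congr E; apply/funext => A; rewrite truncfD.
Qed.

Lemma stepE_Z c F : stepV F -> stepE (fun A => c * F A) = c * stepE F.
Proof.
move=> VF; apply/cvg_lim => //.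
rewrite (_ : (fun _ => _) = (fun N => c * E (trunc D N F))).
  by apply: cvgMl_tmp; exact: stepE_cvg.
apply/funext => N; rewrite -(pf_Z VE); last exact: stepV_trunc.
by congr E; apply/funext => A; rewrite truncfZ.
Qed.

Lemma stepE_loc w : V w -> loc (~` D) w -> stepV w /\ stepE w = E w.
Proof.
move=> Vw lw; split.
  apply: lspan_sub; exists (fun=> 1), w; split=> //; first exact: cellfun_cst.
  by apply/funext => A; rewrite mul1r.
apply/cvg_lim => //; apply: cvg_near_cst; apply: nearW => N.
by congr E; apply/funext => A; rewrite trunc_loc.
Qed.

Lemma stepV_M F G : stepV F -> stepV G -> stepV (fun A => F A * G A).
Proof.
apply: lspanM => _ _ [phi [w [cphi Vw lw ->]]] [psi [v [cpsi Vv lv ->]]].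
apply: lspan_sub; exists (fun A => phi A * psi A), (fun A => w A * v A); split.
- exact: cellfunM.
- exact: (pf_VM VE).
- exact: (loc_op (fun a b => a * b)).
- by apply/funext => A; rewrite mulrACA.
Qed.

(* The truncation of f * g agrees with the product of the truncations up to terms
   that vanish in L^2. *)
Lemma trunc_mul_cvg F G : stepV F -> stepV G ->
  E (trunc D N (fun A => F A * G A)) - E (fun A => trunc D N F A * trunc D N G A)
    @[N --> \oo] --> (0 : R).
Proof.
move=> VF; elim: VF G => [|a _ f [phi [w [cphi Vw lw ->]]] Vf IH] G VG.
  apply: cvg_near_cst; apply: nearW => N.
  rewrite (_ : trunc _ _ _ = (fun A => trunc D N (fun=> 0) A * trunc D N G A)) ?subrr//.
  apply/funext => A; rewrite truncf0 mul0r -[RHS](truncf0 D N A); congr trunc.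
  by apply/funext => B; rewrite mul0r.
suff h : E (trunc D N (fun A => phi A * w A * G A)) -
    E (fun A => trunc D N phi A * w A * trunc D N G A) @[N --> \oo] --> (0 : R).
  have VwG : stepV (fun A => phi A * w A * G A).
    by apply: stepV_M => //; apply: lspan_sub; exists phi, w.
  have VfG : stepV (fun A => f A * G A) by exact: stepV_M.
  rewrite (_ : (fun _ => _) = (fun N => a * (E (trunc D N (fun A => phi A * w A * G A)) -
    E (fun A => trunc D N phi A * w A * trunc D N G A)) +
    (E (trunc D N (fun A => f A * G A)) - E (fun A => trunc D N f A * trunc D N G A)))).
    rewrite -[X in _ --> X]addr0; apply: cvgD; last exact: IH.
    by rewrite -[X in _ --> X](mulr0 a); apply: cvgMl_tmp.
  apply/funext => N; rewrite trunc_lspan//.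
  have V1 : V (fun A => trunc D N phi A * w A * trunc D N G A).
    apply: (pf_VM VE); last exact: stepV_trunc.
    by apply: (pf_VM VE) => //; exact: VT.
  have V2 : V (fun A => trunc D N f A * trunc D N G A).
    by apply: (pf_VM VE); exact: stepV_trunc.
  rewrite (_ : (fun A => _ * trunc D N G A) = (fun A =>
    a * (trunc D N phi A * w A * trunc D N G A) + trunc D N f A * trunc D N G A)); last first.
    by apply/funext => A; rewrite mulrDl !mulrA.
  rewrite (pf_D VE (pf_VZ VE a V1) V2) (pf_Z VE)//.
  rewrite (_ : trunc D N _ = (fun A => a * trunc D N (fun A => phi A * w A * G A) A +
     trunc D N (fun A => f A * G A) A)); last first.
    apply/funext => A; rewrite -truncfZ -truncfD; congr trunc.
    by apply/funext => B; rewrite mulrDl !mulrA.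
  rewrite (pf_D VE (pf_VZ VE a (stepV_trunc N VwG)) (stepV_trunc N VfG)) (pf_Z VE); last exact: stepV_trunc.
  by ring.
elim: VG => [|b _ g [psi [v [cpsi Vv lv ->]]] Vg IHg].
  apply: cvg_near_cst; apply: nearW => N.
  rewrite (_ : trunc _ _ _ = (fun A => trunc D N phi A * w A * trunc D N (fun=> 0) A)) ?subrr//.
  apply/funext => A; rewrite truncf0 mulr0 -[RHS](truncf0 D N A); congr trunc.
  by apply/funext => B; rewrite mulr0.
have [c c0 hc] := corr_truncM pD tD cphi cpsi.
have [l1 i1 _] := cphi; have [l2 i2 _] := cpsi.
pose h N A := trunc D N (fun A => phi A * psi A) A - trunc D N phi A * trunc D N psi A.
have lh N : loc D (h N).
  apply: (loc_op (fun a b => a - b)).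
    by apply: loc_trunc; exact: (loc_op (fun a b => a * b)).
  by apply: (loc_op (fun a b => a * b)); exact: loc_trunc.
have cpp := cellfunM cphi cpsi; have [l3 i3 _] := cpp.
have ph N : poly (h N).
  apply: lspanB; first exact: poly_trunc.
  by apply: polycM; [exact: precompact_borelI|exact: poly_trunc|exact: poly_trunc].
have Vwv : V (fun A => w A * v A) by exact: (pf_VM VE).
have lwv : loc (~` D) (fun A => w A * v A) by exact: (loc_op (fun a b => a * b)).
have hcvg : E (fun A => h N A * (w A * v A)) @[N --> \oo] --> (0 : R).
  apply: (@pf_cvg0 _ _ c) => // N; first exact: (VQ (ph N) (lh N)).1.
  rewrite (VQ _ _).2; first exact: hc.
    by apply: polycM => //; exact: precompact_borelI.
  exact: (loc_op (fun a b => a * b)).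
have VwG : stepV (fun A => phi A * w A * (psi A * v A)).
  by apply: stepV_M; apply: lspan_sub; [exists phi, w|exists psi, v].
have VfG : stepV (fun A => phi A * w A * g A).
  by apply: stepV_M => //; apply: lspan_sub; exists phi, w.
rewrite (_ : (fun _ => _) = (fun N => b * E (fun A => h N A * (w A * v A)) +
  (E (trunc D N (fun A => phi A * w A * g A)) - E (fun A => trunc D N phi A * w A * trunc D N g A)))).
  rewrite -[X in _ --> X]addr0; apply: cvgD => //.
  by rewrite -[X in _ --> X](mulr0 b); apply: cvgMl_tmp.
apply/funext => N; rewrite trunc_lspan//.
have Vpw : V (fun A => trunc D N phi A * w A) by apply: (pf_VM VE) => //; exact: VT.
have V1 : V (fun A => trunc D N phi A * w A * (trunc D N psi A * v A)).
  by apply: (pf_VM VE) => //; apply: (pf_VM VE) => //; exact: VT.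
have V2 : V (fun A => trunc D N phi A * w A * trunc D N g A).
  by apply: (pf_VM VE) => //; exact: stepV_trunc.
rewrite (_ : (fun A => trunc D N phi A * w A * _) = (fun A =>
  b * (trunc D N phi A * w A * (trunc D N psi A * v A)) + trunc D N phi A * w A * trunc D N g A)); last first.
  by apply/funext => A; rewrite mulrDr mulrCA.
rewrite (pf_D VE (pf_VZ VE b V1) V2) (pf_Z VE)//.
have V3 : V (fun A => trunc D N (fun A => phi A * psi A) A * (w A * v A)).
  by apply: (pf_VM VE) => //; exact: VT.
rewrite (_ : trunc D N (fun A => phi A * w A * _) = (fun A =>
  b * (trunc D N (fun A => phi A * psi A) A * (w A * v A)) + trunc D N (fun A => phi A * w A * g A) A)); last first.
  apply/funext => A; have := truncfM N A l3 lwv => /= <-.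
  rewrite -truncfZ -truncfD; congr trunc.
  by apply/funext => B; rewrite mulrDr; congr (_ + _); rewrite mulrCA mulrACA.
rewrite (pf_D VE (pf_VZ VE b V3) (stepV_trunc N VfG)) (pf_Z VE)//.
rewrite (_ : (fun A => h N A * _) = (fun A => trunc D N (fun A => phi A * psi A) A * (w A * v A) -
  trunc D N phi A * w A * (trunc D N psi A * v A))); last first.
  by apply/funext => A; rewrite /h mulrBl [X in _ - X]mulrACA.
by rewrite (pf_B VE)//; ring.
Qed.

(** For squares: [E] is nonnegative on the square of a truncation, and by [trunc_mul_cvg] these
    values converge to [stepE] of the square. *)
Lemma step_posfun : posfun stepV stepE.
Proof.
split.
- by move=> c; apply: (stepE_loc (pf_cst VE c) _).1; exact: loc_cst.
- by move=> F G; exact: lspanD.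
- exact: stepV_M.
- exact: stepE_D.
- exact: stepE_Z.
- move=> F VF; have VFF := stepV_M VF VF.
  have h : E (fun A => trunc D N F A * trunc D N F A) @[N --> \oo] --> stepE (fun A => F A * F A).
    rewrite -[X in _ --> X]subr0 (_ : (fun _ => _) = (fun N => E (trunc D N (fun A => F A * F A)) -
      (E (trunc D N (fun A => F A * F A)) - E (fun A => trunc D N F A * trunc D N F A)))).
      by apply: cvgB; [exact: stepE_cvg|exact: trunc_mul_cvg].
    by apply/funext => N; rewrite opprB addrC subrK.
  rewrite -(cvg_lim _ h)//; apply: limr_ge; first exact: cvgP h.
  by apply: nearW => N; apply: (pf_sq VE); exact: stepV_trunc.
Qed.

End tower_step.

(** * Iteration over the cells *)

Section tower.
Context {R : realType} {X : topologicalType}.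
Variable rho : {measure set (fconf X) -> \bar R}.
Variable D : nat -> set X.
Implicit Types (F phi psi w : {fset X} -> R) (A Z : {fset X}).

Local Notation poly := (@polyc X R (@precompact_borel X)).
Local Notation corr := (corr rho).

Fixpoint towerV j : set ({fset X} -> R) :=
  if j is i.+1 then stepV (towerV i) (D i) else poly.

Fixpoint towerE j : ({fset X} -> R) -> R :=
  if j is i.+1 then stepE (towerE i) (D i) else corr.

Hypothesis rho_fin : forall D, precompact_borel D -> forall n,
  (rho (fconf_in D n) < +oo)%E.
Hypothesis rho_PD : positive_definite rho.
Hypothesis D_pre : forall j, precompact_borel (D j).
Hypothesis D_tame : forall j, tame rho (D j).
Hypothesis D_disj : forall i j, (i < j)%N -> D i `&` D j = set0.

Lemma corr_posfun : posfun poly corr.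
Proof.
split.
- exact: polyc_cst.
- by move=> F G; exact: lspanD.
- by move=> F G; apply: polycM; exact: precompact_borelI.
- by move=> F G; exact: corrD.
- by move=> c F; exact: corrZ.
- by move=> F; exact: corr_ge0.
Qed.

Lemma cell_loc i j F : i != j -> loc (D i) F -> loc (~` D j) F.
Proof.
move=> ij; apply: loc_subset; apply/disjoints_subset.
by case: (ltngtP i j) ij => // ij _; [exact: D_disj|rewrite setIC; exact: D_disj].
Qed.

(** The second half supplies the hypothesis [VQ] of the next step: polynomials in a cell that is not
    yet processed keep their value, because truncation in the other cells does not affect them. *)
Lemma tower_spec j : posfun (towerV j) (towerE j) /\
  forall F, poly F -> (forall i, (i < j)%N -> loc (~` D i) F) ->
    towerV j F /\ towerE j F = corr F.
Proof.
elim: j => [|j [IH1 IH2]]; first by split; [exact: corr_posfun|].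
have VQ F : poly F -> loc (D j) F -> towerV j F /\ towerE j F = corr F.
  move=> pF lF; apply: IH2 => // i ij; apply: cell_loc lF.
  by rewrite gtn_eqF.
split; first exact: (step_posfun rho_fin IH1 (D_pre j) (D_tame j) VQ).
move=> F pF lF; have [|VF EF] := IH2 _ pF.
  by move=> i ij; apply: lF; rewrite ltnS ltnW.
rewrite -EF; apply: stepE_loc => //; exact: lF.
Qed.

Lemma tower_posfun j : posfun (towerV j) (towerE j).
Proof. exact: (tower_spec j).1. Qed.

Lemma towerS j F : towerV j F -> loc (~` D j) F ->
  towerV j.+1 F /\ towerE j.+1 F = towerE j F.
Proof. exact: stepE_loc. Qed.

Lemma tower_mono j k F : (j <= k)%N -> towerV j F ->
  (forall i, (j <= i < k)%N -> loc (~` D i) F) ->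
  towerV k F /\ towerE k F = towerE j F.
Proof.
elim: k => [|k IH]; first by rewrite leqn0 => /eqP ->.
rewrite leq_eqVlt => /predU1P[->//|]; rewrite ltnS => jk VF lF.
have [|Vk Ek] := IH jk VF.
  by move=> i /andP[ji ik]; apply: lF; rewrite ji ltnS ltnW.
by rewrite -Ek; apply: towerS => //; apply: lF; rewrite jk ltnSn.
Qed.

(** The truncations of a polynomial are eventually equal to it, so the limit in each step is that of
    an eventually constant sequence. *)
Lemma tower_poly j F : poly F -> towerE j F = corr F.
Proof.
move=> pF; elim: j => // j <- /=; have [n dF] := polyc_degle pF.
apply/cvg_lim => //; apply: cvg_near_cst; near=> N.
congr towerE; apply/funext => A; apply: trunc_degle; apply: degleW dF.
by near: N; exact: nbhs_infty_ge.
Unshelve. all: by end_near. Qed.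

Lemma tower_cellfun i j phi : (i < j)%N -> cellfun (D i) phi -> towerV j phi.
Proof.
move=> ij cphi; have [l1 _ _] := cphi.
apply: (tower_mono (j := i.+1) ij _ _).1.
  apply: lspan_sub; exists phi, (fun=> 1); split=> //.
  - exact: (pf_cst (tower_posfun i)).
  - by apply/funext => A; rewrite mulr1.
move=> k /andP[ik _]; apply: cell_loc l1.
by rewrite ltn_eqF.
Qed.

(* psi - phi is the square of the cell function sqrt (psi - phi). *)
Lemma tower_markov i j phi psi : (i < j)%N -> cellfun (D i) phi -> cellfun (D i) psi ->
  (forall A, phi A <= psi A) -> towerE j phi <= towerE j psi.
Proof.
move=> ij cphi cpsi pp; apply: (pf_le (tower_posfun j)) => //;
  do ?exact: (tower_cellfun ij).
apply: (tower_cellfun ij); apply: cellfun_sqrt; exact: cellfunB.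
Qed.

End tower.

(** * Tame open covers *)

Section tame_neighbourhoods.
Context {R : realType} {X : topologicalType}.
Variable rho : {measure set (fconf X) -> \bar R}.
Implicit Types (F : {fset X} -> R) (D : set X) (A Z : {fset X}) (eta : fconf X).

Local Notation poly := (@polyc X R (@precompact_borel X)).
Local Notation corr := (corr rho).

Definition expweight (b : R) D eta : R :=
  if restr D eta == eta then b ^+ #|` eta| else 0.

Lemma expweight_series b D eta :
  \sum_(0 <= k < n) b ^+ k * \1_(fconf_in D k) eta @[n --> \oo] --> expweight b D eta.
Proof.
apply: cvg_near_cst; near=> n.
have en : (#|` eta| < n)%N by near: n; exact: nbhs_infty_gt.
rewrite (bigD1_seq #|` eta|)/= ?mem_index_iota ?iota_uniq ?en// big1 ?addr0.
  rewrite /expweight indicE; case: ifPn => De.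
    by rewrite mem_set ?mulr1//; split => //; exact/restrP.
  by rewrite memNset ?mulr0// => -[_ /restrP]; exact/negP.
move=> k ke; rewrite indicE memNset ?mulr0// => -[kE _].
by move/eqP: ke; apply; rewrite -kE.
Unshelve. all: by end_near. Qed.

(** The integrals of the partial sums over the number of points are bounded by a geometric series
    with ratio [b * p], and Fatou's lemma passes to [expweight]. *)
Lemma rintegrable_expweight b D (K p : R) : borel D -> 0 <= b -> 0 <= K -> 0 <= p -> b * p < 1 ->
  (forall k, (rho (fconf_in D k) <= (K * p ^+ k)%:E)%E) ->
  rintegrable rho (expweight b D).
Proof.
move=> bD b0 K0 p0 bp1 rk.
have i1 k : rintegrable rho (\1_(fconf_in D k) : fconf X -> R).
  apply: rintegrable_indic; first exact: measurable_fconf_in.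
  exact: le_lt_trans (rk k) (ltry _).
have iS n : rintegrable rho (fun eta => \sum_(0 <= k < n) b ^+ k * \1_(fconf_in D k) eta) /\
    rint rho (fun eta => \sum_(0 <= k < n) b ^+ k * \1_(fconf_in D k) eta) <=
    \sum_(0 <= k < n) K * (b * p) ^+ k.
  elim: n => [|n [IH1 IH2]].
    rewrite big_nil (_ : (fun _ => _) = fun=> 0); last by apply/funext => e; rewrite big_nil.
    by split; [exact: rintegrable0|rewrite rint0].
  rewrite big_nat_recr//= (_ : (fun _ => _) = (fun eta =>
    \sum_(0 <= k < n) b ^+ k * \1_(fconf_in D k) eta + b ^+ n * \1_(fconf_in D n) eta)); last first.
    by apply/funext => e; rewrite big_nat_recr.
  split; first by apply: rintegrableD => //; apply: rintegrableZ.
  rewrite rintD//; last exact: rintegrableZ.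
  rewrite lerD// rintZ// exprMn mulrCA ler_wpM2l ?exprn_ge0//.
  rewrite rint_indic; last exact: measurable_fconf_in.
  have := rk n; case: (rho _) => [r|//|] /=; first by rewrite lee_fin.
  by move=> _; rewrite mulr_ge0// exprn_ge0.
apply: (rint_fatou (F := fun n eta => \sum_(0 <= k < n) b ^+ k * \1_(fconf_in D k) eta)
  (M := K / (1 - b * p)) (fun n => (iS n).1) _ _ _).1.
- by move=> n eta; apply: sumr_ge0 => k _; rewrite mulr_ge0// exprn_ge0.
- exact: expweight_series.
- move=> n; apply: le_trans (iS n).2 _.
  have bp0 : 0 <= b * p by rewrite mulr_ge0.
  rewrite -mulr_sumr ler_wpM2l// -[leRHS]mul1r ler_pdivlMr ?subr_gt0//.
  rewrite [leLHS](_ : _ = 1 - (b * p) ^+ n); first by rewrite gerBl exprn_ge0.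
  elim: n => [|n IH]; first by rewrite big_nil mul0r expr0 subrr.
  by rewrite big_nat_recr//= mulrDl IH exprS; ring.
Qed.

Lemma weight_expweight D : weight D 0 = expweight 255 D.
Proof. by apply/funext => eta; rewrite /weight leq0n andbT. Qed.

Hypothesis rho_fin : forall D, precompact_borel D -> forall n,
  (rho (fconf_in D n) < +oo)%E.
Hypothesis rho_PD : positive_definite rho.

(* The Cauchy-Schwarz inequality for N_x and the number of k-subsets in D. *)
Lemma rho_fconf_insert (x : X) D k : precompact_borel D -> precompact_borel [set x] ->
  ~ D x -> tame rho D ->
  let S := [set eta : fconf X | #|` eta| = k.+1 /\ cnt [set x] eta = 1%N /\ cnt D eta = k] in
  measurable S /\ (rho S <= (Num.sqrt (corr (fun A => (cnt [set x] A)%:R * (cnt [set x] A)%:R))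
    * Num.sqrt (tail rho D k))%:E)%E.
Proof.
move=> pD px Dx tD S.
have bD : borel D by case: pD.
pose G Z : R := if (restr D Z == Z) && (#|` Z| == k) then 1 else 0.
have pG : poly (zeta G).
  apply: (@polyc_zeta _ _ _ _ (fun x => x \in D) D k).
  - move=> A A' AA'; rewrite /G.
    have cA := inv_card AA'.
    have cD : cnt D A = cnt D A' by apply: inv_cnt AA'.
    suff -> : (restr D A == A) = (restr D A' == A') by rewrite cA.
    apply/idP/idP => /eqP e; rewrite eqEfcard restr_sub /=.
      by rewrite -/(cnt D A') -cD -cA /cnt e.
    by rewrite -/(cnt D A) cD cA /cnt e.
  - move=> t; apply: (precompact_borel_sub _ _ pD); last exact: subIsetr.
    by apply: borelI => //; exact: borel_mem.
  - by move=> Z ZD; rewrite /G; case: ifP => // /andP[/restrP].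
  - by move=> Z kZ; rewrite /G gtn_eqF ?andbF.
have pN := @polyc_cnt X R _ _ px.
have CS := pf_square_le (corr_posfun rho_fin rho_PD) pN pG.
have sq : corr (fun A => zeta G A * zeta G A) <= tail rho D k.
  have := @corr_square_le _ _ rho rho_fin (zeta G) D k 1 pG bD tD.
  rewrite expr1n mul1r; apply.
  - move=> Z; rewrite mob_zeta /G mul1r; case: ifP => _; rewrite ?normr1 ?normr0 ?exprn_ege1 ?exprn_ge0//.
    by rewrite ler1n.
  - by move=> Z ZD; rewrite mob_zeta /G; case: ifP => // /andP[/restrP].
  - by move=> Z kZ; rewrite mob_zeta /G ltn_eqF ?andbF.
have pM : poly (fun A => (cnt [set x] A)%:R * zeta G A).
  by apply: polycM => //; exact: precompact_borelI.
have GZ Z : 0 <= G Z by rewrite /G; case: ifP.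
have mS : mob (fun A => (cnt [set x] A)%:R * zeta G A) = uconv (injc_top [:: [set x]]) G.
  apply/funext => Z; rewrite uconvE; apply: eq_mob => B _.
  by rewrite zeta_injc_top cnt_injc1.
have measS : measurable S.
  rewrite (_ : S = fconf_card X k.+1 `&` ([set eta : fconf X | cnt [set x] eta = 1%N] `&`
      [set eta : fconf X | cnt D eta = k])).
    apply: measurableI; first exact: measurable_fconf_card.
    by apply: measurableI; apply: measurable_cnt_eq => //; case: px.
  by [].
have Sle eta : \1_S eta <= mob (fun A => (cnt [set x] A)%:R * zeta G A) eta.
  have F0 Z : 0 <= injc_top [:: [set x]] Z :> R.
    by rewrite /injc_top; case: ifP => // _; exact: injc_ge0.
  rewrite mS indicE; have [/set_mem Se|_] := boolP (eta \in S); last first.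
    by apply: sumr_ge0 => A _; apply: sumr_ge0 => B _; case: ifP => // _; rewrite mulr_ge0.
  have [ek [ex eD]] := Se.
  (* In the convolution only one pair is kept, {x} and the points in [D]; on [S] its term equals
     1. *)
  apply: (le_trans _ (uconv_ge (A := restr [set x] eta) (B := restr D eta) F0 GZ _)).
    rewrite /injc_top [size _]/= -/(cnt [set x] eta) ex eqxx cnt_injc1.
    rewrite cnt_restr setIid ex mul1r /G restrI setIid eqxx -/(cnt D eta) eD eqxx.
    by rewrite /= ?mulr1n lexx.
  rewrite -restr_set_setU; apply/eqP; rewrite eqEfcard restr_sub -/(cnt _ eta) cntU.
    by rewrite /= ex eD ek add1n.
  by apply/seteqP; split=> y // [/= -> /Dx].
have iM := rintegrable_mob rho_fin pM.
have iS : rintegrable rho (\1_S : fconf X -> R).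
  apply: rintegrable_le iM; first exact: measurable_indic.
  by move=> eta; rewrite ger0_norm// Sle.
split=> //; have := rint_le iS iM Sle.
have <- : (rint rho \1_S)%:E = rho S :> \bar R by rewrite -EFin_rint// integral_indic// setIT.
move=> h; rewrite lee_fin (le_trans h)//; apply: (le_trans (ler_norm _)); apply: (le_trans CS).
by rewrite ler_wpM2l ?sqrtr_ge0// ler_wsqrtr.
Qed.

(** On configurations with n points, n at least [k], the number [q ^+ k] divided by [q ^+ n] is at
    least 1: a higher exponential moment makes the tail decay geometrically. *)
Lemma tail_le_expweight D k (q : R) : 0 < q <= 1 -> borel D ->
  rintegrable rho (expweight (255 / q) D) ->
  tail rho D k <= q ^+ k * rint rho (expweight (255 / q) D).
Proof.
move=> /andP[q0 q1] bD iw; rewrite -rintZ//; have q0' := ltW q0.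
have p0 : 0 <= 255 / q by rewrite divr_ge0.
have le0 eta : weight D k eta <= q ^+ k * expweight (255 / q) D eta.
  rewrite /weight /expweight; case: eqP => _ /=; last by rewrite mulr0.
  case: leqP => [kn|_]; last by rewrite mulr_ge0// exprn_ge0.
  rewrite exprMn mulrCA -[leLHS]mulr1 ler_wpM2l ?exprn_ge0// exprVn.
  by rewrite ler_pdivlMr ?exprn_gt0// mul1r; apply: ler_wiXn2l => //; exact: ltW.
apply: rint_le => //; last exact: rintegrableZ.
apply: (rintegrable_le (measurable_weight k bD) _ (rintegrableZ (q ^+ k) iw)).
by move=> eta; rewrite ger0_norm ?weight_ge0.
Qed.

Hypothesis rho_0 : rho (fconf_card X 0) = 1%E.

(** The bound on [c] gives [D] exponential moments up to the base 255 * 256^2, with ratio at most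
    1/2. Hence the tail of [D] decays like 256^(-2k), its square root in [rho_fconf_insert] like
    256^(-k), and this still beats the weight 255^k after [x] is added. *)
Lemma tame_setU1 (x : X) D c : precompact_borel D -> precompact_borel [set x] -> ~ D x ->
  0 <= c <= (2 * 255 * (256 * 256))^-1 ->
  (forall n, (0 < n)%N -> (rho (fconf_in D n) <= (c ^+ n)%:E)%E) ->
  tame rho (D `|` [set x]).
Proof.
move=> pD px Dx /andP[c0 cc] rc; have bD : borel D by case: pD.
have bU : borel (D `|` [set x]) by apply: borelU => //; case: px.
have rho_in0 E : borel E -> (rho (fconf_in E 0) <= 1%:E)%E.
  move=> bE; rewrite -rho_0; apply: le_measure; rewrite ?inE.
  - exact: measurable_fconf_in.
  - exact: measurable_fconf_card.
  - by move=> eta [].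
have rc' k : (rho (fconf_in D k) <= (1 * c ^+ k)%:E)%E.
  by case: k => [|k]; [rewrite mul1r expr0; exact: rho_in0|rewrite mul1r; exact: rc].
have h0 : (0 : R) < (2 * 255 * (256 * 256))^-1 by rewrite invr_gt0; lra.
have iw b : 0 <= b <= 255 * (256 * 256) -> rintegrable rho (expweight b D).
  move=> /andP[b0 bb]; apply: rintegrable_expweight rc' => //.
  have : b * c <= (255 * (256 * 256)) * (2 * 255 * (256 * 256))^-1 by apply: ler_pM.
  by move=> /le_lt_trans; apply; lra.
have tD : tame rho D by rewrite /tame weight_expweight; apply: iw; lra.
pose M := rint rho (expweight (255 * (256 * 256)) D).
have M0 : 0 <= M.
  by apply: rint_ge0 => eta; rewrite /expweight; case: ifP => // _; rewrite exprn_ge0//; lra.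
pose K := Num.sqrt (corr (fun A => (cnt [set x] A)%:R * (cnt [set x] A)%:R)) * Num.sqrt M.
have K0 : 0 <= K by rewrite mulr_ge0// sqrtr_ge0.
rewrite /tame weight_expweight.
have q0 : (0 : R) <= 256^-1 by rewrite invr_ge0.
have c256 : c <= 256^-1.
  by apply: (le_trans cc); rewrite lef_pV2 ?posrE; lra.
have q1 : 255 * 256^-1 < 1 :> R by lra.
have K1 : 0 <= 1 + 256 * K by lra.
(* In the constant, 1 covers the configurations that avoid [x] and [K] those that contain it; 256
   makes up for the exponent [k] in place of [k.+1]. *)
apply: (@rintegrable_expweight _ _ (1 + 256 * K) 256^-1) => //.
case=> [|k].
  by rewrite expr0 mulr1 (le_trans (rho_in0 _ bU))// lee_fin; lra.
have [mS Sle] := rho_fconf_insert k pD px Dx tD.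
set S := [set eta : fconf X | _] in mS Sle.
apply: (@le_trans _ _ (rho (fconf_in D k.+1 `|` S))).
  apply: le_measure; rewrite ?inE.
  - exact: measurable_fconf_in.
  - by apply: measurableU => //; exact: measurable_fconf_in.
  move=> eta [ek eU].
  have cU : (cnt D eta + cnt [set x] eta)%N = k.+1.
    rewrite -cntU; last by apply/seteqP; split=> y // [Dy /= yx]; apply: Dx; rewrite -yx.
    by rewrite /cnt restr_id.
  have cx : (cnt [set x] eta <= 1)%N.
    rewrite -(cardfs1 x) fsubset_leq_card//; apply/fsubsetP => y.
    by rewrite in_restr inE => /andP[_ /set_mem ->].
  case: (posnP (cnt [set x] eta)) => [c_eq0|c_gt0]; last first.
    have c1 : cnt [set x] eta = 1%N by apply/eqP; rewrite eqn_leq cx.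
    by right; split=> //; split=> //; move: cU; rewrite c1 addn1 => -[].
  left; split=> //; apply/restrP; rewrite eqEfcard restr_sub -/(cnt D eta).
  by move: cU; rewrite c_eq0 addn0 => ->; rewrite /= ek.
apply: (le_trans (measureU2 _ _ _)) => //; first exact: measurable_fconf_in.
apply: (le_trans (leeD (rc k.+1 isT) Sle)); rewrite -EFinD lee_fin mulrDl mul1r lerD//.
  by apply: lerXn2r; rewrite ?nnegrE.
have -> : 256 * K * 256^-1 ^+ k.+1 = K * 256^-1 ^+ k.
  by rewrite exprS [256 * K]mulrC -mulrA mulVKf// pnatr_eq0.
rewrite /K mulrAC -mulrA ler_wpM2l ?sqrtr_ge0//.
have -> : 256^-1 ^+ k = Num.sqrt (((256 * 256)^-1) ^+ k) :> R.
  rewrite (_ : (256 * 256)^-1 = 256^-1 ^+ 2 :> R); last by rewrite invfM expr2.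
  by rewrite -exprM mulnC exprM sqrtr_sqr ger0_norm// exprn_ge0// invr_ge0.
rewrite -sqrtrM; last by rewrite exprn_ge0// invr_ge0.
rewrite ler_wsqrtr//; have := @tail_le_expweight D k (256 * 256)^-1.
rewrite invrK; apply => //; last by apply: iw; lra.
by lra.
Qed.

End tame_neighbourhoods.

Section tame_covers.
Context {R : realType} {X : topologicalType}.
Variable rho : {measure set (fconf X) -> \bar R}.

(** The sets form a base, so they separate points and exhaust open sets. The properties of [X] and
    [rho] that later sections use travel with them. *)
Record tame_cover := TameCover {
  tc_set :> nat -> set X ;
  tc_open : forall i, open (tc_set i) ;
  tc_precompact : forall i, precompact (tc_set i) ;
  tc_tame : forall i, tame rho (tc_set i) ;
  tc_base : forall x U, open U -> U x -> exists2 i, tc_set i x & tc_set i `<=` U ;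
  tc_hausdorff : hausdorff_space X ;
  tc_fin : forall D, precompact_borel D -> forall n, (rho (fconf_in D n) < +oo)%E ;
  tc_pd : positive_definite rho ;
  tc_rho0 : rho (fconf_card X 0) = 1%E }.

Hypothesis X_lc : locally_compact [set: X].
Hypothesis X_sc : @second_countable X.
Hypothesis X_T2 : hausdorff_space X.
Hypothesis rho_N : rho (fconf_card X 0) = 1%E.
Hypothesis rho_PD : positive_definite rho.
Hypothesis rho_LB : local_bound rho.

Lemma local_bound_fin D : precompact_borel D -> forall n, (rho (fconf_in D n) < +oo)%E.
Proof.
move=> pD [|n].
  apply: (@le_lt_trans _ _ (rho (fconf_card X 0))); last by rewrite rho_N ltry.
  apply: le_measure; rewrite ?inE; last by move=> eta [].
    by apply: measurable_fconf_in; case: pD.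
  exact: measurable_fconf_card.
by have [C [_ + _]] := rho_LB => /(_ _ pD n.+1 isT)/le_lt_trans; apply; rewrite ltry.
Qed.

Lemma closed_point (x : X) : closed [set x].
Proof. by apply: accessible_closed_set1; exact: hausdorff_accessible. Qed.

Lemma second_countable_seq : exists e : nat -> set X,
  (forall n, open (e n)) /\ forall x U, open U -> U x -> exists2 n, e n x & e n `<=` U.
Proof.
have [B /countable_injP[f finj] [Bo Bb]] := X_sc.
(* The base is numbered by its injection into the naturals; numbers that are not attained get the
   empty set. *)
exists (fun n => if pselect (exists U, B U /\ f U = n) is left e then projT1 (cid e) else set0).
split=> [n|x U oU Ux].
  case: pselect => [e|_]; last exact: open0.
  by case: (cid e) => /= U [BU _]; exact: Bo.
have /(Bb x)[V [BV Vx] VU] : nbhs x U by apply: open_nbhs_nbhs.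
exists (f V); case: pselect => [e|]; try by case; exists V.
  by case: (cid e) => /= W [BW /finj] ->//; rewrite inE.
case: (cid e) => /= W [BW /finj] ->//; rewrite inE//.
Qed.

(** Intersecting the base sets that contain [x] gives neighbourhoods [U n] that shrink to {x}, since
    the space is Hausdorff. The punctured sets [D n] decrease to the empty set, so (LB) makes their
    constants small, and [tame_setU1] puts [x] back. *)
Lemma tame_nbhs (x : X) : exists U, [/\ open U, U x, precompact U & tame rho U].
Proof.
have [e [eo eb]] := second_countable_seq.
have [W [Wo Wx pW]] : exists W, [/\ open W, W x & precompact W].
  have := X_lc (I : [set: X] x); rewrite withinET => -[K xK pK].
  move: xK; rewrite nbhsE => -[W [Wo Wx] WK]; exists W; split=> //.
  by exists K => //; exact: WK.
pose V k := if x \in e k then e k else setT.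
pose U := fix U n := if n is k.+1 then U k `&` V k else W.
have Vx k : open (V k) /\ V k x.
  by rewrite /V; case: ifPn => [/set_mem ex|_]; split=> //; exact: openT.
have Uo n : open (U n) by elim: n => // n IH; apply: openI => //; case: (Vx n).
have Ux n : U n x by elim: n => // n IH; split=> //; case: (Vx n).
have UW n : U n `<=` W by elim: n => // n IH y [/IH].
have Up n : precompact (U n) by exact: precompact_subset (UW n) pW.
pose D n := U n `\ x.
have px : precompact_borel [set x].
  split; last by rewrite precompact_closed; [exact: compact_set1|exact: closed_point].
  by rewrite -[[set x]]setCK; apply: borelC; apply: open_borel; rewrite openC; exact: closed_point.
have pD n : precompact_borel (D n).
  split; last by apply: precompact_subset (Up n) => y [].
  by apply: borelD; [exact: open_borel|case: px].
have [C [C0 Cn Cto0]] := rho_LB.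
have : C (D n) @[n --> \oo] --> (0 : R).
  apply: Cto0 => //.
    by move=> n y [[Uy _] yx].
  rewrite -subset0 => y Dy; have [_ /eqP yx] := Dy 0%N I.
  have := X_T2; rewrite open_hausdorff => /(_ _ _ yx)[[A B] /= [/set_mem Ay /set_mem Bx] [oA oB /eqP AB]].
  have [n enx enB] := eb _ _ oB Bx.
  have [[_ +] _] := Dy n.+1 I; rewrite /V mem_set// => /enB By.
  by have : (A `&` B) y by []; rewrite AB.
move=> /cvgrPdist_lt /(_ ((2 * 255 * (256 * 256))^-1)).
have q0 : (0 : R) < (2 * 255 * (256 * 256))^-1 by rewrite invr_gt0; lra.
move=> /(_ q0)[n _ /(_ n (leqnn n))] /=; rewrite sub0r normrN ger0_norm ?C0// => Cq.
exists (U n); split=> //.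
have -> : U n = D n `|` [set x].
  by rewrite /D setDKU// => _ ->.
apply: (@tame_setU1 _ _ rho local_bound_fin rho_PD rho_N x (D n) (C (D n))) => //.
- by move=> [_]; apply.
- by rewrite C0//= ltW.
- by move=> k k0; exact: Cn.
Qed.

Lemma tame_set0 : tame rho (@set0 X).
Proof.
rewrite /tame weight_expweight.
have p1 : 255 * 0 < 1 :> R by rewrite mulr0.
apply: (@rintegrable_expweight _ _ rho 255 set0 1 0 borel0) => //.
case=> [|k].
  rewrite expr0 mulr1 -rho_N; apply: le_measure; rewrite ?inE; last by move=> eta [].
    by apply: measurable_fconf_in; exact: borel0.
  exact: measurable_fconf_card.
rewrite (_ : fconf_in _ _ = set0) ?measure0 ?lee_fin ?mul1r ?exprn_ge0//.
rewrite -subset0 => eta [ek e0]; have [x xe] : exists x, x \in (eta : {fset X}).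
  by apply/fset0Pn; rewrite -cardfs_eq0 ek.
by have := e0 _ xe.
Qed.

(** Base sets that are not both precompact and tame are replaced by the empty set. The rest is still
    a base, because every point has a tame neighbourhood and tameness passes to smaller open
    sets. *)
Lemma exists_tame_cover : exists _ : tame_cover, True.
Proof.
have [e [eo eb]] := second_countable_seq.
pose O n := if pselect (precompact (e n) /\ tame rho (e n)) is left _ then e n else set0.
have t0 : tame rho (@set0 X) by exact: tame_set0.
have Oo i : open (O i) by rewrite /O; case: pselect => // _; exact: open0.
have Op i : precompact (O i).
  by rewrite /O; case: pselect => [[]//|_]; have [] := @precompact_borel0 X.
have Ot i : tame rho (O i) by rewrite /O; case: pselect => [[]//|_].
have Ob x U : open U -> U x -> exists2 i, O i x & O i `<=` U.
  move=> oU Ux; have [V [oV Vx pV tV]] := tame_nbhs x.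
  have [i ix iUV] := eb _ _ (openI oU oV) (conj Ux Vx).
  have iV : e i `<=` V by move=> y /iUV[].
  have h : precompact (e i) /\ tame rho (e i).
    by split; [exact: precompact_subset pV|apply: tame_sub tV => //; exact: open_borel].
  by exists i; rewrite /O; case: pselect => // _ y /iUV[].
by exists (TameCover Oo Op Ot Ob X_T2 local_bound_fin rho_PD rho_N).
Qed.

End tame_covers.

(** * Cylinder sets *)

Section configurations.
Context {X : topologicalType}.
Implicit Types (g : conf X) (D : set X) (eta : fconf X).

Lemma locally_finite_fset (eta : {fset X}) : [set` eta] \in @locally_finite X.
Proof. by apply/mem_set => D _; apply: finite_setIl; exact: finite_fset. Qed.

Definition conf_of eta : conf X := exist _ [set` (eta : {fset X})] (locally_finite_fset eta).

Definition cut D g : fconf X := fset_set (val g `&` D).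

(** Local finiteness is stated for Borel sets, whence the passage to the closure. *)
Lemma finite_cut D g : precompact D -> finite_set (val g `&` D).
Proof.
move=> pD; have /set_mem lg := valP g.
apply: (@sub_finite_set _ _ (val g `&` closure D)).
  by apply: setIS; exact: subset_closure.
apply: lg; split; last by rewrite precompactE -(closure_id _).1 -?precompactE//; exact: closed_closure.
by rewrite -[closure D]setCK; apply: borelC; apply: open_borel; rewrite openC; exact: closed_closure.
Qed.

Lemma in_cut D g x : precompact D -> (x \in (cut D g : {fset X})) = (x \in val g) && (x \in D).
Proof. by move=> pD; rewrite in_fset_set ?in_setI//; exact: finite_cut. Qed.

Lemma in_conf_of eta x : (x \in val (conf_of eta)) = (x \in (eta : {fset X})).
Proof. by apply/idP/idP => [/set_mem//|xe]; exact/mem_set. Qed.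

Lemma restr_cut D D' g : precompact D' -> restr D (cut D' g) = cut (D `&` D') g.
Proof.
move=> pD; apply/fsetP => x; rewrite in_restr !in_cut//.
  by rewrite in_setI -andbA [X in _ && X]andbC.
by apply: precompact_subset pD.
Qed.

Lemma cut_conf_of D eta : precompact D -> cut D (conf_of eta) = restr D eta.
Proof.
by move=> pD; apply/fsetP => x; rewrite in_cut// in_restr in_conf_of.
Qed.

Lemma conf_countE D g : conf_count D g = #|` cut D g|. Proof. by []. Qed.

Lemma cnt_cut D D' g : precompact D' -> cnt D (cut D' g) = conf_count (D `&` D') g.
Proof. by move=> pD; rewrite /cnt restr_cut. Qed.

Lemma conf_count0 g : conf_count set0 g = 0%N.
Proof. by rewrite conf_countE /cut setI0 fset_set0 cardfs0. Qed.

End configurations.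

Section cover_cells.
Context {R : realType} {X : topologicalType} {rho : {measure set (fconf X) -> \bar R}}.
Variable O : tame_cover rho.
Implicit Types (g : conf X) (D : set X) (eta : fconf X) (F : {fset X} -> R).

Definition lam m : set X := [set x | exists2 i, (i < m)%N & O i x].

Definition cellD j : set X := O j `\` lam j.

Lemma lamS m : lam m.+1 = lam m `|` O m.
Proof.
apply/seteqP; split=> x.
  case=> i; rewrite ltnS leq_eqVlt => /predU1P[->|im] Ox; first by right.
  by left; exists i.
by case=> [[i im Ox]|Ox]; [exists i => //; exact: ltnW|exists m].
Qed.

Lemma lam0 : lam 0 = set0.
Proof. by rewrite -subset0 => x [i]. Qed.

Lemma lam_mono m n : (m <= n)%N -> lam m `<=` lam n.
Proof. by move=> mn x [i im Ox]; exists i => //; exact: leq_trans mn. Qed.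

Lemma O_borel i : precompact_borel (O i).
Proof. by split; [apply: open_borel; exact: tc_open|exact: tc_precompact]. Qed.

Lemma lam_borel m : precompact_borel (lam m).
Proof.
elim: m => [|m IH]; first by rewrite lam0; exact: precompact_borel0.
by rewrite lamS; apply: precompact_borelU => //; exact: O_borel.
Qed.

Lemma cellD_pre j : precompact_borel (cellD j).
Proof.
apply: (precompact_borel_sub _ _ (O_borel j)); last exact: subDsetl.
by apply: borelD; [case: (O_borel j)|case: (lam_borel j)].
Qed.

Lemma cellD_tame j : tame rho (cellD j).
Proof.
apply: tame_sub (tc_tame O j); last exact: subDsetl.
by case: (cellD_pre j).
Qed.

Lemma cellD_sub i m : (i < m)%N -> cellD i `<=` lam m.
Proof. by move=> im x [Ox _]; exists i. Qed.

Lemma cellD_disj i j : (i < j)%N -> cellD i `&` cellD j = set0.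
Proof. by move=> ij; rewrite -subset0 => x [/(cellD_sub ij) xj [_]]. Qed.

Lemma lam_cellD_disj m j : (m <= j)%N -> lam m `&` cellD j = set0.
Proof. by move=> mj; rewrite -subset0 => x [/(lam_mono mj) xj [_]]. Qed.

Lemma lamSD m : lam m.+1 = lam m `|` cellD m.
Proof.
rewrite lamS; apply/seteqP; split=> x [xm|Ox]; try by left.
  by have [xl|xl] := pselect (lam m x); [left|right].
by right; case: Ox.
Qed.

Lemma precompact_sub_lam K : precompact K -> exists m, K `<=` lam m.
Proof.
rewrite precompactE => /compact_near_coveringP/(_ nat \oo lam)[].
  move=> x _; have [i Ox _] := tc_base O openT (I : [set: X] x).
  exists (O i, [set m | (i < m)%N]).
    by split; [apply: open_nbhs_nbhs; split=> //; exact: tc_open|exact: nbhs_infty_gt].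
  by move=> [y m] /= [Oy im]; exists i.
move=> m _ h; exists m => x /subset_closure Kx; exact: (h m (leqnn m)).
Qed.

Lemma tower_O_posfun m : posfun (towerV cellD m : set ({fset X} -> R)) (towerE rho cellD m).
Proof.
apply: tower_posfun; [exact: (tc_fin O)|exact: (tc_pd O)|exact: cellD_pre|exact: cellD_tame|].
exact: cellD_disj.
Qed.

(** Patterns of length [M] cut the space into finitely many Borel classes, which get finer with [M]
    and together separate points ([pat_eq]). *)
Definition pat M (x : X) : {ffun 'I_M -> bool} := [ffun i : 'I_M => x \in O i].

Lemma patP M x y : pat M x = pat M y <-> forall i, (i < M)%N -> (x \in O i) = (y \in O i).
Proof.
split=> [/ffunP h i iM|h]; last by apply/ffunP => i; rewrite !ffunE h.
by have := h (Ordinal iM); rewrite !ffunE.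
Qed.

Lemma pat_refine M M' x y : (M <= M')%N -> pat M' x = pat M' y -> pat M x = pat M y.
Proof. by move=> MM' /patP h; apply/patP => i iM; apply: h; exact: leq_trans MM'. Qed.

Lemma pat_borel M t : borel [set x | pat M x = t].
Proof.
elim: M t => [|M IH] t.
  rewrite (_ : [set _ | _] = setT); first exact: borelT.
  by apply/seteqP; split=> // x _ /=; apply/ffunP => -[].
pose t' : {ffun 'I_M -> bool} := [ffun i => t (widen_ord (leqnSn M) i)].
rewrite (_ : [set _ | _] = [set x | pat M x = t'] `&` [set x | (x \in O M) = t ord_max]).
  apply: borelI; first exact: IH.
  by apply: borel_mem; exact: (O_borel M).1.
apply/seteqP; split=> x /=.
  move=> xt; split; last by rewrite -xt ffunE.
  by apply/ffunP => i; rewrite -[LHS]/(pat M x i) /t' !ffunE -xt ffunE.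
move=> [xt xM]; apply/ffunP => i; rewrite ffunE.
have [iM|] := ltnP i M.
  have := congr1 (fun f : {ffun 'I_M -> bool} => f (Ordinal iM)) xt; rewrite !ffunE => ->.
  by congr (t _); exact: val_inj.
move=> Mi; have -> : i = ord_max by apply/val_inj/eqP; rewrite eqn_leq Mi -ltnS ltn_ord.
exact: xM.
Qed.

Lemma pat_lam M m x y : (m <= M)%N -> pat M x = pat M y -> (x \in lam m) = (y \in lam m).
Proof.
move=> mM /patP h; apply/idP/idP => /set_mem[i im Ox]; apply/mem_set; exists i => //.
  by apply/set_mem; rewrite -h ?mem_set//; exact: leq_trans mM.
by apply/set_mem; rewrite h ?mem_set//; exact: leq_trans mM.
Qed.

Lemma pat_cellD M j x y : (j < M)%N -> pat M x = pat M y -> (x \in cellD j) = (y \in cellD j).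
Proof.
move=> jM xy; rewrite !in_setD (pat_lam (ltnW jM) xy).
by congr (_ && _); move/patP: xy; apply.
Qed.

Lemma measinv_pat M F : invar (pat M) F -> measinv F.
Proof. by move=> iF; exists {ffun 'I_M -> bool}, (pat M); split=> //; exact: pat_borel. Qed.

End cover_cells.

Section positive_functional_bounds.
Context {R : realType} {T : Type}.
Variables (V : set (T -> R)) (E : (T -> R) -> R).
Hypothesis VE : posfun V E.

(** The union bound for indicators. With [p] the product over the tail of the list, the step needs
    [E (a * p) <= E a], which holds because [a - a * p] is idempotent and hence a square. *)
Lemma pf_union (I : Type) (r : seq I) (a : I -> T -> R) :
  (forall i, V (a i)) -> (forall i x, a i x * a i x = a i x) ->
  [/\ V (fun x => \prod_(i <- r) (1 - a i x)),
    forall x, \prod_(i <- r) (1 - a i x) * \prod_(i <- r) (1 - a i x) = \prod_(i <- r) (1 - a i x) &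
    E (fun=> 1) - E (fun x => \prod_(i <- r) (1 - a i x)) <= \sum_(i <- r) E (a i)].
Proof.
move=> Va aa; elim: r => [|i r [Vr rr IH]].
  rewrite (_ : (fun _ => \prod_(i <- [::]) _) = fun=> 1); last by apply/funext => x; rewrite big_nil.
  by rewrite big_nil subrr; split=> // [|x]; [exact: (pf_cst VE)|rewrite big_nil mulr1].
have V1 : V (fun x => 1 - a i x) by apply: (pf_VB VE) => //; exact: (pf_cst VE).
have -> : (fun x => \prod_(j <- i :: r) (1 - a j x)) =
    (fun x => (1 - a i x) * \prod_(j <- r) (1 - a j x)).
  by apply/funext => x; rewrite big_cons.
split; first exact: (pf_VM VE).
  move=> x; rewrite big_cons mulrACA rr; congr (_ * _).
  by rewrite mulrBl mul1r mulrBr mulr1 aa subrr subr0.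
set p := fun x => \prod_(j <- r) (1 - a j x) in Vr rr IH *.
have Vap : V (fun x => a i x * p x) by exact: (pf_VM VE).
rewrite big_cons (_ : (fun x => _ * _) = (fun x => p x - a i x * p x)); last first.
  by apply/funext => x; rewrite mulrBl mul1r.
rewrite (pf_B VE)// opprB addrCA lerD//.
suff : 0 <= E (fun x => a i x - a i x * p x) by rewrite (pf_B VE)// subr_ge0.
rewrite (_ : (fun _ => _) = (fun x => (a i x - a i x * p x) * (a i x - a i x * p x))).
  by apply: (pf_sq VE); exact: (pf_VB VE).
apply/funext => x; have h : a i x * (a i x * p x) = a i x * p x by rewrite mulrA aa.
by rewrite mulrBl !mulrBr aa h [a i x * p x * a i x]mulrC h mulrACA aa rr subrr subr0.
Qed.

End positive_functional_bounds.

Section cylinders.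
Context {R : realType} {X : topologicalType} {rho : {measure set (fconf X) -> \bar R}}.
Variable O : tame_cover rho.
Implicit Types (g : conf X) (E : set (conf X)) (A : {fset X}) (F : {fset X} -> R).

Local Notation V := (towerV (cellD O) : nat -> set ({fset X} -> R)).
Local Notation Ex := (towerE rho (cellD O)).

Definition ind E A : R := (conf_of A \in E)%:R.

Lemma indM E A : ind E A * ind E A = ind E A.
Proof. by rewrite /ind; case: (_ \in _); rewrite ?mulr1 ?mulr0. Qed.

(* Cylinder sets are determined by the numbers of points in the finitely many cells
   of pat O M inside lam O m. *)
Record cyl m M E : Prop := Cyl {
  cyl_le : (m <= M)%N ;
  cyl_cut : forall g, (g \in E) = (conf_of (cut (lam O m) g) \in E) ;
  cyl_inv : invar (pat O M) (ind E) ;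
  cyl_V : V m (ind E) }.

Lemma pre_lam m : precompact (lam O m). Proof. by case: (lam_borel O m). Qed.

Lemma cyl_loc m M E : cyl m M E -> loc (lam O m) (ind E).
Proof.
by move=> [_ cE _ _] A; rewrite /ind cE cut_conf_of//; exact: pre_lam.
Qed.

Lemma cut_conf_cut m m' g : (m <= m')%N ->
  cut (lam O m) (conf_of (cut (lam O m') g)) = cut (lam O m) g.
Proof.
move=> mm'; rewrite cut_conf_of ?restr_cut; try exact: pre_lam.
by congr cut; apply/setIidPl; exact: lam_mono.
Qed.

Lemma inv_refine_pat M M' F : (M <= M')%N -> invar (pat O M) F -> invar (pat O M') F.
Proof. by move=> MM'; apply: inv_refine => x y; exact: pat_refine. Qed.

Lemma tower_lam m m' F : (m <= m')%N -> loc (lam O m) F -> V m F -> V m' F /\ Ex m' F = Ex m F.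
Proof.
move=> mm' lF VF; apply: tower_mono => // i /andP[mi _]; apply: loc_subset lF.
by apply/disjoints_subset; exact: lam_cellD_disj.
Qed.

Lemma cyl_mono m m' M M' E : (m <= m')%N -> (M <= M')%N -> (m' <= M')%N ->
  cyl m M E -> cyl m' M' E.
Proof.
move=> mm' MM' m'M' cE; have lE := cyl_loc cE; case: (cE) => mM cutE iE VE; split=> //.
- by move=> g; rewrite cutE [RHS]cutE cut_conf_cut.
- exact: inv_refine_pat iE.
- exact: (tower_lam mm' lE VE).1.
Qed.

Lemma cyl0 : cyl 0 0 set0.
Proof.
have e : ind set0 = fun=> 0 by apply/funext => A; rewrite /ind in_set0.
by split; rewrite ?e//; exact: polyc_cst.
Qed.

Lemma cylC m M E : cyl m M E -> cyl m M (~` E).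
Proof.
move=> [mM cE iE VE]; have indC : ind (~` E) = (fun A => 1 - ind E A).
  by apply/funext => A; rewrite /ind in_setC; case: (_ \in _); rewrite ?subrr ?subr0.
split=> //; first by move=> g; rewrite !in_setC cE.
  by rewrite indC => A A' /iE ->.
rewrite indC; apply: (pf_VB (tower_O_posfun O m)) => //.
exact: (pf_cst (tower_O_posfun O m)).
Qed.

Lemma cylI m M E E' : cyl m M E -> cyl m M E' -> cyl m M (E `&` E').
Proof.
move=> [mM cE iE VE] [_ cE' iE' VE'].
have indI : ind (E `&` E') = (fun A => ind E A * ind E' A).
  by apply/funext => A; rewrite /ind in_setI -mulnb natrM.
split=> //; first by move=> g; rewrite !in_setI cE cE'.
  by rewrite indI => A A' e; rewrite (iE _ _ e) (iE' _ _ e).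
by rewrite indI; exact: (pf_VM (tower_O_posfun O m)).
Qed.

Definition cylinder : set (set (conf X)) := [set E | exists m M, cyl m M E].

Lemma cylinder_join E E' : cylinder E -> cylinder E' -> exists m M, cyl m M E /\ cyl m M E'.
Proof.
move=> [m [M cE]] [m' [M' cE']]; exists (maxn m m'), (maxn M M').
have h : (maxn m m' <= maxn M M')%N by move: (cyl_le cE) (cyl_le cE'); lia.
by split; [apply: cyl_mono cE|apply: cyl_mono cE'] => //; lia.
Qed.

Lemma cylinder0 : cylinder set0.
Proof. by exists 0%N, 0%N; exact: cyl0. Qed.

Lemma cylinderC : setC_closed cylinder.
Proof. by move=> E [m [M cE]]; exists m, M; exact: cylC. Qed.

Lemma cylinderI : setI_closed cylinder.
Proof.
by move=> E E' cE cE'; have [m [M [h h']]] := cylinder_join cE cE'; exists m, M; exact: cylI.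
Qed.

Lemma cylinderU : setU_closed cylinder.
Proof.
move=> E E' cE cE'; rewrite -[E `|` E']setCK setCU; apply: cylinderC; apply: cylinderI;
  exact: cylinderC.
Qed.

(** A limit over the levels avoids choosing one for [E]: for a cylinder of level [m] the sequence is
    constant from [m] on ([cyl_contentE]). *)
Definition cyl_content E : R := limn (fun m => Ex m (ind E)).

Lemma cyl_contentE m M E : cyl m M E -> cyl_content E = Ex m (ind E).
Proof.
move=> cE; apply/cvg_lim => //; apply: cvg_near_cst; near=> m'.
apply: (tower_lam _ (cyl_loc cE) (cyl_V cE)).2.
by near: m'; exact: nbhs_infty_ge.
Unshelve. all: by end_near. Qed.

Lemma cyl_content_ge0 E : cylinder E -> 0 <= cyl_content E.
Proof.
move=> [m [M cE]]; rewrite (cyl_contentE cE) (_ : ind E = (fun A => ind E A * ind E A)).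
  by apply: (pf_sq (tower_O_posfun O m)); case: cE.
by apply/funext => A; rewrite indM.
Qed.

Lemma cyl_content_add E E' : cylinder E -> cylinder E' -> E `&` E' = set0 ->
  cyl_content (E `|` E') = cyl_content E + cyl_content E'.
Proof.
move=> cE cE' EE'; have [m [M [h h']]] := cylinder_join cE cE'.
have hU : cyl m M (E `|` E').
  by rewrite -[E `|` E']setCK setCU; apply: cylC; apply: cylI; exact: cylC.
rewrite (cyl_contentE h) (cyl_contentE h') (cyl_contentE hU).
rewrite -(pf_D (tower_O_posfun O m)); [|by case: h|by case: h'].
congr (Ex m); apply/funext => A; rewrite /ind in_setU.
have : conf_of A \notin E `&` E' by rewrite EE' in_set0.
by rewrite in_setI; case: (_ \in E); case: (_ \in E') => //; rewrite ?addr0 ?add0r.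
Qed.

(** The Moebius transform of 1 is the indicator of the empty configuration, so this is (N). *)
Lemma corr1 : corr rho (fun=> 1) = 1.
Proof.
rewrite /corr (_ : mob _ = \1_(fconf_card X 0)).
  by rewrite rint_indic ?(tc_rho0 O)//; exact: measurable_fconf_card.
apply/funext => A; rewrite (_ : (fun=> 1) = injc [::]) ?mob_injc//.
by rewrite /injc_top indicE; case: eqP => h; [rewrite mem_set|rewrite memNset].
Qed.

End cylinders.

(** * Compactness *)

Section configuration_limits.
Context {R : realType} {X : topologicalType} {rho : {measure set (fconf X) -> \bar R}}.
Variable O : tame_cover rho.
Implicit Types (x y z : X).

Lemma pat_eq x y : (forall M, pat O M x = pat O M y) -> x = y.
Proof.
move=> xy; apply: (tc_hausdorff O) => A B /nbhs_interior Ax By.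
have [i Ox OA] := tc_base O (@open_interior _ A) (nbhs_singleton Ax).
exists y; split; last exact: nbhs_singleton.
apply: (@interior_subset _ A); apply: OA.
by apply/set_mem; rewrite -((patP O i.+1 x y).1 (xy _) i)// mem_set.
Qed.

Lemma lam_cell m x : lam O m x -> exists2 i, (i < m)%N & cellD O i x.
Proof.
elim: m => [|m IH]; first by rewrite lam0.
rewrite lamSD => -[/IH[i im xi]|]; first by exists i => //; exact: ltnW.
by exists m.
Qed.

Variables (U : set_system nat) (S : nat -> set X).
Context {UU : UltraFilter U}.

(** No merging: within one cell, a fixed number of cover sets tells the points of [S j] apart for
    almost all [j]. *)
Hypothesis S_separated : forall i, exists M, \forall j \near U,
  forall x y, S j x -> S j y -> cellD O i x -> cellD O i y -> pat O M x = pat O M y -> x = y.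

(** No loss to the boundary: a point of [S j] in [O k] lies in one of finitely many cover sets whose
    closure is still in [O k], so membership in [O k] survives a limit. *)
Hypothesis S_interior : forall i k, exists J, \forall j \near U,
  forall x, S j x -> cellD O i x -> O k x ->
    exists l, [/\ (l < J)%N, closure (O l) `<=` O k & O l x].

(* The limit along U of the configurations S j. *)
Definition limset : set X :=
  [set x | forall M, \forall j \near U, exists2 y, S j y & pat O M y = pat O M x].

Definition separating m M := (m <= M)%N /\ forall i, (i < m)%N -> \forall j \near U,
  forall x y, S j x -> S j y -> cellD O i x -> cellD O i y -> pat O M x = pat O M y -> x = y.

Lemma exists_separating m M : exists2 M', (M <= M')%N & separating m M'.
Proof.
have [f fP] := choice S_separated.
exists (maxn (maxn m M) (\max_(i < m) f i)); first lia.
split=> [|i im]; first lia.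
apply: filterS (fP i) => j h x y Sx Sy xi yi /(@pat_refine _ _ _ O (f i)) xy.
apply: h => //; apply: xy; rewrite leq_max; apply/orP; right.
exact: (leq_bigmax (Ordinal im)).
Qed.

Lemma near_ultra (P : nat -> Prop) : ~ (\forall j \near U, P j) -> \forall j \near U, ~ P j.
Proof.
by move=> nP; have [//|] := in_ultra_setVsetC [set j | P j] UU.
Qed.

Lemma near_or n (P : nat -> nat -> Prop) :
  (\forall j \near U, exists2 l, (l < n)%N & P l j) ->
  exists2 l, (l < n)%N & \forall j \near U, P l j.
Proof.
move=> h; apply: contrapT => nP.
have h' : \forall j \near U, forall l : 'I_n, ~ P l j.
  apply: filter_forall => l; apply: near_ultra => Pl; apply: nP.
  by exists l.
have [j []] := @filter_ex _ U _ _ (filterI h h').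
by move=> [l ln Pl] /(_ (Ordinal ln)).
Qed.

(* The unique points of the S j with pattern t lie in a precompact set; a cluster
   point x of them has the pattern t, because S_interior keeps the S j away from the
   boundary of O k. *)
Lemma limset_cell m M (t : {ffun 'I_M -> bool}) : separating m M ->
  (\forall j \near U, exists2 y, S j y /\ lam O m y & pat O M y = t) ->
  exists x, [/\ limset x, lam O m x, pat O M x = t &
    forall z, limset z -> lam O m z -> pat O M z = t -> z = x].
Proof.
move=> [mM sep] ht.
have [j0 [y0 [Sy0 ly0] y0t]] := @filter_ex _ U _ _ ht.
have [i im y0i] := lam_cell ly0.
have cellt z : pat O M z = t -> cellD O i z.
  move=> zt; apply/set_mem; rewrite (pat_cellD (M := M) (y := y0)) ?zt ?mem_set//.
  exact: leq_trans mM.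
have lamt z : pat O M z = t -> lam O m z by move=> /cellt; exact: cellD_sub.
have [y yP] : exists y : nat -> X, \forall j \near U, S j (y j) /\ pat O M (y j) = t.
  have : forall j, exists z, (exists2 z, S j z /\ lam O m z & pat O M z = t) ->
      S j z /\ pat O M z = t.
    move=> j; have [[z [Sz _] zt]|n] := pselect (exists2 z, S j z /\ lam O m z & pat O M z = t).
      by exists z.
    by exists y0.
  move=> /choice[y yP]; exists y; apply: filterS ht => j; exact: yP.
have FF : ProperFilter (y @ U) by exact: fmap_proper_filter.
have [x [_ clx]] : closure (O i) `&` cluster (y @ U) !=set0.
  have := tc_precompact O i; rewrite precompactE; apply => //.
  apply: filterS yP => j [_ /cellt[Oy _]]; exact: subset_closure.
have xO k : (x \in O k) -> \forall j \near U, O k (y j).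
  move=> /set_mem xk; apply: contrapT => /near_ultra nk.
  have [z []] := clx [set z | ~ O k z] (O k) nk (open_nbhs_nbhs (conj (tc_open O k) xk)).
  by [].
(* By the ultrafilter property a single [O l] contains almost all [y j]; then [x] is in its closure
   and thus in [O k]. *)
have Ox k : (\forall j \near U, O k (y j)) -> x \in O k.
  move=> hk; have [J hJ] := S_interior i k.
  have : \forall j \near U, exists2 l, (l < J)%N & closure (O l) `<=` O k /\ O l (y j).
    near=> j.
    have [Syj yjt] : S j (y j) /\ pat O M (y j) = t by near: j.
    have Okj : O k (y j) by near: j.
    have hj : forall x, S j x -> cellD O i x -> O k x ->
      exists l, [/\ (l < J)%N, closure (O l) `<=` O k & O l x] by near: j.
    by have [l [lJ clO Ol]] := hj _ Syj (cellt _ yjt) Okj; exists l.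
  move=> /near_or[l lJ hl]; apply/mem_set.
  have [j [clO _]] := @filter_ex _ U _ _ hl; apply: clO.
  move=> B Bx; have [|z [Olz Bz]] := clx (O l) B _ Bx; last by exists z.
  by apply: filterS hl => j' [].
have patx M' : \forall j \near U, pat O M' (y j) = pat O M' x.
  suff : \forall j \near U, forall k : 'I_M', pat O M' (y j) k = pat O M' x k.
    by apply: filterS => j h; apply/ffunP.
  apply: filter_forall => k; case xk: (x \in O k).
    by apply: filterS (xO _ xk) => j Oy; rewrite !ffunE xk mem_set.
  have : \forall j \near U, ~ O k (y j).
    by apply: near_ultra => /Ox; rewrite xk.
  by apply: filterS => j Oy; rewrite !ffunE xk memNset.
have xt : pat O M x = t.
  have [j [<- [_ //]]] := @filter_ex _ U _ _ (filterI (patx M) yP).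
exists x; split=> //; [|exact: lamt|].
  move=> M'; near=> j; exists (y j); last by near: j; exact: patx.
  have [//] : S j (y j) /\ pat O M (y j) = t by near: j.
(* Points of [S j] that share the patterns of [z] must be the [y j], by separation; so [z] and [x]
   have the same patterns of every length. *)
move=> z zlim _ zt; apply: pat_eq => M'.
have := zlim (maxn M M') => hz.
have [j [[[w Sw wz] [Sy yt]] [hs yx]]] := @filter_ex _ U _ _
  (filterI (filterI hz yP) (filterI (sep i im) (patx M'))).
have wt : pat O M w = t by rewrite -zt; apply: pat_refine wz; exact: leq_maxl.
rewrite -yx -(hs w (y j)) ?wt ?yt//; try exact: cellt.
by apply/esym; apply: pat_refine wz; exact: leq_maxr.
Unshelve. all: by end_near. Qed.

Lemma limset_sep m M x y : separating m M -> limset x -> limset y -> lam O m x -> lam O m y ->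
  pat O M x = pat O M y -> x = y.
Proof.
move=> sM xl yl xm ym xy.
have [|z [_ _ _ h]] := limset_cell (t := pat O M x) sM.
  apply: filterS (xl M) => j [w Sw wx]; exists w => //; split=> //.
  apply/set_mem; rewrite (pat_lam (M := M) (y := x)) ?mem_set//; exact: sM.1.
by rewrite (h x)// (h y).
Qed.

(** A precompact set is covered by some [lam O m], where by [limset_sep] each of the finitely many
    patterns belongs to at most one point. *)
Lemma locally_finite_limset : locally_finite limset.
Proof.
move=> D [_ pD]; have [m Dm] := precompact_sub_lam O pD.
have [M _ sM] := exists_separating m 0.
apply: (@sub_finite_set _ _ (limset `&` lam O m)); first exact: setIS.
have [->|/set0P[x0 _]] := eqVneq (limset `&` lam O m) set0; first exact: finite_set0.
have /choice[g gP] : forall t : {ffun 'I_M -> bool}, exists z : X,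
    (exists2 w, (limset `&` lam O m) w & pat O M w = t) ->
    (limset `&` lam O m) z /\ pat O M z = t.
  move=> t; have [[w Aw wt]|n] := pselect (exists2 w, (limset `&` lam O m) w & pat O M w = t).
    by exists w.
  by exists x0.
apply: (sub_finite_set (B := g @` setT)); last by apply: finite_image; exact: finite_finset.
move=> x [xl xm]; exists (pat O M x) => //.
have [|[gl gm] gx] := gP (pat O M x); first by exists x.
exact: (limset_sep sM gl xl gm xm gx).
Qed.

End configuration_limits.

Section configuration_limits_cylinders.
Context {R : realType} {X : topologicalType} {rho : {measure set (fconf X) -> \bar R}}.
Variable O : tame_cover rho.
Variables (U : set_system nat) (g : nat -> conf X).
Context {UU : UltraFilter U}.

Let S j : set X := val (g j).

Hypothesis S_separated : forall i, exists M, \forall j \near U,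
  forall x y, S j x -> S j y -> cellD O i x -> cellD O i y -> pat O M x = pat O M y -> x = y.

Hypothesis S_interior : forall i k, exists J, \forall j \near U,
  forall x, S j x -> cellD O i x -> O k x ->
    exists l, [/\ (l < J)%N, closure (O l) `<=` O k & O l x].

Definition limconf : conf X :=
  exist _ (limset O U S) (mem_set (locally_finite_limset S_separated S_interior)).

Lemma in_cut_set D (c : conf X) x : precompact D ->
  (x \in (cut D c : {fset X})) <-> (val c x /\ D x).
Proof.
move=> pD; rewrite in_cut//; split=> [/andP[/set_mem ? /set_mem ?]//|[? ?]].
by rewrite !mem_set.
Qed.

(** For almost all [j] the same patterns occur inside [lam O m] for [g j] and for the limit, each at
    most once. So the multisets of patterns agree, and these determine membership in a cylinder. *)
Lemma limconf_cyl m M E : cyl O m M E ->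
  \forall j \near U, (g j \in E) = (limconf \in E).
Proof.
move=> [_ cE iE _]; have [M' MM' sM] := exists_separating S_separated m M.
have [mM' sep] := sM; have pl := pre_lam O m.
have h1 : \forall j \near U, forall t : {ffun 'I_M' -> bool},
    (exists2 y, S j y /\ lam O m y & pat O M' y = t) <->
    (exists2 y, limset O U S y /\ lam O m y & pat O M' y = t).
  apply: filter_forall => t.
  have [ht|nt] := pselect (\forall j \near U, exists2 y, S j y /\ lam O m y & pat O M' y = t).
    have [x [xl xm xt _]] := limset_cell S_interior sM ht.
    by apply: filterS ht => j hj; split=> // _; exists x.
  apply: filterS (near_ultra nt) => j hj; split=> // -[x [xl xm] xt].
  case: nt; apply: filterS (xl M') => j' [y Sy yx]; exists y; last by rewrite yx.
  by split=> //; apply/set_mem; rewrite (pat_lam mM' yx) mem_set.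
have h2 : \forall j \near U, forall i : 'I_m, forall x y, S j x -> S j y ->
    cellD O i x -> cellD O i y -> pat O M' x = pat O M' y -> x = y.
  by apply: filter_forall => i; exact: sep.
apply: filterS (filterI h1 h2) => j [hm hs].
suff e : ind E (cut (lam O m) (g j)) = ind E (cut (lam O m) limconf) :> R.
  by rewrite cE [RHS]cE; move: e; rewrite /ind => /eqP; rewrite eqr_nat; case: (_ \in E); case: (_ \in E).
apply: (inv_refine_pat MM' iE); apply: uniq_perm.
- rewrite map_inj_in_uniq ?fset_uniq// => x y /(in_cut_set _ _ pl)[xS xm] /(in_cut_set _ _ pl)[yS ym] xy.
  have [i im xi] := lam_cell xm; apply: (hs (Ordinal im)) => //.
  by apply/set_mem; rewrite -(pat_cellD (leq_trans im mM') xy) mem_set.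
- rewrite map_inj_in_uniq ?fset_uniq// => x y /(in_cut_set _ _ pl)[xS xm] /(in_cut_set _ _ pl)[yS ym].
  exact: (limset_sep S_interior sM).
move=> t; apply/mapP/mapP => -[x /(in_cut_set _ _ pl) xm xt].
  have [y ym yt] := (hm t).1 (ex_intro2 _ _ x xm (esym xt)).
  by exists y => //; exact/(in_cut_set _ _ pl).
have [y ym yt] := (hm t).2 (ex_intro2 _ _ x xm (esym xt)).
by exists y => //; exact/(in_cut_set _ _ pl).
Qed.

End configuration_limits_cylinders.

Section small_events.
Context {R : realType} {X : topologicalType} {rho : {measure set (fconf X) -> \bar R}}.
Variable O : tame_cover rho.
Implicit Types (g : conf X) (E : set (conf X)) (A Z : {fset X}) (F : {fset X} -> R).

Local Notation Ex := (towerE rho (cellD O)).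
Local Notation poly := (@polyc X R (@precompact_borel X)).

Lemma tower1 m : Ex m (fun=> 1) = 1.
Proof.
by rewrite tower_poly ?(corr1 O)//; exact: polyc_cst.
Qed.

Lemma cyl_cell j M E (phi : {fset X} -> bool) : (j < M)%N ->
  (forall g, (g \in E) = phi (cut (cellD O j) g)) ->
  (forall A, phi A = phi (restr (cellD O j) A)) ->
  invar (pat O M) (fun A => (phi A)%:R : R) ->
  cyl O j.+1 M E /\ ind E = (fun A => (phi A)%:R) :> (_ -> R).
Proof.
move=> jM Ephi lphi iphi; have pD : precompact (cellD O j) by case: (cellD_pre O j).
have indE : ind E = (fun A => (phi A)%:R) :> (_ -> R).
  by apply/funext => A; rewrite /ind Ephi cut_conf_of// -lphi.
have cphi : cellfun (cellD O j) (fun A => (phi A)%:R : R).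
  split; [by move=> A; rewrite lphi|exact: measinv_pat iphi|].
  exists 1, 0%N => A; rewrite expr0 mulr1; case: (phi A); by rewrite ?normr1 ?normr0.
split=> //; split=> //; rewrite ?indE//.
  move=> g; rewrite !Ephi cut_conf_of// restr_cut; last exact: pre_lam.
  by rewrite (setIidl _)//; exact: cellD_sub.
apply: (tower_cellfun (tc_fin O) (tc_pd O) (cellD_pre O) (cellD_tame O) (cellD_disj O) (ltnSn j) cphi).
Qed.

(** Markov's inequality within one cell. The majorant is a polynomial, so its value is a
    [rho]-integral, to which dominated convergence applies. *)
Lemma cyl_content_le j M E psi : cyl O j.+1 M E -> cellfun (cellD O j) (ind E : _ -> R) ->
  cellfun (cellD O j) psi -> poly psi -> (forall A, ind E A <= psi A) ->
  cyl_content O E <= corr rho psi.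
Proof.
move=> cE cI cpsi ppsi le; rewrite (cyl_contentE cE).
rewrite -(tower_poly rho (cellD O) j.+1 ppsi).
exact: (tower_markov (tc_fin O) (tc_pd O) (cellD_pre O) (cellD_tame O) (cellD_disj O) (ltnSn j)).
Qed.

Lemma cellfun_cnt D B : borel B -> B `<=` D -> cellfun D (fun A => (cnt B A)%:R : R).
Proof.
move=> bB BD; split.
- by apply: loc_subset (loc_cnt _) => //; exact: BD.
- exact: (measinv_cnt (fun n => n%:R)).
- exists 1, 1%N => A; rewrite mul1r expr1 ger0_norm// -[1]/(1%:R) -natrD ler_nat.
  by rewrite (leq_trans (cnt_le_card B A))// leq_addl.
Qed.

Definition patdet M (B : set X) := forall x y, pat O M x = pat O M y -> (x \in B) = (y \in B).

Lemma cyl_cnt j M B (p : nat -> bool) : (j < M)%N -> B `<=` cellD O j -> patdet M B ->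
  cyl O j.+1 M [set g | p (conf_count B g)] /\
  ind [set g | p (conf_count B g)] = (fun A => (p (cnt B A))%:R) :> (_ -> R).
Proof.
move=> jM BD pB; have pD : precompact (cellD O j) by case: (cellD_pre O j).
have e g : conf_count B g = cnt B (cut (cellD O j) g).
  by rewrite cnt_cut// (setIidl _).
apply: cyl_cell => //.
- by move=> g; rewrite -e; apply/idP/idP => [/set_mem//|h]; exact/mem_set.
- by move=> A; rewrite cnt_restr (setIidl _).
- by move=> A A' AA'; congr ((p _)%:R); exact: (inv_cnt pB).
Qed.

Lemma open_shrink x k : O k x -> exists l, closure (O l) `<=` O k /\ O l x.
Proof.
move=> xk; have cO : compact (closure (O k)) by have := tc_precompact O k; rewrite precompactE.
have nO : nbhs x (O k) by apply: open_nbhs_nbhs; split=> //; exact: tc_open.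
have nK : nbhs x (closure (O k)) by apply: filterS nO; exact: subset_closure.
have [B nB BO] := compact_regular (tc_hausdorff O) cO nK nO.
have [l Ox OB] := tc_base O (@open_interior _ B) nB.
by exists l; split=> //; apply: subset_trans BO; apply: closure_subset; apply: subset_trans OB _; exact: interior_subset.
Qed.

(** The Moebius transform of a count lives on one-point configurations, and at each of them it is
    eventually 0. *)
Lemma rint_injc1_cvg0 (B : nat -> set X) D : precompact_borel D -> (forall n, borel (B n)) ->
  (forall n, B n `<=` D) -> (forall x, \forall n \near \oo, ~ B n x) ->
  corr rho (fun A => (cnt (B n) A)%:R) @[n --> \oo] --> (0 : R).
Proof.
move=> pD bB BD B0; rewrite -(rint0 rho).
have mobE n : mob (fun A => (cnt (B n) A)%:R) = injc_top [:: B n] :> (_ -> R).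
  rewrite (_ : (fun _ => _) = injc [:: B n]); last by apply/funext => A; rewrite cnt_injc1.
  by apply/funext => A; rewrite mob_injc.
rewrite (_ : (fun n => _) = (fun n => rint rho (injc_top [:: B n]))); last first.
  by apply/funext => n; rewrite /corr mobE.
apply: (rint_dominated (g := injc_top [:: D] : fconf X -> R)).
- by move=> n; apply: measurable_injc_top => D'; rewrite inE => /eqP ->.
- by apply: (rintegrable_injc_top (tc_fin O)) => D'; rewrite inE => /eqP ->.
- move=> n A; rewrite /injc_top; case: ifP => _; last by rewrite normr0.
  by rewrite !cnt_injc1 ger0_norm// ler_nat; exact: cnt_le.
move=> A; apply: cvg_near_cst.
have : \forall n \near \oo, forall x : (A : {fset X}), ~ B n (val x) by apply: filter_forall => x.
apply: filterS => n h; rewrite /injc_top; case: ifP => // _; rewrite cnt_injc1.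
rewrite (_ : cnt _ _ = 0%N)//; apply/eqP; rewrite cardfs_eq0; apply/eqP/fsetP => x.
rewrite in_restr inE; case: (boolP (x \in A)) => //= xA.
by apply/negP => /set_mem; exact: (h [` xA]%fset).
Qed.

End small_events.

(** * Merging points *)

Section separating_events.
Context {R : realType} {X : topologicalType} {rho : {measure set (fconf X) -> \bar R}}.
Variable O : tame_cover rho.
Implicit Types (g : conf X) (E : set (conf X)) (A Z : {fset X}) (F : {fset X} -> R).

Local Notation poly := (@polyc X R (@precompact_borel X)).
Local Notation pcell M D := (cell (pat O M) D).

Lemma injc2 (c : set X) A : injc [:: c; c] A = (cnt c A)%:R * (cnt c A)%:R - (cnt c A)%:R :> R.
Proof.
have := @cnt_injc X R c [:: c] A; rewrite cnt_injc1 => ->.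
by rewrite big_cons big_nil addr0 [_.1]/= [_.2]/= cnt_injc1 setIid addrK.
Qed.

(** This counts the ordered pairs of distinct points of [D] with the same pattern of length [M]. *)
Definition pairs D M A : R := \sum_(t : {ffun 'I_M -> bool}) injc [:: pcell M D t; pcell M D t] A.

Lemma pcell_sub M D t : pcell M D t `<=` D. Proof. exact: subIsetr. Qed.

Lemma pcell_borel M D t : borel D -> borel (pcell M D t).
Proof. by move=> bD; apply: borelI => //; exact: pat_borel. Qed.

Lemma cnt_pcell M D A : (cnt D A)%:R = \sum_t (cnt (pcell M D t) A)%:R :> R.
Proof.
rewrite cntR (eq_bigr (fun t => \sum_(x <- A) (x \in pcell M D t)%:R)); last first.
  by move=> t _; rewrite cntR.
rewrite exchange_big; apply: eq_bigr => x _ /=.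
have h t : (x \in [set y | pat O M y = t]) = (pat O M x == t).
  by apply/idP/eqP => [/set_mem//|xt]; exact/mem_set.
rewrite (bigD1 (pat O M x))//= big1 ?addr0 => [|t tx].
  by rewrite /cell in_setI h eqxx.
by rewrite /cell in_setI h eq_sym (negbTE tx).
Qed.

Lemma natr_sq_ge0 n : 0 <= (n%:R * n%:R - n%:R : R).
Proof. by rewrite -natrM subr_ge0 ler_nat; case: n => // n; rewrite leq_pmulr. Qed.

Lemma pairs_ge0 D M A : 0 <= pairs D M A.
Proof. by apply: sumr_ge0 => t _; rewrite injc2 natr_sq_ge0. Qed.

Lemma pairs_le D M A : pairs D M A <= injc [:: D; D] A.
Proof.
rewrite injc2 /pairs (eq_bigr (fun t => (cnt (pcell M D t) A)%:R * (cnt (pcell M D t) A)%:R -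
  (cnt (pcell M D t) A)%:R)) => [|t _]; last exact: injc2.
rewrite sumrB (cnt_pcell M D) lerB//.
suff [] : 0 <= \sum_t (cnt (pcell M D t) A)%:R :> R /\
  \sum_t (cnt (pcell M D t) A)%:R * (cnt (pcell M D t) A)%:R <=
  (\sum_t (cnt (pcell M D t) A)%:R) * (\sum_t (cnt (pcell M D t) A)%:R) :> R by [].
elim/big_rec2 : _ => [|t y1 y2 _ [y10 le]]; first by rewrite mulr0.
have n0 : 0 <= (cnt (pcell M D t) A)%:R :> R by [].
split; first exact: addr_ge0.
have := mulr_ge0 n0 y10; move: n0 le; move: (_%:R : R) => n n0 le h; nra.
Qed.

Lemma pairs_poly D M : precompact_borel D -> poly (pairs D M).
Proof.
move=> [bD pD]; apply: lspan_sum => t _; suff: poly (injc [:: pcell M D t; pcell M D t]) by [].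
apply: polyc_injc => D' D't.
have -> : D' = pcell M D t by move: D't; rewrite !inE => /orP[] /eqP.
split; first exact: pcell_borel.
by apply: precompact_subset pD; exact: pcell_sub.
Qed.

Lemma pairs_cellfun D M : borel D -> cellfun D (pairs D M).
Proof.
move=> bD; rewrite /pairs (_ : (fun _ => _) = (fun A => \sum_t
  ((cnt (pcell M D t) A)%:R * (cnt (pcell M D t) A)%:R - (cnt (pcell M D t) A)%:R))); last first.
  by apply/funext => A; apply: eq_bigr => t _; exact: injc2.
elim: (index_enum _) => [|t r IH].
  rewrite (_ : (fun _ => _) = fun=> 0); first exact: cellfun_cst.
  by apply/funext => A; rewrite big_nil.
rewrite (_ : (fun _ => _) = (fun A => ((cnt (pcell M D t) A)%:R * (cnt (pcell M D t) A)%:R -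
  (cnt (pcell M D t) A)%:R) + \sum_(t <- r)
  ((cnt (pcell M D t) A)%:R * (cnt (pcell M D t) A)%:R - (cnt (pcell M D t) A)%:R))); last first.
  by apply/funext => A; rewrite big_cons.
have c : cellfun D (fun A => (cnt (pcell M D t) A)%:R : R).
  by apply: cellfun_cnt; [exact: pcell_borel|exact: pcell_sub].
by apply: cellfunD => //; apply: cellfunB => //; exact: cellfunM.
Qed.

(** The Moebius transform lives on two-point configurations, and two distinct points have different
    patterns once [n] is large; the number of all ordered pairs in [D] dominates. *)
Lemma pairs_cvg0 D : precompact_borel D -> corr rho (pairs D n) @[n --> \oo] --> (0 : R).
Proof.
move=> pD; have [bD _] := pD; rewrite -(rint0 rho).
have mobE n A : mob (pairs D n) A = if #|` A| == 2%N then pairs D n A else 0.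
  rewrite mob_sum (eq_bigr (fun t => injc_top [:: pcell n D t; pcell n D t] A)); last first.
    by move=> t _; exact: mob_injc.
  by rewrite /injc_top /=; case: ifP => // _; rewrite big1.
apply: (rint_dominated (g := injc_top [:: D; D] : fconf X -> R)).
- by move=> n; apply: measurable_mob; exact: pairs_poly.
- by apply: (rintegrable_injc_top (tc_fin O)) => D'; rewrite !inE => /orP[] /eqP ->.
- move=> n A; rewrite mobE /injc_top; case: ifP => _; last by rewrite normr0.
  by rewrite ger0_norm ?pairs_ge0// pairs_le.
move=> A; apply: cvg_near_cst.
have : \forall n \near \oo, forall p : (A : {fset X}) * (A : {fset X}),
    val p.1 != val p.2 -> pat O n (val p.1) != pat O n (val p.2).
  apply: filter_forall => p; have [->|np] := eqVneq (val p.1) (val p.2).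
    by apply: nearW => n; rewrite eqxx.
  have [m pm] : exists m, pat O m (val p.1) != pat O m (val p.2).
    apply: contrapT => h; move/eqP: np; apply; apply: (@pat_eq _ _ _ O) => m.
    by apply: contrapT => /eqP pm; apply: h; exists m.
  exists m => // n mn _; apply: contra pm => /eqP pn; apply/eqP; exact: pat_refine pn.
apply: filterS => n h; rewrite mobE; case: ifP => // _.
rewrite /pairs big1// => t _; rewrite injc2.
have : (cnt (pcell n D t) A <= 1)%N.
  rewrite leqNgt; apply/negP => c2.
  have [x xA] : exists x, x \in restr (pcell n D t) A.
    by apply/fset0Pn; rewrite -cardfs_gt0; exact: ltnW.
  have [y] : exists y, y \in (restr (pcell n D t) A `\ x)%fset.
    by apply/fset0Pn; rewrite -cardfs_gt0; move: c2; rewrite /cnt (cardfsD1 x) xA.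
  rewrite in_fsetD1 => /andP[yx]; move: xA; rewrite !in_restr => /andP[xA xt] /andP[yA yt].
  have := h ([` xA]%fset, [` yA]%fset); rewrite /= eq_sym => /(_ yx)/eqP; apply.
  by move: xt yt; rewrite !in_setI => /andP[/set_mem <- _] /andP[/set_mem <- _].
by case: (cnt _ _) => [|[|]]// _; rewrite ?mulr0 ?mulr1 subrr.
Qed.

Definition crowded i M : set (conf X) := [set g | exists x y,
  [/\ val g x /\ cellD O i x, val g y /\ cellD O i y, pat O M x = pat O M y & x <> y]].

Lemma crowdedE i M g : (g \in crowded i M) =
  [exists t, (1 < cnt (pcell M (cellD O i) t) (cut (cellD O i) g))%N].
Proof.
have pD : precompact (cellD O i) by case: (cellD_pre O i).
apply/idP/existsP => [/set_mem[x [y [[gx Dx] [gy Dy] xy xNy]]]|[t c2]].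
  exists (pat O M x); apply: (@leq_trans #|` [fset x; y]%fset|).
    by rewrite cardfs2; case: eqP.
  apply: fsubset_leq_card; apply/fsubsetP => z; rewrite in_fset2 in_restr in_cut//.
  by move=> /orP[] /eqP ->; rewrite !mem_set// /cell; split.
have [x xA] : exists x, x \in restr (pcell M (cellD O i) t) (cut (cellD O i) g).
  by apply/fset0Pn; rewrite -cardfs_gt0; exact: ltnW.
have [y] : exists y, y \in (restr (pcell M (cellD O i) t) (cut (cellD O i) g) `\ x)%fset.
  by apply/fset0Pn; rewrite -cardfs_gt0; move: c2; rewrite /cnt (cardfsD1 x) xA.
rewrite in_fsetD1 => /andP[/eqP yx]; move: xA; rewrite !in_restr !in_cut//.
move=> /andP[/andP[/set_mem gx /set_mem Dx] /set_mem[xt _]].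
move=> /andP[/andP[/set_mem gy /set_mem Dy] /set_mem[yt _]].
by apply/mem_set; exists x, y; split=> //; [rewrite /= in xt yt; rewrite xt yt|exact/nesym].
Qed.

(** A crowded configuration has a pair counted by [pairs], so Markov's inequality applies with this
    polynomial. *)
Lemma crowded_cyl i M : (i < M)%N -> cyl O i.+1 M (crowded i M) /\
  cyl_content O (crowded i M) <= corr rho (pairs (cellD O i) M).
Proof.
move=> iM; have pD := cellD_pre O i.
have [cC eC] : cyl O i.+1 M (crowded i M) /\ ind (crowded i M) = (fun A =>
    [exists t, (1 < cnt (pcell M (cellD O i) t) A)%N]%:R) :> (_ -> R).
  apply: cyl_cell => //; first exact: crowdedE.
    move=> A; apply: eq_existsb => t; rewrite cnt_restr setIidl//; exact: pcell_sub.
  move=> A A' AA'; congr (nat_of_bool _)%:R; apply: eq_existsb => t; congr (_ < _)%N.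
  apply: inv_cnt AA' => x y xy; rewrite /cell in_setI [RHS]in_setI (pat_cellD iM xy); congr (_ && _).
  by apply/idP/idP => /set_mem h; apply/mem_set; rewrite /= -h xy.
split=> //; apply: (cyl_content_le cC).
- split; [|exact: measinv_pat (cyl_inv cC)|].
    move=> A; rewrite eC; congr (nat_of_bool _)%:R; apply: eq_existsb => t.
    by rewrite cnt_restr setIidl//; exact: pcell_sub.
  exists 1, 0%N => A; rewrite expr0 mulr1 /ind; case: (_ \in _); by rewrite ?normr1 ?normr0.
- by apply: pairs_cellfun; case: pD.
- exact: pairs_poly.
move=> A; rewrite eC; case: existsP => [[t ct]|_]; last exact: pairs_ge0.
rewrite /pairs (bigD1 t)// -[X in X <= _]addr0 lerD//; last first.
  by apply: sumr_ge0 => t' _; exact: injc_ge0.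
rewrite injc2 -natrM.
move: ct; case: (cnt _ _) => [|[|n]]// _.
by rewrite lerBrDr -natrD ler_nat; nia.
Qed.

End separating_events.

Section content_compactness.
Context {R : realType} {X : topologicalType} {rho : {measure set (fconf X) -> \bar R}}.
Variable O : tame_cover rho.
Implicit Types (g : conf X) (E : set (conf X)).

Definition shrunk k l : set X := if `[< closure (O l) `<=` O k >] then O l else set0.

(* O k is the union of the O l whose closure lies in O k, so that boundary i k J
   decreases to the empty set as J grows. *)
Definition boundary i k J : set X := (cellD O i `&` O k) `\` \bigcup_(l in `I_J) shrunk k l.

Lemma boundary_sub i k J : boundary i k J `<=` cellD O i.
Proof. by move=> x [[]]. Qed.

Lemma boundary_borel i k J : borel (boundary i k J).
Proof.
apply: borelD.
  by apply: borelI; [exact: (cellD_pre O i).1|exact: (O_borel O k).1].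
rewrite bigcup_mkord; apply: borel_bigsetU => l; rewrite /shrunk.
by case: ifP => _; [exact: (O_borel O l).1|exact: borel0].
Qed.

Lemma boundary_patdet i k J M : (i < M)%N -> (k < M)%N -> (J <= M)%N ->
  patdet O M (boundary i k J).
Proof.
move=> iM kM JM; suff h x y : pat O M x = pat O M y -> boundary i k J x -> boundary i k J y.
  by move=> x y xy; apply/idP/idP => /set_mem b; apply/mem_set; apply: h b => //; exact/esym.
move=> xy [[xi xk] xJ]; split.
  split; apply/set_mem; first by rewrite -(pat_cellD iM xy) mem_set.
  by rewrite -((patP O M x y).1 xy)// mem_set.
move=> [l /= lJ yl]; apply: xJ; exists l => //; move: yl; rewrite /shrunk; case: ifP => // _ yl.
by apply/set_mem; rewrite ((patP O M x y).1 xy) ?mem_set//; exact: leq_trans JM.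
Qed.

Lemma boundary_cvg0 i k : corr rho (fun A => (cnt (boundary i k n) A)%:R) @[n --> \oo] --> (0 : R).
Proof.
apply: (rint_injc1_cvg0 O (cellD_pre O i)).
- by move=> n; exact: boundary_borel.
- by move=> n; exact: boundary_sub.
move=> x; have [xk|xk] := pselect (O k x); last by apply: nearW => n [[_]].
have [l [lk xl]] := open_shrink xk; exists l.+1 => // n ln [_]; apply; exists l => //.
by rewrite /shrunk asboolT.
Qed.

Lemma cyl_content_subset E E' : cylinder O E -> cylinder O E' -> E `<=` E' ->
  cyl_content O E <= cyl_content O E'.
Proof.
move=> cE cE' EE'.
have cD : cylinder O (E' `&` ~` E) by apply: cylinderI => //; exact: cylinderC.
rewrite (_ : E' = E `|` (E' `&` ~` E)); last first.
  apply/seteqP; split=> x; last by case=> [/EE'|[]].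
  by have [xE|xE] := pselect (E x); [left|right].
rewrite cyl_content_add//; last by rewrite setIC -setIA setICl setI0.
by rewrite lerDl cyl_content_ge0.
Qed.

Lemma cyl_content_union E E' : cylinder O E -> cylinder O E' ->
  cyl_content O (E `|` E') <= cyl_content O E + cyl_content O E'.
Proof.
move=> cE cE'; have cD : cylinder O (E' `&` ~` E) by apply: cylinderI => //; exact: cylinderC.
rewrite (_ : E `|` E' = E `|` (E' `&` ~` E)); last first.
  apply/seteqP; split=> x; last by case=> [|[]]; [left|right].
  by have [xE|xE] := pselect (E x); [left|move=> [//|]; right].
rewrite cyl_content_add//; last by rewrite setIC -setIA setICl setI0.
by rewrite lerD2l cyl_content_subset//; exact: subIsetl.
Qed.

Lemma cyl_content0 : cyl_content O set0 = 0.
Proof.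
have c0 := @cylinder0 _ _ _ O.
have := cyl_content_add c0 c0 (setI0 _); rewrite setU0 => h.
by apply: (addrI (cyl_content O set0)); rewrite -h addr0.
Qed.

(** Left indices stand for merging in cell [i], right ones for a point of cell [i] in [O k] that
    none of the first [n] cover sets with closure in [O k] contains. The index type is countable, so
    the errors can be made summable. *)
Definition bad (q : nat + nat * nat) n : set (conf X) :=
  match q with
  | inl i => crowded O i n
  | inr (i, k) => [set g | (0 < conf_count (boundary i k n) g)%N]
  end.

Lemma bad_small q e : 0 < e -> exists n, cylinder O (bad q n) /\ cyl_content O (bad q n) <= e.
Proof.
move=> e0; case: q => [i|[i k]] /=.
  have /cvgrPdist_le/(_ _ e0) := pairs_cvg0 O (cellD_pre O i).
  move=> h; have : \forall n \near \oo, (i < n)%N by exact: nbhs_infty_gt.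
  move=> /(filterI h)/filter_ex[n [he iN]]; exists n.
  have [c le] := crowded_cyl O iN; split; first by exists i.+1, n.
  apply: (le_trans le); apply: le_trans he; rewrite sub0r normrN; exact: ler_norm.
have /cvgrPdist_le/(_ _ e0)/filter_ex[n he] := boundary_cvg0 i k; exists n.
pose M := maxn (maxn i.+1 k.+1) n.
have [iM kM nM] : [/\ (i < M)%N, (k < M)%N & (n <= M)%N] by rewrite /M; split; lia.
have [c eC] := cyl_cnt (fun n => (0 < n)%N) iM (@boundary_sub i k n) (boundary_patdet iM kM nM).
split; first by exists i.+1, M.
have ppsi : polyc (@precompact_borel X) (fun A => (cnt (boundary i k n) A)%:R : R).
  apply: polyc_cnt; apply: precompact_borel_sub (cellD_pre O i); first exact: boundary_borel.
  exact: boundary_sub.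
apply: (@le_trans _ _ (corr rho (fun A => (cnt (boundary i k n) A)%:R))); last first.
  by apply: le_trans he; rewrite sub0r normrN; exact: ler_norm.
apply: (cyl_content_le c) => //.
- split; [|exact: measinv_pat (cyl_inv c)|].
    by move=> A; rewrite eC cnt_restr setIidl//; exact: boundary_sub.
  exists 1, 0%N => A; rewrite expr0 mulr1 /ind; case: (_ \in _); by rewrite ?normr1 ?normr0.
- by apply: cellfun_cnt; [exact: boundary_borel|exact: boundary_sub].
- by move=> A; rewrite eC ler_nat; case: (cnt _ _).
Qed.

(** The first [j] bad events have total content at most [e * (1 - 1 / 2 ^+ j)], which is strictly
    below [e], so they cannot cover [A]. This takes finite additivity only. *)
Lemma cylinder_avoid (B : nat -> set (conf X)) (A : set (conf X)) e j :
  (forall q, cylinder O (B q)) -> (forall q, cyl_content O (B q) <= e / 2 ^+ q.+1) ->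
  0 < e -> cylinder O A -> e <= cyl_content O A ->
  exists2 g, A g & forall q, (q < j)%N -> ~ B q g.
Proof.
move=> cB Be e0 cA eA; apply: contrapT => h.
have [cU Ue] : cylinder O (\big[setU/set0]_(q < j) B q) /\
    cyl_content O (\big[setU/set0]_(q < j) B q) <= e * (1 - 1 / 2 ^+ j).
  elim: j {h} => [|j [cU IH]].
    by rewrite big_ord0 expr0 divr1 subrr mulr0 cyl_content0; split=> //; exact: cylinder0.
  rewrite big_ord_recr /=; split; first exact: cylinderU.
  apply: (le_trans (cyl_content_union cU (cB j))).
  apply: (le_trans (lerD IH (Be j))); rewrite exprS.
  have : 2 ^+ j != 0 :> R by rewrite expf_neq0.
  move: (2 ^+ j) => p p0; rewrite [leLHS](_ : _ = e * (1 - 1 / (2 * p)))//.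
  by field; rewrite p0.
have AU : A `<=` \big[setU/set0]_(q < j) B q.
  move=> g Ag; apply: contrapT => nU; apply: h; exists g => // q qj Bq; apply: nU.
  by rewrite -bigcup_mkord; exists q.
have := le_trans eA (le_trans (cyl_content_subset cA cU AU) Ue).
rewrite mulrBr mulr1 lerBrDr gerDl leNgt; move=> /negP; apply.
by rewrite mulr_gt0// divr_gt0// exprn_gt0.
Qed.

(** Choose [g j] in [A j] outside the first [j] bad events. Along an ultrafilter each bad event is
    eventually avoided, so the limit configuration exists; as the [A j] decrease, almost all [g i]
    lie in a given [A j], and by [limconf_cyl] the limit does too. *)
Theorem cylinder_compact (A : nat -> set (conf X)) e : 0 < e ->
  (forall j, cylinder O (A j)) -> (forall j, A j.+1 `<=` A j) ->
  (forall j, e <= cyl_content O (A j)) -> exists g, forall j, A j g.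
Proof.
move=> e0 cA decA eA.
have pos q : 0 < e / 2 ^+ q.+1 by rewrite divr_gt0// exprn_gt0.
(* The bad events are numbered by [choice.pickle]; numbers that decode to nothing stand for the
   event [inl 0]. *)
have [n nP] := choice (fun q : nat => bad_small (odflt (inl 0%N) (choice.unpickle q)) (pos q)).
pose B q := bad (odflt (inl 0%N) (choice.unpickle q)) (n q).
have /choice[g gP] : forall j, exists g, A j g /\ forall q, (q < j)%N -> ~ B q g.
  move=> j; have [||g Ag Bg] := @cylinder_avoid B (A j) e j _ _ e0 (cA j) (eA j).
  - by move=> q; case: (nP q).
  - by move=> q; case: (nP q).
  - by exists g.
have [U [UU infU]] := ultraFilterLemma (eventually_filter : ProperFilter eventually).
have avoid (b : nat + nat * nat) : \forall j \near U, ~ bad b (n (choice.pickle b)) (g j).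
  apply: infU; exists (choice.pickle b).+1 => // j bj.
  by have := (gP j).2 _ bj; rewrite /B choice.pickleK.
have sep i : exists M, \forall j \near U, forall x y, val (g j) x -> val (g j) y ->
    cellD O i x -> cellD O i y -> pat O M x = pat O M y -> x = y.
  exists (n (choice.pickle (inl i : nat + nat * nat))).
  apply: filterS (avoid (inl i)) => j nb x y gx gy xi yi xy; apply: contrapT => nxy.
  by apply: nb; exists x, y.
have int i k : exists J, \forall j \near U, forall x, val (g j) x -> cellD O i x -> O k x ->
    exists l, [/\ (l < J)%N, closure (O l) `<=` O k & O l x].
  exists (n (choice.pickle (inr (i, k) : nat + nat * nat))).
  apply: filterS (avoid (inr (i, k))) => j nb x gx xi xk; apply: contrapT => nl; apply: nb => /=.
  rewrite conf_countE cardfs_gt0; apply/fset0Pn; exists x.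
  have pb : precompact (boundary i k (n (choice.pickle (inr (i, k) : nat + nat * nat)))).
    by apply: precompact_subset (cellD_pre O i).2; exact: boundary_sub.
  rewrite in_cut// mem_set//=; apply/mem_set; split=> // -[l /= lJ]; rewrite /shrunk.
  by case: asboolP => // lk xl; apply: nl; exists l.
exists (limconf sep int) => j; have [m [M cj]] := cA j.
have : \forall i \near U, (j <= i)%N by apply: infU; exact: nbhs_infty_ge.
move=> /(filterI (limconf_cyl sep int cj))/filter_ex[i [gi ji]]; apply/set_mem; rewrite -gi.
suff Aij : A i `<=` A j by apply/mem_set/Aij; exact: (gP i).1.
elim: i ji {gi} => [|i IH]; first by rewrite leqn0 => /eqP ->.
rewrite leq_eqVlt => /predU1P[->//|/IH]; apply: subset_trans; exact: decA.
Qed.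

End content_compactness.

(** * The measure *)

Section cylinder_sigma_algebra.
Context {R : realType} {X : topologicalType} {rho : {measure set (fconf X) -> \bar R}}.
Variable O : tame_cover rho.
Implicit Types (g : conf X) (E : set (conf X)) (A : {fset X}) (B D : set X).

Local Notation pcell M D := (cell (pat O M) D).

(** The Borel sets determined by patterns of some finite length form a pi-system, which generates
    the Borel sets because the cover is a base. The other two hypotheses make [P] a
    lambda-system. *)
Lemma patdet_ind (P : set X -> Prop) :
  (forall M B, patdet O M B -> P B) ->
  (forall A' B : set X, borel A' -> borel B -> A' `<=` B -> P A' -> P B -> P (B `\` A')) ->
  (forall F : nat -> set X, (forall n, borel (F n)) -> nondecreasing_seq F ->
    (forall n, P (F n)) -> P (\bigcup_n F n)) ->
  forall B, borel B -> P B.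
Proof.
move=> Ppat PD PU; pose G : set (set X) := [set B | borel B /\ exists M, patdet O M B].
have GT : G setT by split; [exact: borelT|exists 0%N => x y _; rewrite !in_setT].
have GI : setI_closed G.
  move=> A B [bA [M hA]] [bB [M' hB]]; split; first exact: borelI.
  exists (maxn M M') => x y xy; rewrite !in_setI.
  by congr (_ && _); [apply: hA|apply: hB]; apply: pat_refine xy; rewrite ?leq_maxl ?leq_maxr.
have lP : lambda_system setT [set B | borel B /\ P B].
  split=> //.
  - by split; [exact: borelT|apply: (Ppat 0%N) => x y _; rewrite !in_setT].
  - by move=> A B BA [bA PA] [bB PB]; split; [exact: borelD|exact: PD].
  - move=> F ndF PF; split; first by apply: borel_bigcup => i; case: (PF i).
    by apply: PU => // n; case: (PF n).
have GH : G `<=` [set B | borel B /\ P B] by move=> B [bB [M hB]]; split=> //; exact: Ppat hB.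
move=> B bB; suff /(lambda_system_subset GI lP GH)[] : <<s setT, G >> B by [].
apply: (smallest_sub _ _ bB).
  exact: smallest_sigma_algebra.
move=> A oA; pose F i := if `[< O i `<=` A >] then O i else set0.
rewrite (_ : A = \bigcup_i F i); last first.
  apply/seteqP; split=> x; last first.
    by move=> [i _]; rewrite /F; case: asboolP => // OA /OA.
  by move=> Ax; have [i xi OA] := tc_base O oA Ax; exists i => //; rewrite /F asboolT.
apply: sigma_algebra_bigcup => i; rewrite /F; case: asboolP => _; last exact: sigma_algebra0.
apply: sub_sigma_algebra; split; first exact: (O_borel O i).1.
by exists i.+1 => x y /patP; apply.
Qed.

Lemma pat_cnt_eq m M (T : Type) (Phi : {fset X} -> T) A A' :
  (forall A, Phi A = Phi (restr (lam O m) A)) ->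
  (forall A A', perm_eq (map (pat O M) A) (map (pat O M) A') -> Phi A = Phi A') ->
  (forall t, cnt (pcell M (lam O m) t) A = cnt (pcell M (lam O m) t) A') -> Phi A = Phi A'.
Proof.
move=> lPhi iPhi h; rewrite lPhi [RHS]lPhi; apply: iPhi; apply/allP => t _ /=.
rewrite !count_map; have := h t; rewrite /cell -!cnt_restr !cntE => e.
have e' (Z : {fset X}) : count (preim (pat O M) (pred1 t)) Z =
    count (fun x => x \in [set y | pat O M y = t]) Z.
  by apply: eq_count => x /=; apply/eqP/idP => [xt|/set_mem]; [exact/mem_set|].
by rewrite !e' e.
Qed.

(** The pattern of a point of [lam O m] determines its cell, so no pattern class is cut by two
    cells. This brings the counts of pattern classes under [cyl_cnt]. *)
Lemma pcell_lam m M t : (m <= M)%N -> pcell M (lam O m) t = set0 \/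
  exists i, [/\ (i < m)%N, pcell M (lam O m) t `<=` cellD O i & patdet O M (pcell M (lam O m) t)].
Proof.
move=> mM; have [->|/set0P[x [/= xt /lam_cell[i im xi]]]] := eqVneq (pcell M (lam O m) t) set0.
  by left.
right; exists i; split=> //.
  move=> y [/= yt _]; apply/set_mem; rewrite (pat_cellD (M := M) (y := x)) ?mem_set//.
    exact: leq_trans mM.
  by rewrite yt xt.
move=> y z yz; rewrite /cell in_setI [RHS]in_setI (pat_lam mM yz); congr (_ && _).
by apply/idP/idP => /set_mem /= h; apply/mem_set; rewrite /= -?h// yz.
Qed.

Lemma cyl_setT m M : (m <= M)%N -> cyl O m M setT.
Proof. by move=> mM; rewrite -setC0; apply: cylC; apply: cyl_mono (cyl0 O). Qed.

Lemma cyl_pcell m M t (p : pred nat) : (m <= M)%N ->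
  cyl O m M [set g | p (conf_count (pcell M (lam O m) t) g)].
Proof.
move=> mM; have [->|[i [im ci pc]]] := pcell_lam t mM.
  rewrite (_ : [set _ | _] = if p 0%N then setT else set0).
    by case: (p 0%N); [exact: cyl_setT|apply: cyl_mono (cyl0 O)].
  by apply/seteqP; split=> g /=; rewrite conf_count0; case: (p 0%N).
have [c _] := cyl_cnt p (leq_trans im mM) ci pc.
exact: cyl_mono c.
Qed.

Lemma cyl_counts m M (k : {ffun 'I_M -> bool} -> nat) : (m <= M)%N ->
  cyl O m M [set g | forall t, conf_count (pcell M (lam O m) t) g = k t].
Proof.
move=> mM; rewrite (_ : [set _ | _] = [set g | all (fun t =>
    conf_count (pcell M (lam O m) t) g == k t) (enum {ffun 'I_M -> bool})]); last first.
  apply/seteqP; split=> g /= h; first by apply/allP => t _; rewrite h.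
  by move=> t; apply/eqP; apply: (allP h); rewrite mem_enum.
elim: (enum _) => [|t r IH] /=.
  rewrite (_ : [set _ | _] = setT); first exact: cyl_setT.
  by apply/seteqP; split.
rewrite (_ : [set _ | _] = [set g | conf_count (pcell M (lam O m) t) g == k t] `&`
  [set g | all (fun t => conf_count (pcell M (lam O m) t) g == k t) r]).
  apply: cylI => //; exact: (cyl_pcell t (fun n => n == k t)).
by apply/seteqP; split=> g /=; [move/andP|move=> [-> ->]].
Qed.

(** A cylinder is a union of sets [K k] on which the counts of all pattern classes are prescribed.
    There are countably many profiles [k], and each [K k] is a finite intersection of generators. *)
Lemma cylinder_borel_conf : cylinder O `<=` <<s @conf_gen X >>.
Proof.
move=> E [m [M cE]]; have [mM cutE iE _] := cE.
pose K k : set (conf X) := [set g | forall t, conf_count (pcell M (lam O m) t) g = k t].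
(* [F] runs through the profiles that occur in [E]; all other numbers give the empty set. *)
pose F n : set (conf X) := 
  if (choice.unpickle n : option {ffun {ffun 'I_M -> bool} -> nat}) is Some k then
    (if `[< (K k `&` E) !=set0 >] then K k else set0) else set0.
have KE k g g' : K k g -> K k g' -> E g -> E g'.
  move=> kg kg' Eg; apply/set_mem; rewrite cutE -/(ind E _); move: (mem_set Eg); rewrite cutE.
  rewrite (@pat_cnt_eq m M _ (fun A => conf_of A \in E) _ (cut (lam O m) g'))//.
  - move=> A; have := cyl_loc cE A; rewrite /ind => /eqP; rewrite eqr_nat.
    by case: (_ \in E); case: (_ \in E).
  - move=> A A' /iE /eqP; rewrite /ind eqr_nat.
    by case: (_ \in E); case: (_ \in E).
  have pl := pre_lam O m.
  by move=> t; rewrite !cnt_cut// setIidl ?kg ?kg'// => x [].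
rewrite (_ : E = \bigcup_n F n); last first.
  apply/seteqP; split=> g; last first.
    move=> [n _]; rewrite /F; case: (choice.unpickle n) => [k|]//.
    by case: asboolP => // -[g' [kg' Eg']] kg; exact: KE kg' kg Eg'.
  move=> Eg; pose k : {ffun {ffun 'I_M -> bool} -> nat} :=
    [ffun t => conf_count (pcell M (lam O m) t) g].
  have kg : K k g by move=> t; rewrite ffunE.
  by exists (choice.pickle k) => //; rewrite /F choice.pickleK asboolT//; exists g.
have sC := smallest_sigma_algebra setT (@conf_gen X).
apply: sigma_algebra_bigcup => n; rewrite /F.
case: (choice.unpickle n) => [k|]; last exact: sigma_algebra0.
case: asboolP => _; last exact: sigma_algebra0.
rewrite (_ : K k = \bigcap_(t : {ffun 'I_M -> bool}) [set g | conf_count (pcell M (lam O m) t) g = k t]).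
  apply: (@fin_bigcap_measurable _ (borel_conf X)); first exact: finite_finset.
  move=> t _; apply: sub_sigma_algebra; exists (pcell M (lam O m) t).
    apply: precompact_borel_sub (lam_borel O m); last by move=> x [].
    by apply: pcell_borel; case: (lam_borel O m).
  exists [set k t] => //.
  by apply/seteqP; split=> g //= [].
by apply/seteqP; split=> [g h t _|g h t]; [exact: h|exact: (h t I)].
Qed.

Lemma cnt_near (F : nat -> set X) A : nondecreasing_seq F ->
  \forall n \near \oo, cnt (F n) A = cnt (\bigcup_n F n) A.
Proof.
move=> ndF; have : \forall n \near \oo, forall x : A, (\bigcup_n F n) (val x) -> F n (val x).
  apply: filter_forall => x; have [[i _ Fx]|n] := pselect ((\bigcup_n F n) (val x)).
    by exists i => // j ij _; have /subsetPset := ndF _ _ ij; apply.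
  by apply: nearW => n' /n.
apply: filterS => n h; congr #|` _|; apply/fsetP => x; rewrite !in_restr.
case: (boolP (x \in A)) => //= xA; apply/idP/idP => /set_mem Fx; apply/mem_set; first by exists n.
exact: (h [` xA]%fset).
Qed.

Lemma cntD A D D' : D `<=` D' -> (cnt (D' `\` D) A)%:R = (cnt D' A)%:R - (cnt D A)%:R :> R.
Proof.
move=> DD'; rewrite -{2}(setDUK DD') cntU ?natrD ?setDIK//.
by rewrite addrAC subrr add0r.
Qed.

(** For sets determined by patterns the count splits over the cells into cylinder functions;
    differences and monotone limits reach all Borel sets by [patdet_ind]. Intersecting with
    [lam O m] keeps every count finite. *)
Lemma measurable_conf_countR D : precompact_borel D ->
  measurable_fun setT (fun g : g_sigma_algebraType (cylinder O) => (conf_count D g)%:R : R).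
Proof.
move=> [bD pD]; have [m Dm] := precompact_sub_lam O pD.
pose Y := g_sigma_algebraType (cylinder O).
have pl := pre_lam O.
have cE B m' g : (conf_count (B `&` lam O m') g)%:R = (cnt B (cut (lam O m') g))%:R :> R.
  by rewrite cnt_cut.
rewrite -(setIidl Dm).
apply: (patdet_ind (P := fun B => measurable_fun setT
  (fun g : Y => (conf_count (B `&` lam O m) g)%:R : R)) _ _ _ bD).
- move=> M B hB; elim: (m) => [|m' IH].
    rewrite (_ : (fun _ => _) = fun=> 0); first exact: measurable_cst.
    by apply/funext => g; rewrite lam0 setI0 conf_count0.
  rewrite (_ : (fun _ => _) = (fun g => (conf_count (B `&` lam O m') g)%:R +
    (conf_count (B `&` cellD O m') g)%:R)); last first.
    apply/funext => g; rewrite -natrD; congr _%:R.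
    have e D' : D' `<=` lam O m'.+1 -> conf_count D' g = cnt D' (cut (lam O m'.+1) g).
      by move=> D'L; rewrite cnt_cut// setIidl.
    rewrite !e; do ?by apply: subIset; right; first [exact: subset_refl|exact: lam_mono|exact: cellD_sub].
    by rewrite -cntU -?setIUr -?lamSD// setIACA lam_cellD_disj// setI0.
  apply: measurable_funD => //; apply: measurable_natr; apply: measurable_nat_preimage => k.
  apply: sub_sigma_algebra; pose M' := maxn M m'.+1.
  have mM : (m' < M')%N by rewrite leq_maxr.
  have pB : patdet O M' (B `&` cellD O m').
    move=> x y xy; rewrite in_setI [RHS]in_setI (pat_cellD mM xy); congr (_ && _); apply: hB.
    by apply: pat_refine xy; exact: leq_maxl.
  exists m'.+1, M'; rewrite (_ : [set _ | _] = [set g | conf_count (B `&` cellD O m') g == k]).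
    by apply: (cyl_cnt (fun n => n == k) mM (@subIsetr _ _ _) pB).1.
  by apply/seteqP; split=> g /= /eqP.
- move=> D1 D2 bD1 bD2 D12 m1 m2.
  rewrite (_ : (fun _ => _) = (fun g => (conf_count (D2 `&` lam O m) g)%:R -
    (conf_count (D1 `&` lam O m) g)%:R)); first exact: measurable_funB.
  by apply/funext => g; rewrite !cE cntD.
- move=> F bF ndF mF.
  apply: (@measurable_fun_cvg _ _ _ _ (fun n (g : Y) => (conf_count (F n `&` lam O m) g)%:R)) => //.
  move=> g _; apply: cvg_near_cst; apply: filterS (cnt_near (cut (lam O m) g) ndF) => n h.
  by rewrite !cE h.
Qed.

Lemma g_sigma_cylinder : <<s cylinder O >> = <<s @conf_gen X >>.
Proof.
apply/seteqP; split; apply: smallest_sub; try exact: smallest_sigma_algebra.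
  exact: cylinder_borel_conf.
move=> _ [D pD [Y mY <-]].
have h := measurable_conf_countR pD.
rewrite setTI (_ : _ @^-1` _ = \bigcup_(k in Y) [set g | conf_count D g = k]); last first.
  by apply/seteqP; split=> g; [exists (conf_count D g)|move=> [k Yk /= gk]; rewrite /preimage /= gk].
have : measurable (\bigcup_(k in Y) [set g : g_sigma_algebraType (cylinder O) | conf_count D g = k]).
  apply: bigcup_measurable => k _; have := h measurableT [set (k%:R : R)] (measurable_set1 _).
  rewrite setTI; congr measurable; apply/seteqP; split=> g /=; last by move->.
  by move/eqP; rewrite eqr_nat => /eqP.
exact.
Qed.

End cylinder_sigma_algebra.

(** A copy of [conf X], indexed by the cover, that carries the algebra of cylinders as its
    measurable structure; the extension of measures starts from it. *)
Definition cyl_space {R : realType} {X : topologicalType}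
  {rho : {measure set (fconf X) -> \bar R}} (O : tame_cover rho) : Type := conf X.

Fact cyl_display : measure_display. Proof. exact. Qed.

HB.instance Definition _ (R : realType) (X : topologicalType)
  (rho : {measure set (fconf X) -> \bar R}) (O : tame_cover rho) :=
  Choice.copy (cyl_space O) (conf X).
HB.instance Definition _ (R : realType) (X : topologicalType)
  (rho : {measure set (fconf X) -> \bar R}) (O : tame_cover rho) :=
  Pointed.copy (cyl_space O) (conf X).
HB.instance Definition _ (R : realType) (X : topologicalType)
  (rho : {measure set (fconf X) -> \bar R}) (O : tame_cover rho) :=
  isAlgebraOfSets.Build cyl_display (cyl_space O)
    (@cylinder0 _ _ _ O) (@cylinderU _ _ _ O) (@cylinderC _ _ _ O).

Section cylinder_premeasure.
Context {R : realType} {X : topologicalType} {rho : {measure set (fconf X) -> \bar R}}.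
Variable O : tame_cover rho.

(** The absolute value makes the function nonnegative on all sets, as the measure structure demands;
    on cylinders it changes nothing ([premeasureE]). *)
Definition premeasure (E : set (cyl_space O)) : \bar R := (`|cyl_content O E|)%:E.

Lemma premeasureE E : cylinder O E -> premeasure E = (cyl_content O E)%:E.
Proof. by move=> cE; rewrite /premeasure ger0_norm// cyl_content_ge0. Qed.

Let premeasure0 : premeasure set0 = 0%E.
Proof. by rewrite /premeasure cyl_content0 normr0. Qed.

Let premeasure_ge0 E : (0 <= premeasure E)%E.
Proof. by rewrite lee_fin. Qed.

Lemma cyl_content_bigsetU (F : nat -> set (conf X)) n : (forall i, cylinder O (F i)) ->
  trivIset setT F -> cylinder O (\big[setU/set0]_(i < n) F i) /\
  cyl_content O (\big[setU/set0]_(i < n) F i) = \sum_(0 <= i < n) cyl_content O (F i).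
Proof.
move=> cF tF; elim: n => [|n [cU IH]].
  by rewrite big_ord0 big_nil cyl_content0; split=> //; exact: cylinder0.
rewrite big_ord_recr big_nat_recr//= -IH; split; first exact: cylinderU.
rewrite cyl_content_add// -subset0 => x [+ Fx]; rewrite -bigcup_mkord => -[i /= ni Fix].
move/trivIsetP : tF => /(_ i n I I); rewrite (ltn_eqF ni) => /(_ isT) h.
by have : (F i `&` F n) x by []; rewrite h.
Qed.

(** The remainders of the union are decreasing cylinders with empty intersection; if their contents
    stayed above some [e], [cylinder_compact] would give a point in all of them. *)
Let premeasure_sigma_additive : semi_sigma_additive premeasure.
Proof.
move=> F cF tF cU; rewrite premeasureE//.
pose S n := \big[setU/set0]_(i < n) F i.
pose r n := cyl_content O (\bigcup_n F n `&` ~` S n).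
have cS n : cylinder O (S n) by exact: (cyl_content_bigsetU n cF tF).1.
have cD n : cylinder O (\bigcup_n F n `&` ~` S n) by apply: cylinderI => //; exact: cylinderC.
have SU n : S n `<=` \bigcup_n F n by rewrite /S -bigcup_mkord => x [i _ Fx]; exists i.
have Sn n : \sum_(0 <= i < n) cyl_content O (F i) = cyl_content O (\bigcup_n F n) - r n.
  rewrite -(cyl_content_bigsetU n cF tF).2 -/(S n); apply/eqP; rewrite eq_sym subr_eq; apply/eqP.
  rewrite /r -cyl_content_add//; last by rewrite setICA setICr setI0.
  by rewrite setUIr setUCr setIT (setUidPr _ _).2.
rewrite (_ : (fun n => _) = (fun n => (cyl_content O (\bigcup_n F n) - r n)%:E)); last first.
  by apply/funext => n; rewrite -Sn -sumEFin; apply: eq_bigr => i _; rewrite (premeasureE (cF i)).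
apply: cvg_EFin; first exact: nearW.
rewrite -[X in _ --> X]subr0; apply: cvgB; first exact: cvg_cst.
have S_le n m : (n <= m)%N -> S n `<=` S m.
  by move=> nm; rewrite /S -!bigcup_mkord => x [i /= ni Fx]; exists i => //=; exact: leq_trans nm.
apply/cvgrPdist_lt => e e0.
have [n rn] : exists n, r n < e.
  apply: contrapT => h.
  have [||g Ag] := @cylinder_compact _ _ _ O (fun n => \bigcup_n F n `&` ~` S n) e e0 cD.
  - by move=> j; apply: setIS; apply: subsetC; exact: S_le (leqnSn j).
  - by move=> j; rewrite leNgt; apply/negP => rj; apply: h; exists j.
  have [[i _ Fg] _] := Ag 0%N; have [_] := Ag i.+1; apply.
  by rewrite /S -bigcup_mkord; exists i => /=.
exists n => // m nm; rewrite sub0r normrN ger0_norm; last exact: cyl_content_ge0.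
by apply: le_lt_trans rn; apply: cyl_content_subset => //; apply: setIS; apply: subsetC; exact: S_le.
Qed.

HB.instance Definition _ := isMeasure.Build _ _ _ premeasure
  premeasure0 premeasure_ge0 premeasure_sigma_additive.

(** The extension is taken from the cylinders but regarded as a function on sets of [borel_conf X];
    the two sigma-algebras agree by [g_sigma_cylinder]. *)
Definition conf_measure (A : set (borel_conf X)) : \bar R := measure_extension premeasure A.

Let conf_measure0 : conf_measure set0 = 0%E.
Proof. exact: (measure0 (measure_extension premeasure)). Qed.

Let conf_measure_ge0 A : (0 <= conf_measure A)%E.
Proof. exact: (measure_ge0 (measure_extension premeasure)). Qed.

Let conf_measure_sigma_additive : semi_sigma_additive conf_measure.
Proof.
have m (B : set (conf X)) : <<s @conf_gen X >> B -> <<s cylinder O >> B.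
  by rewrite g_sigma_cylinder.
move=> F mF tF mU; apply: (measure_semi_sigma_additive (s := measure_extension premeasure)) => //.
- by move=> i; exact: m (mF i).
- exact: m mU.
Qed.

HB.instance Definition _ := isMeasure.Build _ _ _ conf_measure
  conf_measure0 conf_measure_ge0 conf_measure_sigma_additive.

Lemma conf_measure_cyl E : cylinder O E -> conf_measure E = (cyl_content O E)%:E.
Proof. by move=> cE; rewrite /conf_measure /measure_extension measurable_mu_extE//= premeasureE. Qed.

Let conf_measureT : conf_measure setT = 1%E.
Proof.
have cT := cyl_setT O (leqnn 0); rewrite conf_measure_cyl; last by exists 0%N, 0%N.
rewrite (cyl_contentE cT) (_ : ind setT = fun=> 1) ?tower1//.
by apply/funext => A; rewrite /ind in_setT.
Qed.

HB.instance Definition _ := Measure_isProbability.Build _ _ _ conf_measure conf_measureT.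

End cylinder_premeasure.

(** * Moments *)

Section square_bounded.
Context {R : realType} {d : measure_display} {T : measurableType d}.
Variable P : probability T R.
Implicit Types f g : T -> R.

Lemma rintegrable_cst (c : R) : rintegrable P (fun=> c).
Proof. by apply: finite_measure_integrable_cst. Qed.

Lemma rintegrable_square f : measurable_fun setT f -> rintegrable P (fun x => f x * f x) ->
  rintegrable P f.
Proof.
move=> mf if2; apply: (rintegrable_le (g := fun x => 1 + f x * f x)) => // [x|].
  by rewrite ler_norml; move: (f x) => y; apply/andP; split; nra.
by apply: rintegrableD => //; exact: rintegrable_cst.
Qed.

Definition damp (dl x : R) : R := x * (1 + (dl * x) ^+ 2)^-1.

Lemma damp_le dl x : 0 < dl -> `|damp dl x| <= dl^-1.
Proof.
move=> d0; have p0 : 0 < 1 + (dl * x) ^+ 2 by rewrite ltr_pwDl// sqr_ge0.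
rewrite /damp normrM normfV (ger0_norm (ltW p0)) ler_pdivrMr// mulrC ler_pdivlMr//.
have -> : (dl * x) ^+ 2 = (`|x| * dl) ^+ 2 by rewrite mulrC !exprMn real_normK ?num_real.
by move: (`|x| * dl) => a; nra.
Qed.

Lemma damp_dist dl x : 0 < dl -> `|x - damp dl x| <= dl * (x * x).
Proof.
move=> d0; have p0 : 0 < 1 + (dl * x) ^+ 2 by rewrite ltr_pwDl// sqr_ge0.
have -> : x - damp dl x = dl * (x * x) * (dl * damp dl x).
  by rewrite /damp; field; rewrite gt_eqF// -expr2 -exprMn.
have x2 : 0 <= dl * (x * x) by rewrite mulr_ge0 ?(ltW d0)// -expr2 sqr_ge0.
rewrite normrM [X in X * _]ger0_norm// ler_piMr//.
by rewrite normrM (ger0_norm (ltW d0)) mulrC -ler_pdivlMr// mul1r damp_le.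
Qed.

Lemma cvg_damp dl (u : nat -> R) l : u n @[n --> \oo] --> l ->
  damp dl (u n) @[n --> \oo] --> damp dl l.
Proof.
move=> ul; apply: cvgM => //; apply: cvgV.
  by rewrite gt_eqF// ltr_pwDl// sqr_ge0.
apply: cvgD; first exact: cvg_cst.
by rewrite expr2; under eq_fun do rewrite expr2; apply: cvgM; apply: cvgMl_tmp.
Qed.

(* The truncation damp dl is bounded and moves x by at most dl * x^2, so that a
   bound on the second moments turns pointwise convergence into convergence of
   the integrals. *)
Lemma rint_cvg_square (F : nat -> T -> R) f M :
  (forall n, measurable_fun setT (F n)) ->
  (forall n, rintegrable P (fun x => F n x * F n x)) ->
  (forall n, rint P (fun x => F n x * F n x) <= M) ->
  (forall x, F n x @[n --> \oo] --> f x) ->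
  [/\ measurable_fun setT f, rintegrable P (fun x => f x * f x), rintegrable P f &
    rint P (F n) @[n --> \oo] --> rint P f].
Proof.
move=> mF iF2 FM Ff; have mf : measurable_fun setT f.
  by apply: (@measurable_fun_cvg _ _ _ _ F) => // x _; exact: Ff.
have [if2 f2M] : rintegrable P (fun x => f x * f x) /\ rint P (fun x => f x * f x) <= M.
  apply: (@rint_fatou _ _ _ P (fun n x => F n x * F n x)) => //.
    by move=> n x; rewrite -expr2 sqr_ge0.
  by move=> x; apply: cvgM; exact: Ff.
have i_f := rintegrable_square mf if2.
have iF n := rintegrable_square (mF n) (iF2 n).
split=> //; have M0 : 0 <= M by apply: le_trans f2M; apply: rint_ge0 => x; rewrite -expr2 sqr_ge0.
apply/cvgrPdist_lt => e e0.
(* The factor 4 leaves room for three errors of size [e / 4]; [M + 1] keeps the denominator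
   positive. *)
pose dl := e / (4 * (M + 1)).
have d0 : 0 < dl by rewrite divr_gt0// mulr_gt0// ltr_wpDl.
have dM : dl * M <= e / 4.
  rewrite /dl invfM mulrA -mulrA ler_piMr//; first by rewrite divr_ge0// ltW.
  by rewrite mulrC ler_pdivrMr ?ltr_wpDl// mul1r lerDl.
have mdamp g : measurable_fun setT g -> measurable_fun setT (fun x => damp dl (g x)).
  move=> mg; apply: (@measurableT_comp _ _ _ _ _ _ (damp dl)) => //.
  apply: continuous_measurable_fun => x; apply: cvgM; first exact: cvg_id.
  apply: cvgV; first by rewrite gt_eqF// ltr_pwDl// sqr_ge0.
  apply: cvgD; first exact: cvg_cst.
  by rewrite expr2; under eq_fun do rewrite expr2; apply: cvgM; apply: cvgMl_tmp; exact: cvg_id.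
have idamp g : measurable_fun setT g -> rintegrable P (fun x => damp dl (g x)).
  move=> mg; apply: (rintegrable_le (g := fun=> dl^-1)); [exact: mdamp|..|exact: rintegrable_cst].
  by move=> x; exact: damp_le.
have close g : measurable_fun setT g -> rintegrable P (fun x => g x * g x) ->
    rint P (fun x => g x * g x) <= M -> `|rint P g - rint P (fun x => damp dl (g x))| <= e / 4.
  move=> mg ig gM; have ig1 := rintegrable_square mg ig.
  rewrite -rintB//; last exact: idamp.
  have i1 : rintegrable P (fun x => g x - damp dl (g x)) by apply: rintegrableB => //; exact: idamp.
  have i2 : rintegrable P (fun x => dl * (g x * g x)) by exact: rintegrableZ.
  have up : rint P (fun x => g x - damp dl (g x)) <= dl * M.
    apply: (@le_trans _ _ (dl * rint P (fun x => g x * g x))); last by rewrite ler_wpM2l// ltW.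
    rewrite -rintZ//; apply: rint_le => // x; apply: (le_trans (ler_norm _)); exact: damp_dist.
  have low : - (dl * M) <= rint P (fun x => g x - damp dl (g x)).
    apply: (@le_trans _ _ (- dl * rint P (fun x => g x * g x))).
      by rewrite mulNr lerN2 ler_wpM2l// ltW.
    rewrite -rintZ//; apply: rint_le => //; first exact: rintegrableZ.
    by move=> x; rewrite mulNr lerNl (le_trans _ (damp_dist (g x) d0))// -normrN ler_norm.
  by rewrite ler_norml; apply/andP; split; lra.
have hcvg : rint P (fun x => damp dl (F n x)) @[n --> \oo] --> rint P (fun x => damp dl (f x)).
  apply: (rint_dominated (g := fun=> dl^-1)).
  - by move=> n; exact: mdamp.
  - exact: rintegrable_cst.
  - by move=> n x; exact: damp_le.
  - by move=> x; apply: cvg_damp; exact: Ff.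
have e4 : 0 < e / 4 by rewrite divr_gt0.
have /cvgrPdist_lt/(_ _ e4) := hcvg; apply: filterS => n hn.
have := close f mf if2 f2M; have := close (F n) (mF n) (iF2 n) (FM n).
move: hn; rewrite !ltr_norml !ler_norml => /andP[? ?] /andP[? ?] /andP[? ?].
by apply/andP; split; lra.
Qed.

End square_bounded.

(** * Integrals of functions of the patterns *)

Section cylinder_functions.
Context {R : realType} {X : topologicalType} {rho : {measure set (fconf X) -> \bar R}}.
Variable O : tame_cover rho.
Variable P : probability (borel_conf X) R.
Hypothesis P_cyl : forall E, cylinder O E -> P E = (cyl_content O E)%:E.
Implicit Types (g : conf X) (A : {fset X}) (Phi : {fset X} -> R).

Local Notation V := (towerV (cellD O) : nat -> set ({fset X} -> R)).
Local Notation Ex := (towerE rho (cellD O)).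
Local Notation pcell M D := (cell (pat O M) D).

Lemma measurable_cylinder E : cylinder O E -> measurable (E : set (borel_conf X)).
Proof. exact: cylinder_borel_conf. Qed.

Lemma P_lty (E : set (borel_conf X)) : cylinder O E -> (P E < +oo)%E.
Proof. by move=> cE; rewrite -[X in (X < _)%E]/(P E) P_cyl// ltry. Qed.

Section fixed_level.
Variables (m M : nat) (Phi : {fset X} -> R).
Hypothesis mM : (m <= M)%N.
Hypothesis lPhi : loc (lam O m) Phi.
Hypothesis iPhi : invar (pat O M) Phi.
Hypothesis VPhi : V m Phi.

Local Notation c := (pcell M (lam O m)).
Local Notation counts N := {ffun {ffun 'I_M -> bool} -> 'I_N.+1}.

Let K N (k : counts N) : set (conf X) := [set g | forall t, conf_count (c t) g = k t].

Let K_cyl N (k : counts N) : cyl O m M (K k).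
Proof. exact: cyl_counts. Qed.

Definition over N t A : R := (N < cnt (c t) A)%N%:R.

(** The indicator that no pattern class in [lam O m] holds more than [N] points; multiplied by it, a
    function of the counts takes finitely many values. *)
Definition bounded N A : R := \prod_(t : {ffun 'I_M -> bool}) (1 - over N t A).

(** The value of [Phi] on the profile [k], read off any configuration with these counts; profiles
    that do not occur get 0. *)
Let val_of N (k : counts N) : R :=
  if pselect (K k !=set0) is left e then Phi (cut (lam O m) (projT1 (cid e))) else 0.

Let pre_c t : precompact (c t).
Proof. by apply: precompact_subset (pre_lam O m) => x []. Qed.

Let indK N (k : counts N) A : ind (K k) A = [forall t, cnt (c t) A == k t]%:R :> R.
Proof.
rewrite /ind; congr (nat_of_bool _)%:R; apply/idP/forallP => [/set_mem h t|h].
  by rewrite -h conf_countE cut_conf_of.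
by apply/mem_set => t; rewrite conf_countE cut_conf_of//; exact: (eqP (h t)).
Qed.

Lemma bounded_sum N A : Phi A * bounded N A = \sum_(k : counts N) val_of k * ind (K k) A.
Proof.
have [[t tN]|h] := pselect (exists t, (N < cnt (c t) A)%N).
  rewrite /bounded (bigD1 t)//= /over tN subrr mul0r mulr0 big1// => k _.
  rewrite indK; case: forallP => [/(_ t)/eqP e|_]; last by rewrite mulr0.
  by move: tN; rewrite e ltnNge -ltnS ltn_ord.
have h' t : (cnt (c t) A <= N)%N by rewrite leqNgt; apply/negP => tN; apply: h; exists t.
rewrite /bounded big1 ?mulr1 => [|t _]; last by rewrite /over ltnNge h' subr0.
pose k0 : counts N := [ffun t => inord (cnt (c t) A)].
have k0E t : (k0 t : nat) = cnt (c t) A by rewrite ffunE inordK ?ltnS ?h'.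
rewrite (bigD1 k0)//= big1 ?addr0 => [|k kk0]; last first.
  rewrite indK; case: forallP => [e|_]; last by rewrite mulr0.
  by case/eqP: kk0; apply/ffunP => t; apply: val_inj; rewrite /= k0E (eqP (e t)).
rewrite indK (_ : [forall t, _]); last by apply/forallP => t; rewrite k0E eqxx.
rewrite mulr1 /val_of; case: pselect => [e|]; last first.
  case; exists (conf_of A) => t; rewrite k0E conf_countE cut_conf_of//.
case: cid => g /= gK; apply: (@pat_cnt_eq _ _ _ O m M _ Phi) => // t.
rewrite cnt_cut; last exact: pre_lam.
by rewrite setIidl ?gK ?k0E// => x [].
Qed.

Let over_V N t : V m (over N t).
Proof.
have := cyl_V (cyl_pcell O t (fun n => (N < n)%N) mM); rewrite (_ : ind _ = over N t)//.
apply/funext => A; rewrite /ind /over; congr (nat_of_bool _)%:R.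
by apply/idP/idP => [/set_mem|h]; [|apply/mem_set]; rewrite /= conf_countE cut_conf_of.
Qed.

Let over_idem N t A : over N t A * over N t A = over N t A.
Proof. by rewrite /over; case: (_ < _)%N; rewrite ?mulr1 ?mulr0. Qed.

(** By [bounded_sum] the function is a finite combination of indicators of cylinders, on which the
    integral and the tower functional agree by [P_cyl]. *)
Lemma bounded_rint N : V m (fun A => Phi A * bounded N A) /\
  rintegrable P (fun g : borel_conf X => Phi (cut (lam O m) g) * bounded N (cut (lam O m) g)) /\
  rint P (fun g : borel_conf X => Phi (cut (lam O m) g) * bounded N (cut (lam O m) g)) =
    Ex m (fun A => Phi A * bounded N A).
Proof.
have VE := tower_O_posfun O m.
have VK (k : counts N) : V m (fun A => val_of k * ind (K k) A).
  by apply: (pf_VZ VE); exact: cyl_V (K_cyl k).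
have e : (fun A => Phi A * bounded N A) = (fun A => \sum_(k : counts N) val_of k * ind (K k) A).
  by apply/funext => A; rewrite bounded_sum.
have [Vs Es] := pf_sum VE (index_enum (counts N)) (P := xpredT) (fun k _ => VK k).
have e' : (fun g : borel_conf X => Phi (cut (lam O m) g) * bounded N (cut (lam O m) g)) =
    (fun g => \sum_(k : counts N) val_of k * \1_(K k) g).
  apply/funext => g; rewrite bounded_sum; apply: eq_bigr => k _; congr (_ * _).
  by rewrite indicE (cyl_cut (K_cyl k)).
have cK (k : counts N) : cylinder O (K k) by exists m, M; exact: K_cyl.
have iK (k : counts N) : rintegrable P (\1_(K k) : borel_conf X -> R).
  by apply: rintegrable_indic; [exact: measurable_cylinder|exact: P_lty].
rewrite e e'; split; first exact: Vs.
rewrite Es; elim: (index_enum _) => [|k r [IH1 IH2]].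
  rewrite (_ : (fun _ => _) = fun=> 0); last by apply/funext => g; rewrite big_nil.
  by rewrite big_nil rint0; split=> //; exact: rintegrable0.
rewrite (_ : (fun _ => _) = (fun g : borel_conf X => val_of k * \1_(K k) g +
  \sum_(k <- r) val_of k * \1_(K k) g)); last by apply/funext => g; rewrite big_cons.
have i1 : rintegrable P (fun g : borel_conf X => val_of k * \1_(K k) g) by exact: rintegrableZ.
split; first exact: rintegrableD.
rewrite rintD// IH2 big_cons; congr (_ + _).
rewrite rintZ// rint_indic; last exact: measurable_cylinder.
rewrite -[X in fine X]/(P (K k)) P_cyl//=.
by rewrite (pf_Z VE) ?(cyl_contentE (K_cyl k))//; exact: cyl_V (K_cyl k).
Qed.

(** Markov's inequality in the cell that contains the pattern class: the indicator is at most the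
    count divided by [N.+1]. *)
Lemma over_cvg0 t : Ex m (over N t) @[N --> \oo] --> (0 : R).
Proof.
have [c0|[i [im ci pc]]] := pcell_lam O t mM.
  apply: cvg_near_cst; apply: nearW => N; rewrite -(pf_0 (tower_O_posfun O m)); congr (Ex m).
  apply/funext => A; rewrite /over c0 (_ : cnt _ _ = 0%N)//.
  by apply/eqP; rewrite cardfs_eq0; apply/eqP/fsetP => x; rewrite in_restr in_set0 andbF.
have bc : borel (c t) by apply: pcell_borel; case: (lam_borel O m).
have pcB : precompact_borel (c t) by split.
apply: (squeeze_cvgr (f := fun=> 0) (h := fun N => corr rho (fun A => (cnt (c t) A)%:R) * N.+1%:R^-1)).
- apply: nearW => N; apply/andP; split.
    rewrite (_ : over N t = (fun A => over N t A * over N t A)).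
      exact: (pf_sq (tower_O_posfun O m)).
    by apply/funext => A; rewrite over_idem.
  have cc := cellfun_cnt bc ci (R := R).
  rewrite -(tower_poly rho (cellD O) m (polyc_cnt (R := R) pcB)) mulrC -(pf_Z (tower_O_posfun O m)); last first.
    exact: (tower_cellfun (tc_fin O) (tc_pd O) (cellD_pre O) (cellD_tame O) (cellD_disj O) im cc).
  apply: (tower_markov (tc_fin O) (tc_pd O) (cellD_pre O) (cellD_tame O) (cellD_disj O) im).
  + apply: cellfun_le cc _.
    * by move=> A; rewrite /over cnt_restr setIidl.
    * exact: (measinv_cnt (fun n => (N < n)%N%:R)).
    move=> A; rewrite /over; case: ltnP => [h|_]; last by rewrite normr0.
    by rewrite normr1 ger0_norm// ler1n; exact: leq_trans h.
  + exact: cellfunZ.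
  move=> A; rewrite /over; case: ltnP => [h|_]; last by rewrite mulr_ge0// invr_ge0.
  by rewrite mulrC ler_pdivlMr ?ltr0n// mul1r ler_nat.
- exact: cvg_cst.
rewrite -[X in _ --> X](mulr0 (corr rho (fun A => (cnt (c t) A)%:R))).
apply: cvgMl_tmp; exact: cvg_harmonic.
Qed.

(** Cauchy-Schwarz with [1 - bounded N], an idempotent whose value is by [pf_union] at most the sum
    of the values of [over]. *)
Lemma bounded_cvg : Ex m (fun A => Phi A * bounded N A) @[N --> \oo] --> Ex m Phi.
Proof.
have VE := tower_O_posfun O m.
have U N := pf_union VE (index_enum {ffun 'I_M -> bool}) (over_V N) (over_idem N).
have Vb N : V m (bounded N) by have [] := U N.
have V1 N : V m (fun A => 1 - bounded N A) by apply: (pf_VB VE) => //; exact: (pf_cst VE).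
have h : Ex m (fun A => (1 - bounded N A) * Phi A) @[N --> \oo] --> (0 : R).
  apply: norm_cvg0; apply: (squeeze_cvgr (f := fun=> 0) (h := fun N =>
    Num.sqrt (\sum_(t : {ffun 'I_M -> bool}) Ex m (over N t)) * Num.sqrt (Ex m (fun A => Phi A * Phi A)))).
  - apply: nearW => N; rewrite normr_ge0 /=; apply: (le_trans (pf_square_le VE (V1 N) VPhi)).
    rewrite ler_wpM2r ?sqrtr_ge0// ler_wsqrtr//; have [_ bb] := U N; apply: le_trans.
    rewrite (_ : (fun A => _) = (fun A => 1 - bounded N A)); last first.
      by apply/funext => A; rewrite mulrBl mul1r mulrBr mulr1 /bounded bb subrr subr0.
    by rewrite (pf_B VE)//; exact: (pf_cst VE).
  - exact: cvg_cst.
  rewrite -[X in _ --> X](mul0r (Num.sqrt (Ex m (fun A => Phi A * Phi A)))).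
  apply: cvgMr_tmp; rewrite -[X in _ --> X]sqrtr0.
  apply: continuous_cvg; first exact: sqrt_continuous.
  elim: (index_enum _) => [|t r IH].
    by apply: cvg_near_cst; apply: nearW => N; rewrite big_nil.
  rewrite -[X in _ --> X]addr0 (_ : (fun N => _) = (fun N => Ex m (over N t) +
    \sum_(t <- r) Ex m (over N t))); last by apply/funext => N; rewrite big_cons.
  by apply: cvgD => //; exact: over_cvg0.
rewrite -[X in _ --> X]subr0 (_ : (fun N => _) = (fun N => Ex m Phi - Ex m (fun A => (1 - bounded N A) * Phi A))).
  by apply: cvgB => //; exact: cvg_cst.
apply/funext => N; rewrite -(pf_B VE)//; last exact: (pf_VM VE).
by congr (Ex m); apply/funext => A; ring.
Qed.

End fixed_level.

(** The cut-off functions converge to [Phi] pointwise and in the tower functional, and their second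
    moments stay below that of [Phi], so [rint_cvg_square] identifies the limit of the integrals. *)
Lemma cyl_moment m M Phi : (m <= M)%N -> loc (lam O m) Phi -> invar (pat O M) Phi -> V m Phi ->
  rintegrable P (fun g : borel_conf X => Phi (cut (lam O m) g)) /\
  rint P (fun g : borel_conf X => Phi (cut (lam O m) g)) = Ex m Phi.
Proof.
move=> mM lPhi iPhi VPhi; have VE := tower_O_posfun O m.
have l2 : loc (lam O m) (fun A => Phi A * Phi A) by exact: (loc_op (fun a b => a * b)).
have i2 : invar (pat O M) (fun A => Phi A * Phi A) by exact: (inv_op (fun a b => a * b)).
have V2 : V m (fun A => Phi A * Phi A) by exact: (pf_VM VE).
have b1 := bounded_rint mM lPhi iPhi; have b2 := bounded_rint mM l2 i2.
have bb N A : bounded m M N A * bounded m M N A = bounded m M N A.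
  rewrite /bounded -big_split; apply: eq_bigr => t _ /=; rewrite /over.
  by case: (_ < _)%N; rewrite ?subrr ?subr0 ?mulr0 ?mulr1.
have sqE N : (fun g : borel_conf X => Phi (cut (lam O m) g) * bounded m M N (cut (lam O m) g) *
    (Phi (cut (lam O m) g) * bounded m M N (cut (lam O m) g))) =
    (fun g => Phi (cut (lam O m) g) * Phi (cut (lam O m) g) * bounded m M N (cut (lam O m) g)).
  by apply/funext => g; rewrite mulrACA bb.
have [] := @rint_cvg_square _ _ _ P
  (fun N (g : borel_conf X) => Phi (cut (lam O m) g) * bounded m M N (cut (lam O m) g))
  (fun g => Phi (cut (lam O m) g)) (Ex m (fun A => Phi A * Phi A)).
- by move=> N; apply: (rintegrable_measurable (mu := P)); case: (b1 N) => _ [].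
- by move=> N; rewrite sqE; case: (b2 N) => _ [].
- move=> N; rewrite sqE; have [VN [_ ->]] := b2 N; rewrite -subr_ge0 -(pf_B VE)//.
  have Vb : V m (fun A => Phi A - Phi A * bounded m M N A).
    by apply: (pf_VB VE) => //; case: (b1 N).
  have := pf_sq VE Vb; congr (0 <= Ex m _); apply/funext => A.
  have := bb N A; move: (Phi A) (bounded _ _ _ _) => x b bbA.
  have -> : (x - x * b) * (x - x * b) = x * x * (1 - b - b + b * b) by ring.
  by rewrite bbA; ring.
- move=> g; apply: cvg_near_cst; near=> N; rewrite /bounded big1 ?mulr1// => t _.
  rewrite /over ltnNge (_ : (_ <= N)%N) ?subr0//.
  apply: (leq_trans (cnt_le_card _ _)); near: N; exact: nbhs_infty_ge.
move=> _ _ i_f hcvg; split=> //.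
have hE := bounded_cvg mM VPhi.
rewrite -(cvg_lim (@Rhausdorff R) hE) -(cvg_lim (@Rhausdorff R) hcvg); congr (limn _).
by apply/funext => N; case: (b1 N) => _ [_ ->].
Unshelve. all: by end_near. Qed.

End cylinder_functions.

Section injc_sets.
Context {K : choiceType} {R : realFieldType}.
Implicit Types (A : {fset K}) (D : set K) (s l : seq (set K)).

(** By the recursion [cnt_injc], [injc s] arises from constants and counts through sums, differences
    and products. *)
Lemma injc_closed (Q : ({fset K} -> R) -> Prop) (C : set (set K)) :
  setI_closed C -> (forall c, Q (fun=> c)) -> (forall D, C D -> Q (fun A => (cnt D A)%:R)) ->
  (forall F G, Q F -> Q G -> Q (fun A => F A - G A)) ->
  (forall F G, Q F -> Q G -> Q (fun A => F A + G A)) ->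
  (forall F G, Q F -> Q G -> Q (fun A => F A * G A)) ->
  forall s, (forall D, D \in s -> C D) -> Q (injc s).
Proof.
move=> CI Q1 Qc QB QD QM s; have [n] := ubnP (size s); elim: n s => // n IH [|D s] ns Cs.
  exact: Q1.
have -> : injc (D :: s) = (fun A => (cnt D A)%:R * injc s A -
    \sum_(p <- picks s) injc (D `&` p.1 :: p.2) A) :> ({fset K} -> R).
  by apply/funext => A; rewrite cnt_injc addrK.
have CD : C D by apply: Cs; rewrite inE eqxx.
apply: (QB).
  by apply: QM; [exact: Qc|apply: IH => // D' D's; apply: Cs; rewrite inE D's orbT].
have h : forall r, {subset r <= picks s} -> Q (fun A => \sum_(p <- r) injc (D `&` p.1 :: p.2) A).
  elim=> [|p r IHr] rs.
    have -> : (fun A => \sum_(p <- [::]) injc (D `&` p.1 :: p.2) A) = (fun=> 0) :> ({fset K} -> R).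
      by apply/funext => A; rewrite big_nil.
    exact: Q1.
  have -> : (fun A => \sum_(p <- p :: r) injc (D `&` p.1 :: p.2) A) = (fun A =>
      injc (D `&` p.1 :: p.2) A + \sum_(p <- r) injc (D `&` p.1 :: p.2) A) :> ({fset K} -> R).
    by apply/funext => A; rewrite big_cons.
  have ps : p \in picks s by apply: rs; rewrite inE eqxx.
  have Cp D' : D' \in p.1 :: p.2 -> C D' by move=> /(mem_picks ps) D's; apply: Cs; rewrite inE D's orbT.
  apply: QD; last by apply: IHr => q qr; apply: rs; rewrite inE qr orbT.
  apply: IH; first by apply: leq_ltn_trans (size_picks_lt ps) _.
  move=> D'; rewrite inE => /orP[/eqP ->|D'p]; last by apply: Cp; rewrite inE D'p orbT.
  by apply: CI => //; apply: Cp; rewrite inE eqxx.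
exact: h.
Qed.

Lemma injc_eq_mem l1 l2 D D' A : {in A, forall x, (x \in D) = (x \in D')} ->
  injc (l1 ++ D :: l2) A = injc (l1 ++ D' :: l2) A :> R.
Proof.
elim: l1 A => [|E l1 IH] A h /=; apply: eq_big_seq => x xA; first by rewrite h.
by congr (_ * _); apply: IH => y; rewrite in_fsetD1 => /andP[_]; exact: h.
Qed.

Lemma injc_setD l1 l2 D D' A : D `<=` D' ->
  injc (l1 ++ (D' `\` D) :: l2) A = injc (l1 ++ D' :: l2) A - injc (l1 ++ D :: l2) A :> R.
Proof.
move=> DD'; elim: l1 A => [|E l1 IH] A /=; rewrite -sumrB; apply: eq_bigr => x _; last first.
  by rewrite IH mulrBr.
rewrite -mulrBl in_setD; congr (_ * _); have [xD|xD] := boolP (x \in D).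
  by rewrite (_ : x \in D') ?subrr//; move: xD => /set_mem/DD'/mem_set.
by rewrite andbT subr0.
Qed.

Lemma injc_subset l1 l2 D D' A : D `<=` D' ->
  injc (l1 ++ D :: l2) A <= injc (l1 ++ D' :: l2) A :> R.
Proof. by move=> DD'; rewrite -subr_ge0 -injc_setD// injc_ge0. Qed.

Lemma injc_near l1 l2 (F : nat -> set K) A : nondecreasing_seq F ->
  \forall n \near \oo, injc (l1 ++ F n :: l2) A = injc (l1 ++ (\bigcup_n F n) :: l2) A :> R.
Proof.
move=> ndF; have : \forall n \near \oo, forall x : A, (val x \in F n) = (val x \in \bigcup_n F n).
  apply: filter_forall => x; have [[i _ Fx]|n] := pselect ((\bigcup_n F n) (val x)).
    exists i => // j ij; have /subsetPset Fij := ndF _ _ ij.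
    by rewrite !mem_set//; [exists i|exact: Fij].
  by apply: nearW => n'; rewrite !memNset// => Fx; apply: n; exists n'.
by apply: filterS => n h; apply: injc_eq_mem => x xA; exact: (h [` xA]%fset).
Qed.

End injc_sets.

Section moments.
Context {R : realType} {X : topologicalType} {rho : {measure set (fconf X) -> \bar R}}.
Variable O : tame_cover rho.
Variable P : probability (borel_conf X) R.
Hypothesis P_cyl : forall E, cylinder O E -> P E = (cyl_content O E)%:E.
Implicit Types (g : conf X) (A : {fset X}) (Phi : {fset X} -> R) (D : set X).

Local Notation V := (towerV (cellD O) : nat -> set ({fset X} -> R)).
Local Notation Ex := (towerE rho (cellD O)).

(** The count is split at the last cell: the part inside is a cell function, and the rest comes from
    the previous level. *)
Lemma tower_cnt m D : borel D -> D `<=` lam O m -> V m (fun A => (cnt D A)%:R).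
Proof.
move=> bD; elim: m D bD => [|m IH] D bD Dm.
  rewrite (_ : (fun _ => _) = fun=> 0); first exact: (pf_cst (tower_O_posfun O 0)).
  apply/funext => A; rewrite (_ : cnt _ _ = 0%N)//; apply/eqP; rewrite cardfs_eq0; apply/eqP/fsetP => x.
  by rewrite in_restr inE; apply/negP => /andP[_ /set_mem/Dm]; rewrite lam0.
rewrite (_ : (fun _ => _) = (fun A => (cnt (D `&` lam O m) A)%:R + (cnt (D `&` cellD O m) A)%:R)); last first.
  apply/funext => A; rewrite -natrD -cntU; last by rewrite setIACA lam_cellD_disj// setI0.
  by rewrite -setIUr -lamSD setIidl.
apply: (pf_VD (tower_O_posfun O m.+1)).
  have l : loc (lam O m) (fun A => (cnt (D `&` lam O m) A)%:R : R).
    by apply: loc_subset (loc_cnt _); exact: subIsetr.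
  apply: (tower_lam (leqnSn m) l _).1; apply: IH; last exact: subIsetr.
  by apply: borelI => //; case: (lam_borel O m).
apply: (tower_cellfun (tc_fin O) (tc_pd O) (cellD_pre O) (cellD_tame O) (cellD_disj O) (ltnSn m)).
by apply: cellfun_cnt; [apply: borelI => //; case: (cellD_pre O m)|exact: subIsetr].
Qed.

Definition local_borel m : set (set X) := [set D | borel D /\ D `<=` lam O m].

Lemma local_borelI m : setI_closed (local_borel m).
Proof.
by move=> A B [bA Am] [bB Bm]; split; [exact: borelI|apply: subset_trans Am; exact: subIsetl].
Qed.

Lemma local_borel_pre m D : local_borel m D -> precompact_borel D.
Proof. by move=> [bD Dm]; exact: precompact_borel_sub (lam_borel O m). Qed.

Lemma tower_injc m s : (forall D, D \in s -> local_borel m D) -> V m (injc s).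
Proof.
have VE := tower_O_posfun O m; apply: (injc_closed (Q := V m) (@local_borelI m)).
- exact: (pf_cst VE).
- by move=> D [bD Dm]; exact: tower_cnt.
- by move=> F G; exact: (pf_VB VE).
- exact: (pf_VD VE).
- exact: (pf_VM VE).
Qed.

Lemma loc_injc m s : (forall D, D \in s -> local_borel m D) -> loc (lam O m) (injc s : _ -> R).
Proof.
apply: (injc_closed (Q := loc (lam O m)) (@local_borelI m)) => //.
- by move=> D [bD Dm]; apply: loc_subset (loc_cnt _).
- by move=> F G; exact: (loc_op (fun a b => a - b)).
- by move=> F G; exact: (loc_op (fun a b => a + b)).
- by move=> F G; exact: (loc_op (fun a b => a * b)).
Qed.

Lemma patdetI M : setI_closed [set D | patdet O M D].
Proof. by move=> A B hA hB x y xy; rewrite !in_setI (hA _ _ xy) (hB _ _ xy). Qed.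

Lemma invar_injc M s : (forall D, D \in s -> patdet O M D) -> invar (pat O M) (injc s : _ -> R).
Proof.
apply: (injc_closed (Q := invar (pat O M)) (@patdetI M)) => //.
- by move=> D hD A A' AA'; congr (_%:R); exact: inv_cnt AA'.
- by move=> F G; exact: (inv_op (fun a b => a - b)).
- by move=> F G; exact: (inv_op (fun a b => a + b)).
- by move=> F G; exact: (inv_op (fun a b => a * b)).
Qed.

Lemma measurable_cut_injc m s : (forall D, D \in s -> local_borel m D) ->
  measurable_fun setT (fun g : borel_conf X => injc s (cut (lam O m) g) : R).
Proof.
apply: (injc_closed (Q := fun F => measurable_fun setT (fun g : borel_conf X => F (cut (lam O m) g) : R))
  (@local_borelI m)).
- by move=> c; exact: measurable_cst.
- move=> D DL; rewrite (_ : (fun _ => _) = (fun g => (conf_count D g)%:R)); last first.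
    by apply/funext => g; rewrite cnt_cut ?setIidl//; [case: DL|exact: pre_lam].
  apply: measurable_natr => _ Y mY; apply: sub_sigma_algebra.
  by exists D; [exact: local_borel_pre DL|exists Y].
- by move=> F G; exact: measurable_funB.
- by move=> F G; exact: measurable_funD.
- by move=> F G; exact: measurable_funM.
Qed.

Lemma pat_injc_moment m M s : (m <= M)%N -> (forall D, D \in s -> local_borel m D) ->
  (forall D, D \in s -> patdet O M D) ->
  rintegrable P (fun g : borel_conf X => injc s (cut (lam O m) g)) /\
  rint P (fun g : borel_conf X => injc s (cut (lam O m) g)) = corr rho (injc s).
Proof.
move=> mM sL sM; have [i e] := cyl_moment P_cyl mM (loc_injc sL) (invar_injc sM) (tower_injc sL).
split=> //; rewrite e tower_poly//; apply: polyc_injc => D /sL; exact: local_borel_pre.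
Qed.

(** The number of points in [lam O m] to the power [size s] dominates; it depends on patterns only,
    so [cyl_moment] shows it integrable. *)
Lemma rintegrable_cut_injc m s : (forall D, D \in s -> local_borel m D) ->
  rintegrable P (fun g : borel_conf X => injc s (cut (lam O m) g)).
Proof.
move=> sL; pose Phi A : R := (cnt (lam O m) A)%:R ^+ size s.
have [i _] : rintegrable P (fun g : borel_conf X => Phi (cut (lam O m) g)) /\
    rint P (fun g : borel_conf X => Phi (cut (lam O m) g)) = Ex m Phi.
  apply: (cyl_moment P_cyl (leqnn m)).
  - by move=> A; rewrite /Phi cnt_restr setIid.
  - move=> A A' AA'; rewrite /Phi; congr (_%:R ^+ _); apply: inv_cnt AA' => x y; exact: pat_lam.
  - rewrite /Phi; elim: (size s) => [|n IH].
      exact: (pf_cst (tower_O_posfun O m)).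
    rewrite (_ : (fun _ => _) = (fun A => (cnt (lam O m) A)%:R * (cnt (lam O m) A)%:R ^+ n)).
      apply: (pf_VM (tower_O_posfun O m)) => //.
      by apply: tower_cnt => //; case: (lam_borel O m).
    by apply/funext => A; rewrite exprS.
apply: rintegrable_le i; first exact: measurable_cut_injc.
move=> g; rewrite ger0_norm ?injc_ge0// /Phi (le_trans (injc_le _ _))//.
by rewrite /cnt restr_cut ?setIid//; exact: pre_lam.
Qed.

Lemma corr_injc s : corr rho (injc s) = rint rho (injc_top s : fconf X -> R).
Proof. by congr (rint rho); apply/funext => A; exact: mob_injc. Qed.

Lemma patdetW M M' D : (M <= M')%N -> patdet O M D -> patdet O M' D.
Proof. by move=> MM' h x y xy; apply: h; exact: pat_refine xy. Qed.

(* Borel sets are reached from the sets determined by patterns one argument of injc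
   at a time, by the pi-lambda theorem. *)
Lemma injc_moment m M t s : (m <= M)%N -> (forall D, D \in t -> local_borel m D /\ patdet O M D) ->
  (forall D, D \in s -> local_borel m D) ->
  rint P (fun g : borel_conf X => injc (t ++ s) (cut (lam O m) g)) = corr rho (injc (t ++ s)).
Proof.
move=> mM; elim: s t M mM => [|D s IH] t M mM tL sL.
  by rewrite cats0; exact: (pat_injc_moment mM (fun D h => (tL D h).1) (fun D h => (tL D h).2)).2.
have [bD Dm] : local_borel m D by apply: sL; rewrite inE eqxx.
have sL' D' : D' \in s -> local_borel m D' by move=> D's; apply: sL; rewrite inE D's orbT.
have bl : borel (lam O m) by case: (lam_borel O m).
have L B : borel B -> forall D', D' \in t ++ (B `&` lam O m) :: s -> local_borel m D'.
  move=> bB D'; rewrite mem_cat inE => /or3P[/tL[]//|/eqP ->|/sL' //].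
  by split; [exact: borelI|exact: subIsetr].
have iP B : borel B ->
    rintegrable P (fun g : borel_conf X => injc (t ++ (B `&` lam O m) :: s) (cut (lam O m) g)).
  by move=> bB; apply: rintegrable_cut_injc; exact: L.
have iR B : borel B -> rintegrable rho (injc_top (t ++ (B `&` lam O m) :: s) : fconf X -> R).
  move=> bB; apply: (rintegrable_injc_top (tc_fin O)) => D' /(L _ bB); exact: local_borel_pre.
have szE B B' : size (t ++ B :: s) = size (t ++ B' :: s) by rewrite !size_cat.
rewrite -(setIidl Dm).
apply: (@patdet_ind _ _ _ O (fun B =>
  rint P (fun g : borel_conf X => injc (t ++ (B `&` lam O m) :: s) (cut (lam O m) g)) =
  corr rho (injc (t ++ (B `&` lam O m) :: s)))) => //.
(* The argument [B] moves from the Borel part [s] to the pattern part [t], with a pattern length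
   that serves both. *)
- move=> M' B hB; rewrite -cat_rcons; apply: (IH _ (maxn M M')) => //.
    by rewrite (leq_trans mM)// leq_maxl.
  move=> D'; rewrite mem_rcons inE => /orP[/eqP ->|/tL[Lh h]]; last first.
    by split=> //; apply: patdetW h; exact: leq_maxl.
  have pB : patdet O (maxn M M') (B `&` lam O m).
    apply: patdetI; first by apply: patdetW hB; exact: leq_maxr.
    by move=> x y; apply: pat_lam; rewrite (leq_trans mM)// leq_maxl.
  split=> //; split; last exact: subIsetr.
  (* A set determined by patterns is a finite union of pattern classes and therefore Borel. *)
  rewrite (_ : _ `&` _ = \big[setU/set0]_(q : {ffun 'I_(maxn M M') -> bool} |
    `[< [set x | pat O (maxn M M') x = q] `<=` B `&` lam O m >]) [set x | pat O (maxn M M') x = q]).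
    by elim/big_ind : _ => [||q _]; [exact: borel0|exact: borelU|exact: pat_borel].
  apply/seteqP; split=> x; rewrite -bigcup_seq_cond.
    move=> Bx; exists (pat O (maxn M M') x) => //=; rewrite mem_index_enum; apply/asboolP => y /= yx.
    by have := pB _ _ yx; rewrite [RHS](mem_set Bx) => /set_mem.
  by move=> [q /= /andP[_ /asboolP h] xq]; exact: h.
- move=> B1 B2 bB1 bB2 B12 hB1 hB2.
  have BBl : B1 `&` lam O m `<=` B2 `&` lam O m by exact: setSI.
  have e : (B2 `\` B1) `&` lam O m = (B2 `&` lam O m) `\` (B1 `&` lam O m).
    apply/seteqP; split=> x; first by move=> [[h nB] xl]; split=> // -[].
    by move=> [[h xl] nB]; split=> //; split=> // Bx; apply: nB.
  rewrite e (_ : (fun g => _) = (fun g : borel_conf X => injc (t ++ (B2 `&` lam O m) :: s) (cut (lam O m) g) -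
    injc (t ++ (B1 `&` lam O m) :: s) (cut (lam O m) g))); last by apply/funext => g; rewrite injc_setD.
  rewrite rintB; [|exact: iP..]; rewrite hB1 hB2 !corr_injc -rintB; [|exact: iR..].
  congr (rint rho); apply/funext => A; rewrite /injc_top (szE (B1 `&` lam O m) (B2 `&` lam O m)).
  rewrite (szE (_ `\` _) (B2 `&` lam O m)).
  by case: ifP => _; rewrite ?subrr// injc_setD.
- move=> F bF ndF hF; rewrite setI_bigcupl.
  have ndF' : nondecreasing_seq (fun n => F n `&` lam O m).
    by move=> i j ij; apply/subsetPset; apply: setSI; apply/subsetPset; exact: ndF.
  have bU : borel (\bigcup_n F n) by exact: borel_bigcup.
  have c1 : rint P (fun g : borel_conf X => injc (t ++ (F n `&` lam O m) :: s) (cut (lam O m) g)) @[n --> \oo] -->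
      rint P (fun g : borel_conf X => injc (t ++ (\bigcup_n (F n `&` lam O m)) :: s) (cut (lam O m) g)).
    apply: (rint_dominated (g := fun g : borel_conf X => injc (t ++ (setT `&` lam O m) :: s) (cut (lam O m) g))).
    + by move=> n; apply: (rintegrable_measurable (mu := P)); exact: iP.
    + by apply: iP; exact: borelT.
    + by move=> n g; rewrite ger0_norm ?injc_ge0// injc_subset//; exact: setSI.
    + by move=> g; apply: cvg_near_cst; exact: injc_near.
  have c2 : rint rho (injc_top (t ++ (F n `&` lam O m) :: s) : fconf X -> R) @[n --> \oo] -->
      rint rho (injc_top (t ++ (\bigcup_n (F n `&` lam O m)) :: s) : fconf X -> R).
    apply: (rint_dominated (g := injc_top (t ++ (setT `&` lam O m) :: s) : fconf X -> R)).
    + by move=> n; apply: (rintegrable_measurable (mu := rho)); exact: iR.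
    + by apply: iR; exact: borelT.
    + move=> n A; rewrite /injc_top (szE (F n `&` lam O m) (setT `&` lam O m)).
      case: ifP => _; last by rewrite normr0.
      by rewrite ger0_norm ?injc_ge0// injc_subset//; exact: setSI.
    + move=> A; apply: cvg_near_cst.
      apply: filterS (injc_near (R := R) t s A ndF') => n h.
      by rewrite /injc_top (szE (F n `&` lam O m) (\bigcup_n (F n `&` lam O m))) h.
  rewrite corr_injc -(cvg_lim (@Rhausdorff R) c2) -(cvg_lim (@Rhausdorff R) c1); congr (limn _).
  by apply/funext => n; rewrite hF corr_injc.
Qed.

Lemma poly_moment F : polyc (@precompact_borel X) F ->
  exists m0, forall m, (m0 <= m)%N ->
    rintegrable P (fun g : borel_conf X => F (cut (lam O m) g)) /\
    rint P (fun g : borel_conf X => F (cut (lam O m) g)) = corr rho F.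
Proof.
elim=> [|a _ f [s sC ->] pf [m0 IH]].
  exists 0%N => m _; rewrite rint0; split; first exact: rintegrable0.
  have h := polyc_cst (R := R) (@precompact_borel X) 0.
  have := corrZ (tc_fin O) 0 h; rewrite [RHS]mul0r => e; rewrite -[LHS]e; congr corr.
  by apply/funext => A; rewrite mul0r.
have pI : polyc (@precompact_borel X) (injc s : _ -> R) by exact: polyc_injc.
have [m1 hm1] : exists m1, forall m, (m1 <= m)%N -> forall D, D \in s -> local_borel m D.
  have [_ pU] := bigcup_seq_precompact sC.
  have [m1 Um1] := precompact_sub_lam O pU.
  exists m1 => m m1m D Ds; split; first by case: (sC _ Ds).
  apply: subset_trans (lam_mono m1m); apply: subset_trans Um1.
  by rewrite -bigcup_seq => x Dx; exists D.
exists (maxn m0 m1) => m; rewrite geq_max => /andP[m0m m1m].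
have [i1 e1] := IH m m0m.
have i2 := rintegrable_cut_injc (hm1 m m1m).
have e2 := injc_moment (t := [::]) (leqnn m) (fun _ => ltac:(by [])) (hm1 m m1m).
split; first by apply: rintegrableD => //; exact: rintegrableZ.
rewrite rintD//; last exact: rintegrableZ.
rewrite rintZ// e1 [rint P _]e2 (corrD (tc_fin O) (F := fun A => a * injc s A)) ?(corrZ (tc_fin O))//.
exact: lspanZ.
Qed.

End moments.

Section class_S.
Context {R : realType} {X : topologicalType} {rho : {measure set (fconf X) -> \bar R}}.
Variable O : tame_cover rho.
Implicit Types (g : conf X) (eta : fconf X) (Q : {fset X} -> R) (G : {mset X}%mset -> R).

Local Notation poly := (@polyc X R (@precompact_borel X)).

Lemma symtens_injc n (D : 'I_n -> set X) eta (en : size (eta : {fset X}) == n) :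
  symtens (fun i => \1_(D i)) (tnth (Tuple en)) = (n`!%:R)^-1 * injc [tuple D i | i < n] eta :> R.
Proof.
rewrite /symtens injc_permutations; last by rewrite size_tuple; exact/eqP.
rewrite -(sum_perm_tuple (eta := Tuple en)) ?fset_uniq//; congr (_ * _).
by apply: eq_bigr => p _; apply: eq_bigr => i _; rewrite tnth_mktuple.
Qed.

(** Up to the factor 1/n!, symmetrized products of indicators are the Moebius transforms [injc_top];
    so a function in S is matched by polynomials degree by degree, on configurations without
    multiple points. *)
Lemma classS_poly G : Defs.classS G -> exists2 Q, poly Q &
  forall eta, G (mset_of_fconf eta) = mob Q eta.
Proof.
move=> [N N0 [GN GS]].
have xE n eta (en : size (eta : {fset X}) == n) : mconf (tnth (Tuple en)) = mset_of_fconf eta.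
  by rewrite /mconf /mset_of_fconf; congr seq_mset; rewrite codomE map_tnth_enum.
suff [Q pQ QG] : exists2 Q, poly Q & forall eta, mob Q eta =
    if (0 < #|` eta| <= N)%N then G (mset_of_fconf eta) else 0.
  (* The value at the empty configuration is arbitrary in S; it is carried by [injc [::]], whose
     Moebius transform is the indicator of the empty set. *)
  exists (fun A => G (mset_of_fconf (fset0 : fconf X)) * injc [::] A + Q A).
    by apply: lspanD => //; apply: lspanZ; exact: polyc_injc.
  move=> eta; rewrite mobD mobZ mob_injc QG /injc_top.
  have [e0|] := posnP #|` eta|.
    by rewrite (cardfs0_eq e0) cardfs0 /= mulr1 addr0.
  move=> e0; rewrite /= mulr0 add0r; case: leqP => // Ne.
  have en : size (eta : {fset X}) == #|` eta| by [].
  by rewrite -(xE _ _ en) GN.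
elim: {-2}N (leqnn N) => [|n IH] nN.
  exists (fun=> 0); first exact: polyc_cst.
  by move=> eta; rewrite mob_cst0; case: posnP => // e; rewrite leqNgt e.
have [Q pQ QG] := IH (ltnW nN).
have [m [c [D [DC GD]]]] := GS n.+1 nN.
exists (fun A => (\sum_(j < m) c j * (n.+1`!%:R)^-1 * injc [tuple D j i | i < n.+1] A) + Q A).
  apply: lspanD => //; apply: lspan_sum => j _.
  apply: lspanZ; suff : poly (injc [tuple D j i | i < n.+1]) by [].
  by apply: polyc_injc => D' /tnthP[i ->]; rewrite tnth_mktuple; exact: DC.
move=> eta; rewrite mobD QG mob_sum.
have e j : mob (fun A => c j * (n.+1`!%:R)^-1 * injc [tuple D j i | i < n.+1] A) eta =
    c j * (n.+1`!%:R)^-1 * injc_top [tuple D j i | i < n.+1] eta.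
  by rewrite mobZ mob_injc.
rewrite (eq_bigr _ (fun j _ => e j)) /injc_top.
have [en|en] := eqVneq #|` eta| n.+1.
  rewrite en ltnn ltn0Sn leqnn addr0 /=.
  have en' : size (eta : {fset X}) == n.+1 by exact/eqP.
  rewrite -(xE _ _ en') GD; apply: eq_bigr => j _.
  by rewrite symtens_injc size_tuple card_ord eqxx mulrA.
rewrite big1 ?add0r => [|j _]; last by rewrite size_tuple (negbTE en) mulr0.
by congr (if _ then _ else _); rewrite [in RHS](leq_eqVlt _ n.+1) (negbTE en).
Qed.

Lemma poly_loc Q : poly Q -> exists m0, forall m, (m0 <= m)%N ->
  loc (lam O m) Q /\ measurable_fun setT (fun g : borel_conf X => Q (cut (lam O m) g)).
Proof.
elim=> [|a _ f [s sC ->] pf [m0 IH]].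
  by exists 0%N => m _; split=> //; exact: measurable_cst.
have [m1 hm1] : exists m1, forall m, (m1 <= m)%N -> forall D, D \in s -> local_borel O m D.
  have [_ pU] := bigcup_seq_precompact sC.
  have [m1 Um1] := precompact_sub_lam O pU.
  exists m1 => m m1m D Ds; split; first by case: (sC _ Ds).
  apply: subset_trans (lam_mono m1m); apply: subset_trans Um1.
  by rewrite -bigcup_seq => x Dx; exists D.
exists (maxn m0 m1) => m; rewrite geq_max => /andP[m0m m1m].
have [l1 mf] := IH m m0m; have l2 := loc_injc (R := R) (hm1 m m1m); split.
  by apply: (loc_op (fun a b => a + b)) => //; apply: (loc_op (fun b _ => a * b) l2 l2).
apply: measurable_funD => //; apply: measurable_funM; first exact: measurable_cst.
exact: measurable_cut_injc (hm1 m m1m).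
Qed.

Lemma cut_loc m m' Q g : (m <= m')%N -> loc (lam O m) Q ->
  Q (cut (lam O m') g) = Q (cut (lam O m) g).
Proof.
move=> mm' lQ; rewrite lQ restr_cut; last exact: pre_lam.
by rewrite setIidl//; exact: lam_mono.
Qed.

(** Finite subsets that leave [lam O m] contribute nothing by [mob_loc], and [zeta_mob] sums the
    others. *)
Lemma sum_finite_sub_cut m Q G g : loc (lam O m) Q ->
  (forall eta, G (mset_of_fconf eta) = mob Q eta) -> sum_finite_sub G g = Q (cut (lam O m) g).
Proof.
move=> lQ GQ; rewrite -[RHS]zeta_mob /sum_finite_sub /zeta.
have pl := pre_lam O m.
rewrite (@fsbigE _ _ _ _ _ (fpowerset (cut (lam O m) g : {fset X}) : seq (fconf X))).
- rewrite big_seq_cond [RHS]big_seq; apply: eq_big => [eta|eta _]; last exact: GQ.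
  apply: andb_idr; rewrite fpowersetE => /fsubsetP ec; apply/mem_set => x /= /ec.
  by rewrite in_cut// => /andP[/set_mem].
- exact: fset_uniq.
- by move=> eta /=; rewrite fpowersetE => /fsubsetP ec x /= /ec; rewrite in_cut// => /andP[/set_mem].
move=> eta /= eg; rewrite fpowersetE => nec; rewrite GQ; apply: (mob_loc lQ) => el.
move/negP: nec; apply; apply/fsubsetP => x xe; rewrite in_cut//.
by rewrite !mem_set//; [exact: el|exact: eg].
Qed.

Lemma cyl_correlation (P : probability (borel_conf X) R) :
  (forall E, cylinder O E -> P E = (cyl_content O E)%:E) -> correlation_measure rho P.
Proof.
move=> P_cyl G /classS_poly[Q pQ GQ].
have iQ := rintegrable_mob (tc_fin O) pQ.
have e : (fun eta => (G (mset_of_fconf eta))%:E) = EFin \o (mob Q : fconf X -> R).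
  by apply/funext => eta; rewrite GQ.
rewrite e; split=> //; rewrite [LHS]EFin_rint//.
have [m0 hm0] := poly_loc pQ; have [m1 hm1] := poly_moment P_cyl pQ.
have [lQ _] := hm0 _ (leq_maxl m0 m1); have [iP eP] := hm1 _ (leq_maxr m0 m1).
rewrite -[rint rho _]/(corr rho Q) -eP -EFin_rint//; apply: eq_integral => g _.
by rewrite (sum_finite_sub_cut _ lQ).
Qed.

End class_S.

(** * Uniqueness *)

Section uniqueness.
Context {R : realType} {X : topologicalType} {rho : {measure set (fconf X) -> \bar R}}.
Variable O : tame_cover rho.
Variable P : probability (borel_conf X) R.
Hypothesis P_corr : correlation_measure rho P.
Implicit Types (g : conf X) (Q Phi : {fset X} -> R).

Local Notation poly := (@polyc X R (@precompact_borel X)).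
Local Notation V := (towerV (cellD O) : nat -> set ({fset X} -> R)).
Local Notation Ex := (towerE rho (cellD O)).

(** The correlation identity gives the value of an integral over configurations; integrability of
    [Q] is derived from the identity for [Q * Q], whose integral is finite. *)
Lemma poly_correlation Q m : poly Q -> loc (lam O m) Q ->
  rintegrable P (fun g : borel_conf X => Q (cut (lam O m) g)) /\
  rint P (fun g : borel_conf X => Q (cut (lam O m) g)) = corr rho Q.
Proof.
move=> pQ lQ.
have int Q' : poly Q' -> loc (lam O m) Q' ->
    (\int[P]_g (Q' (cut (lam O m) g))%:E)%E = (corr rho Q')%:E.
  move=> pQ' lQ'; have [G SG GQ] := polyc_ext pQ'; have [_] := P_corr SG.
  rewrite (eq_integral (fun eta : fconf X => (mob Q' eta)%:E)) => [|eta _]; last by rewrite GQ.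
  rewrite EFin_rint; last exact: (rintegrable_mob (tc_fin O)).
  move=> ->; apply: eq_integral => g _.
  by rewrite (sum_finite_sub_cut _ lQ').
have mQ : measurable_fun setT (fun g : borel_conf X => Q (cut (lam O m) g)).
  have [m0 hm0] := poly_loc O pQ; have [_] := hm0 _ (leq_maxl m0 m).
  rewrite (_ : (fun _ => _) = (fun g : borel_conf X => Q (cut (lam O m) g)))//.
  by apply/funext => g; rewrite (cut_loc _ _ lQ)// leq_maxr.
have iQ : rintegrable P (fun g : borel_conf X => Q (cut (lam O m) g)).
  apply: rintegrable_square => //; apply/integrableP; split.
    by apply/measurable_EFinP; exact: measurable_funM.
  rewrite (eq_integral (fun g : borel_conf X => (Q (cut (lam O m) g) * Q (cut (lam O m) g))%:E)).
    rewrite (int (fun A => Q A * Q A)) ?ltry//; last exact: (loc_op (fun a b => a * b)).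
    by apply: polycM => //; exact: precompact_borelI.
  by move=> g _; rewrite /= ger0_norm// -expr2 sqr_ge0.
split=> //; rewrite /rint /Rintegral; have -> := int Q pQ lQ; by [].
Qed.

Lemma trunc_large D N Phi A : (cnt D A <= N)%N -> trunc D N Phi A = Phi A.
Proof.
move=> AN; rewrite /trunc -[in RHS](restrUC D A).
rewrite -[RHS](zeta_mob (fun B => Phi (B `|` restr (~` D) A)%fset)).
by apply: eq_zeta => Z ZA; rewrite (leq_trans _ AN)// fsubset_leq_card.
Qed.

Lemma trunc_local D D' N Phi : D `<=` D' -> loc D' Phi -> loc D' (trunc D N Phi).
Proof.
move=> DD' lPhi A; have e : restr D (restr D' A) = restr D A by rewrite restrI setIidl.
rewrite /trunc e; apply: eq_zeta => Z _.
case: ifP => // _; apply: eq_mob => B _; rewrite lPhi [RHS]lPhi; congr Phi.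
by rewrite !restr_setU !restrI; congr (_ `|` restr _ _)%fset; rewrite setIAC setIid.
Qed.

(** Truncations in the cell [j] belong to the previous level and are at each configuration
    eventually equal to [Phi]. Their second moments converge by [trunc_mul_cvg], hence are bounded,
    and [rint_cvg_square] passes to the limit. *)
Lemma tower_correlation j m Phi : (j <= m)%N -> V j Phi -> loc (lam O m) Phi ->
  rintegrable P (fun g : borel_conf X => Phi (cut (lam O m) g)) /\
  rint P (fun g : borel_conf X => Phi (cut (lam O m) g)) = Ex j Phi.
Proof.
elim: j Phi => [|j IH] Phi jm; first by move=> pPhi lPhi; exact: poly_correlation.
move=> VPhi lPhi; pose D := cellD O j.
have [VE VQ'] := tower_spec (tc_fin O) (tc_pd O) (cellD_pre O) (cellD_tame O) (cellD_disj O) j.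
have VQ F : poly F -> loc D F -> V j F /\ Ex j F = corr rho F.
  move=> pF lF; apply: VQ' => // i ij; apply: (cell_loc (cellD_disj O)) lF.
  by rewrite gtn_eqF.
have pD : precompact_borel D by exact: cellD_pre.
have tD : tame rho D by exact: cellD_tame.
have VT N : V j (trunc D N Phi) by exact: (stepV_trunc VE pD VQ).
have lT N : loc (lam O m) (trunc D N Phi) by apply: trunc_local => //; exact: cellD_sub.
have IH1 N := IH _ (ltnW jm) (VT N) (lT N).
have VT2 N : V j (fun A => trunc D N Phi A * trunc D N Phi A) by exact: (pf_VM VE).
have lT2 N : loc (lam O m) (fun A => trunc D N Phi A * trunc D N Phi A).
  exact: (loc_op (fun a b => a * b)).
have IH2 N := IH _ (ltnW jm) (VT2 N) (lT2 N).
have [M hM] : exists M, forall N, Ex j (fun A => trunc D N Phi A * trunc D N Phi A) <= M.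
  have VPP : stepV (V j) D (fun A => Phi A * Phi A) by exact: (stepV_M VE).
  have h1 := stepE_cvg (tc_fin O) VE pD tD VQ VPP.
  have h2 := trunc_mul_cvg (tc_fin O) VE pD tD VQ VPhi VPhi.
  have [M [_ hM]] := cvg_seq_bounded (cvgP _ (cvgB h1 h2)).
  exists (M + 1) => N; have /hM/(_ N I) : M < M + 1 by rewrite ltrDl.
  by rewrite /= opprB addrC subrK; exact: le_trans (ler_norm _).
have [] := @rint_cvg_square _ _ _ P (fun N (g : borel_conf X) => trunc D N Phi (cut (lam O m) g))
  (fun g => Phi (cut (lam O m) g)) M.
- by move=> N; apply: (rintegrable_measurable (mu := P)); case: (IH1 N).
- by move=> N; case: (IH2 N).
- by move=> N; case: (IH2 N) => _ ->.
- move=> g; apply: cvg_near_cst; near=> N; apply: trunc_large.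
  apply: (leq_trans (cnt_le_card _ _)); near: N; exact: nbhs_infty_ge.
move=> _ _ i_f hcvg; split=> //.
have h1 := stepE_cvg (tc_fin O) VE pD tD VQ VPhi.
rewrite -[RHS](cvg_lim (@Rhausdorff R) h1) -(cvg_lim (@Rhausdorff R) hcvg); congr (limn _).
by apply/funext => N; case: (IH1 N) => _ ->.
Unshelve. all: by end_near. Qed.

Lemma correlation_cyl E : cylinder O E -> P E = (cyl_content O E)%:E.
Proof.
move=> [m [M cE]]; have mE : measurable (E : set (borel_conf X)).
  by apply: (@cylinder_borel_conf _ _ _ O); exists m, M.
have [_] := tower_correlation (leqnn m) (cyl_V cE) (cyl_loc cE).
rewrite (cyl_contentE cE) => <-.
rewrite (_ : (fun g => _) = \1_E); last by apply/funext => g; rewrite indicE (cyl_cut cE).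
by rewrite rint_indic// fineK// fin_num_measure.
Qed.

End uniqueness.

Theorem corollary1 (R : realType) (X : topologicalType)
    (X_lc : locally_compact [set: X]) (X_sc : @second_countable X)
    (X_T2 : hausdorff_space X)
    (rho : {measure set (fconf X) -> \bar R})
    (rho_N : rho (fconf_card X 0) = 1%E)
    (rho_PD : positive_definite rho)
    (rho_LB : local_bound rho) :
  exists mu : probability (borel_conf X) R,
    correlation_measure rho mu /\
    forall mu' : probability (borel_conf X) R,
      correlation_measure rho mu' ->
      forall A : set (borel_conf X), measurable A -> mu' A = mu A.
Proof.
case: (exists_tame_cover X_lc X_sc X_T2 rho_N rho_PD rho_LB) => C _.
exists (conf_measure C : probability (borel_conf X) R); split.
  by apply: (cyl_correlation (O := C)) => E; exact: conf_measure_cyl.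
move=> mu' mu'_corr A mA.
apply: (@measure_unique _ _ (borel_conf X) (cylinder C) (fun=> setT)) => //.
- by rewrite -[RHS]/(<<s cylinder C >>) g_sigma_cylinder.
- exact: cylinderI.
- by move=> _; exists 0%N, 0%N; exact: cyl_setT.
- by rewrite bigcup_const.
- by move=> E cE; rewrite [LHS](correlation_cyl mu'_corr cE) [RHS]conf_measure_cyl.
- by move=> _; rewrite -[X in (X < _)%E]/(mu' setT) probability_setT ltry.
Qed.
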